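(* Let $\ell, T>0$ and $0<\alpha<1$. Let $p, q\in C^1[0,\ell]$, $a\in C^2[0,\ell]$, and let $u, \widetilde{u} \in W^{1,1}(0,T;L^2(0,\ell)) \cap L^2(0,T; H^2(0,\ell))$ satisfy $$ d_t^{\alpha} u(x,t) = \partial_x^2u(x,t) - p(x)u(x,t), \quad u(x,0) = a(x), \quad \partial_xu(0, t) = 0, \quad 0<x<\ell, \ 0<t<T, $$ and $$ d_t^{\alpha} \widetilde{u}(x,t) = \partial_x^2\widetilde{u}(x,t) - q(x)\widetilde{u}(x,t), \quad \widetilde{u}(x,0) = a(x), \quad \partial_x\widetilde{u}(0, t) = 0, \quad 0<x<\ell, \ 0<t<T. $$ Assume that $|a(x)| \ne 0$ for all $0\le x\le \ell$. If $u(0,t) = \widetilde{u}(0,t)$ for $0<t<T$, then $p(x) = q(x)$ for all $0\le x\le \ell$.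
   Context: For $0<\alpha<1$ the Caputo derivative is $d_t^{\alpha} v(t) = \frac{1}{\Gamma(1-\alpha)}\int^t_0 (t-s)^{-\alpha} \frac{dv}{ds}(s)\, ds$ for $v \in W^{1,1}(0,T)$, where $\Gamma$ is the gamma function; it is applied in the same way in the time variable to functions in $W^{1,1}(0,T;L^2(0,\ell))$. $L^2(0,\ell)$, $H^2(0,\ell)$, $W^{1,1}(0,T;L^2(0,\ell))$, $L^2(0,T;H^2(0,\ell))$ are the usual Lebesgue, Sobolev and Bochner spaces. The equations and boundary identities are understood in the sense natural for this regularity: almost everywhere in $(0,\ell)\times(0,T)$ for the equations, and for almost every $t$ for the boundary traces at $x=0$. No boundary condition is imposed at $x=\ell$. *)

(* Defs.v *)
From HB Require Import structures.
From mathcomp Require Export all_boot all_order all_algebra.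
From mathcomp Require Export all_classical all_reals all_analysis.
Export Order.TTheory GRing.Theory Num.Theory.
Export numFieldNormedType.Exports.

Set Implicit Arguments.
Unset Strict Implicit.
Unset Printing Implicit Defensive.

Local Open Scope classical_set_scope.
Local Open Scope ring_scope.

Section fractional_diffusion.
Context {R : realType}.
Local Notation mu := (@lebesgue_measure R).
Implicit Types (l T alpha c : R) (f g v p a : R -> R) (u w : R -> R -> R).

(* [Ck l k f] is f \in C^k[0,l]: the derivatives up to order k exist in ]0,l[
   and extend continuously to [0,l]. *)
Fixpoint Ck l (k : nat) f : Prop :=
  {within `[0, l], continuous f} /\
  match k with
  | 0 => True
  | k'.+1 => exists2 g, Ck l k' g &
               forall x, x \in `]0, l[ -> is_derive x 1 f (g x)
  end.

Definition Gamma (z : R) : R :=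
  \int[mu]_(s in `]0, +oo[) (s `^ (z - 1) * expR (- s)).

(* C_c^\infty(b,c) *)
Definition test_function (b c : R) (phi : R -> R) : Prop :=
  (forall n x, derivable (derive1n n phi) x 1) /\
  exists b' c', [/\ b < b', c' < c & forall x, x \notin `[b', c'] -> phi x = 0].

(* In all uses f and g are square integrable on ]0,l[, so both integrals
   converge. *)
Definition weak_derivative l f g : Prop :=
  forall phi, test_function 0 l phi ->
    \int[mu]_(x in `]0, l[) (f x * derive1 phi x) =
    - \int[mu]_(x in `]0, l[) (g x * phi x).

(* Value at x = 0 of the continuous representative on [0,l] of the class of f. *)
Definition has_trace0 l f c : Prop :=
  exists g, [/\ {within `[0, l], continuous g},
    {ae mu, forall x, x \in `]0, l[ -> g x = f x} & g 0 = c].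

Definition L2norm l f : \bar R := 'N[mu]_2%:E[(EFin \o f) \_ `]0, l[].

(* A Bochner measurable map from ]0,T[ to the separable space L^2(0,l) is
   represented by a jointly measurable function (x, t) |-> w x t. *)
Definition LpL2 (r : \bar R) l T w : Prop :=
  measurable_fun (`]0, l[ `*` `]0, T[ : set (R * R)) (fun z => w z.1 z.2) /\
  ('N[mu]_r[(fun t => L2norm l (w ^~ t)) \_ `]0%R, T[] < +oo)%E.

(* w is the derivative of u in the sense of L^2(0,l)-valued distributions on
   ]0,T[; the Bochner integrals in t are computed pointwise for a.e. x. *)
Definition weak_dt l T u w : Prop :=
  forall phi, test_function 0 T phi ->
    {ae mu, forall x, x \in `]0, l[ ->
      \int[mu]_(t in `]0, T[) (u x t * derive1 phi t) =
      - \int[mu]_(t in `]0, T[) (w x t * phi t)}.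

Definition weak_dx l T u w : Prop :=
  {ae mu, forall t, t \in `]0, T[ -> weak_derivative l (u ^~ t) (w ^~ t)}.

(* W^{1,1}(0,T; L^2(0,l)), with time derivative ut *)
Definition W11L2_with l T u ut : Prop :=
  [/\ LpL2 1%:E l T u, LpL2 1%:E l T ut & weak_dt l T u ut].

Definition W11L2 l T u : Prop := exists ut, W11L2_with l T u ut.

(* L^2(0,T; H^2(0,l)), with space derivatives ux and uxx *)
Definition L2H2_with l T u ux uxx : Prop :=
  [/\ LpL2 2%:E l T u, LpL2 2%:E l T ux, LpL2 2%:E l T uxx,
      weak_dx l T u ux & weak_dx l T ux uxx].

Definition L2H2 l T u : Prop := exists ux uxx, L2H2_with l T u ux uxx.

(* Value at t = 0, in L^2(0,l), of the representative of u that is continuous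
   from [0,T] to L^2(0,l). *)
Definition has_initial_value l T u a : Prop :=
  exists U : R -> R -> R,
  [/\ forall t, t \in `[0, T] ->
        measurable_fun `]0, l[ (U ^~ t) /\ (L2norm l (U ^~ t) < +oo)%E,
      forall t0, t0 \in `[0, T] ->
        L2norm l (fun x => U x t - U x t0) @[t --> within `[0, T] (nbhs t0)]
          --> 0%E,
      {ae mu, forall t, t \in `]0, T[ ->
        {ae mu, forall x, x \in `]0, l[ -> U x t = u x t}} &
      {ae mu, forall x, x \in `]0, l[ -> U x 0 = a x}].

(* Caputo derivative at time t of a function with derivative dv. *)
Definition caputo alpha (dv : R -> R) (t : R) : R :=
  (Gamma (1 - alpha))^-1 * \int[mu]_(s in `]0, t[) ((t - s) `^ (- alpha) * dv s).

(* The weak derivatives ut, ux, uxx are unique up to null sets. *)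
Definition is_solution l T alpha p a u : Prop :=
  exists ut ux uxx,
  [/\ W11L2_with l T u ut, L2H2_with l T u ux uxx,
      {ae (mu \x mu)%E, forall z : R * R, z.1 \in `]0, l[ -> z.2 \in `]0, T[ ->
        caputo alpha (ut z.1) z.2 = uxx z.1 z.2 - p z.1 * u z.1 z.2},
      has_initial_value l T u a &
      {ae mu, forall t, t \in `]0, T[ -> has_trace0 l (ux ^~ t) 0}].

Definition same_trace0 l T u w : Prop :=
  {ae mu, forall t, t \in `]0, T[ ->
    exists2 c, has_trace0 l (u ^~ t) c & has_trace0 l (w ^~ t) c}.

End fractional_diffusion.

(* Main.v *)
From HB Require Import structures.
Require Import Defs.
From mathcomp Require Import all_boot all_order all_algebra.
From mathcomp Require Import all_classical all_reals all_analysis.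
From mathcomp Require Import measurable_realfun ring lra.
Import Order.TTheory GRing.Theory Num.Theory.
Import numFieldNormedType.Exports.

(** The order alpha of the time derivative can be removed by a change of the
    Laplace variable. Take s with s^alpha = k^2 and let V(x) be
    s * (transform of u(x, .) at s) - a(x). A Caputo derivative transforms
    like s^(alpha-1) times the transform of u_t, so the equation for u
    becomes, in terms of k alone,
    V'' = (k^2 + p) V + p a - a'', with V'(0) = - a'(0).
    Only the interval ]0, T[ is available, which costs an error of the order
    of e^(-sT) (laplace_caputo, laplace_primitive, solution_resolvent).
    Nothing is known at x = l, but Green's formula (green_formula) for the
    Neumann kernel N of k^2 - d^2/dx^2 on the half line shows that the unknown
    data at l influence V(0) by terms of the order of e^(-kl). Hence V(0) is,
    up to powers of s times e^(-kl), the value at 0 of the solution of the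
    integral equation r = N(a'' - p a) + a'(0) N(., 0) - N(p r)
    (resolvent_bound, boundary_value_estimate, boundary_gap).

    The kernel N is in turn the Laplace transform of the fundamental solution
    of the wave equation on the half line with the Neumann condition
    (laplace_wave_kernel), so that r is exactly the Laplace transform, at k,
    of the solution m of a Volterra equation of wave type, built by Picard
    iteration. For the two potentials p and q, the difference d of the two
    families solves a wave equation with source (p - q)(a + m)
    (wave_families, laplace_profile, laplace_difference). If u and v have the
    same trace at x = 0, then the transform of d(0, .) at every large natural
    number k is of the order of e^(-k lam), for every lam < l
    (equal_potentials; powR_rate absorbs the powers of s).

    On the other hand -k times this transform is the transform of
    (p - q) a on ]0, l[ plus that of a function G, which collects the part of
    - d/dt d(0, t) caused by m and d themselves (laplace_trace); by finite
    speed of propagation |G(t)| is bounded by a constant times the integral of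
    |p - q| on ]0, t[.
    The uniqueness theorem for the Laplace transform (laplace_unique) gives
    (p - q) a + G = 0 in the mean on ]0, l[, hence
    |(p - q) a|(t) <= C int_0^t |p - q|; as a does not vanish, Gronwall's
    lemma yields p = q (potential_unique).

    The regularity in the hypotheses is used through integrated identities:
    a function with a trace is the primitive of its weak derivative
    (weak_derivative_FTC, has_trace0_FTC), and u(x, t) is a(x) plus the
    integral of u_t(x, .) on ]0, t[ (initial_value_FTC). *)

Set Implicit Arguments.
Unset Strict Implicit.
Unset Printing Implicit Defensive.

Local Open Scope classical_set_scope.
Local Open Scope ring_scope.

(** * Real-valued integrals *)

Section real_integrals.
Context d (T : measurableType d) (R : realType).
Context (mu : {measure set T -> \bar R}).
Implicit Types (D : set T) (f g : T -> R).

Lemma integrable_le D f g : measurable D -> measurable_fun D f ->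
  mu.-integrable D (EFin \o g) -> (forall x, D x -> `|f x| <= g x) ->
  mu.-integrable D (EFin \o f).
Proof.
move=> mD mf ig fg; apply: (le_integrable mD _ _ ig); first exact/measurable_EFinP.
move=> x Dx /=; rewrite lee_fin (le_trans (fg x Dx))// ler_norm//.
Qed.

Lemma integrable_cst_lty D (k : R) : measurable D -> (mu D < +oo)%E ->
  mu.-integrable D (EFin \o cst k).
Proof.
move=> mD Dy; apply: measurable_bounded_integrable => //.
exact: bounded_cst.
Qed.

Lemma integrable_bnd D f (M : R) : measurable D -> (mu D < +oo)%E ->
  measurable_fun D f -> (forall x, D x -> `|f x| <= M) ->
  mu.-integrable D (EFin \o f).
Proof.
move=> mD Dy mf fM; apply: (@integrable_le D f (cst M)) => //.
exact: integrable_cst_lty.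
Qed.

Lemma integrable_measurable D f : mu.-integrable D (EFin \o f) ->
  measurable_fun D f.
Proof. by case/integrableP => /measurable_EFinP. Qed.

Lemma normr_Rint_le D f g : measurable D -> measurable_fun D f ->
  mu.-integrable D (EFin \o g) -> (forall x, D x -> `|f x| <= g x) ->
  `|\int[mu]_(x in D) f x| <= \int[mu]_(x in D) g x.
Proof.
move=> mD mf ig fg; have fi := integrable_le mD mf ig fg.
apply: (le_trans (le_normr_Rintegral mD fi)).
by apply: le_Rintegral => //; exact: integrable_norm.
Qed.

Lemma normr_Rint_bnd D f (M : R) : measurable D -> (mu D < +oo)%E ->
  measurable_fun D f -> (forall x, D x -> `|f x| <= M) ->
  `|\int[mu]_(x in D) f x| <= M * fine (mu D).
Proof.
move=> mD Dy mf fM; rewrite -Rintegral_cst//.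
apply: normr_Rint_le => //; exact: integrable_cst_lty.
Qed.

Lemma ae_eq_Rint D f g : measurable D -> measurable_fun D f ->
  measurable_fun D g -> {ae mu, forall x, D x -> f x = g x} ->
  \int[mu]_(x in D) f x = \int[mu]_(x in D) g x.
Proof.
move=> mD mf mg fg; congr fine; apply: ae_eq_integral => //.
- exact/measurable_EFinP.
- exact/measurable_EFinP.
- by apply: filterS fg => x fg Dx; rewrite fg.
Qed.

Lemma integrableMb D f g (M : R) : measurable D -> measurable_fun D f ->
  mu.-integrable D (EFin \o g) -> (forall x, D x -> `|f x| <= M) ->
  mu.-integrable D (EFin \o (fun x => f x * g x)).
Proof.
move=> mD mf ig fM.
have mg := integrable_measurable ig.
apply: (@integrable_le _ _ (fun x => M * `|g x|)) => //.
- exact: measurable_funM.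
- have := integrableZl mD M (integrable_norm ig).
  by apply: eq_integrable => // x _ /=.
- by move=> x Dx; rewrite normrM ler_wpM2r// fM.
Qed.

Lemma RintN D f : measurable D -> mu.-integrable D (EFin \o f) ->
  \int[mu]_(x in D) - f x = - \int[mu]_(x in D) f x.
Proof.
move=> mD fi; rewrite -mulN1r -RintegralZl//.
by apply: eq_Rintegral => x _; rewrite mulN1r.
Qed.

Lemma integrable_addr D f g : measurable D -> mu.-integrable D (EFin \o f) ->
  mu.-integrable D (EFin \o g) ->
  mu.-integrable D (EFin \o (fun x => f x + g x)).
Proof.
by move=> mD fi gi; apply: eq_integrable (integrableD mD fi gi).
Qed.

Lemma integrable_subr D f g : measurable D -> mu.-integrable D (EFin \o f) ->
  mu.-integrable D (EFin \o g) ->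
  mu.-integrable D (EFin \o (fun x => f x - g x)).
Proof.
by move=> mD fi gi; apply: eq_integrable (integrableB mD fi gi).
Qed.

Lemma integrable_mull D f (k : R) : measurable D -> mu.-integrable D (EFin \o f) ->
  mu.-integrable D (EFin \o (fun x => k * f x)).
Proof.
by move=> mD fi; apply: eq_integrable (integrableZl mD k fi).
Qed.

Lemma integrable_ext D f g : measurable D -> mu.-integrable D (EFin \o f) ->
  (forall x, D x -> f x = g x) -> mu.-integrable D (EFin \o g).
Proof.
move=> mD fi fg; apply: eq_integrable fi => // x /set_mem Dx /=.
by rewrite fg.
Qed.

Lemma EFin_Rint D f : measurable D -> mu.-integrable D (EFin \o f) ->
  (\int[mu]_(x in D) f x)%:E = (\int[mu]_(x in D) (f x)%:E)%E.
Proof. by move=> mD fi; rewrite fineK//; exact: integrable_fin_num. Qed.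

Lemma ae_le_Rint D f g : measurable D -> mu.-integrable D (EFin \o f) ->
  mu.-integrable D (EFin \o g) -> {ae mu, forall x, D x -> f x <= g x} ->
  \int[mu]_(x in D) f x <= \int[mu]_(x in D) g x.
Proof.
move=> mD fi gi fg.
have mf := integrable_measurable fi; have mg := integrable_measurable gi.
pose h x := Num.min (f x) (g x).
have mh : measurable_fun D h by exact: (measurable_minr mf mg).
have hi : mu.-integrable D (EFin \o h).
  apply: (@integrable_le _ _ (fun x => `|f x| + `|g x|)) => //.
    by apply: integrable_addr => //; exact: integrable_norm.
  move=> x _; rewrite /h; have [_|_] := leP (f x) (g x).
  - by rewrite lerDl.
  - by rewrite lerDr.
rewrite (@ae_eq_Rint D f h)//; last first.
  by apply: filterS fg => x fg Dx; rewrite /h min_l// fg.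
by apply: le_Rintegral => // x _; rewrite /h ge_min lexx orbT.
Qed.

Lemma Rint_eq0_ae D f : measurable D -> mu.-integrable D (EFin \o f) ->
  (forall x, D x -> 0 <= f x) -> \int[mu]_(x in D) f x <= 0 ->
  {ae mu, forall x, D x -> f x = 0}.
Proof.
move=> mD fi f0 If.
have mf := integrable_measurable fi.
have : (\int[mu]_(x in D) `|(EFin \o f) x| = 0)%E.
  rewrite (eq_integral (fun x => (f x)%:E)); last first.
    by move=> x /set_mem Dx /=; rewrite ger0_norm// f0.
  rewrite -EFin_Rint//; congr EFin; apply/eqP; rewrite eq_le If/=.
  exact: Rintegral_ge0.
have mEf : measurable_fun D (EFin \o f) by exact/measurable_EFinP.
move/(ae_eq_integral_abs mu mD mEf).1.
by apply: filterS => x /[apply] -[].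
Qed.

End real_integrals.

(** * Integrals of functions of two variables *)

Section fubini_rectangles.
Context d1 d2 (T1 : measurableType d1) (T2 : measurableType d2) (R : realType).
Context (m1 : {sigma_finite_measure set T1 -> \bar R}).
Context (m2 : {sigma_finite_measure set T2 -> \bar R}).
Implicit Types (A : set T1) (B : set T2) (f : T1 -> T2 -> R).

Lemma patch_rect A B f x y :
  ((fun z => f z.1 z.2) \_ (A `*` B)) (x, y) =
  ((fun x => (f x \_ B) y) \_ A) x.
Proof.
rewrite !patchE/=; have [xA|xA] := boolP (x \in A); have [yB|yB] := boolP (y \in B).
- by rewrite ifT// in_setX xA yB.
- by rewrite ifF// in_setX xA (negbTE yB).
- by rewrite ifF// in_setX (negbTE xA).
- by rewrite ifF// in_setX (negbTE xA).
Qed.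

Lemma Rint_patch2 A B f :
  \int[m1]_(x in A) \int[m2]_(y in B) f x y =
  \int[m1]_x \int[m2]_y ((fun z => f z.1 z.2) \_ (A `*` B)) (x, y).
Proof.
rewrite Rintegral_mkcond; apply: eq_Rintegral => x _.
rewrite patchE; case: ifPn => xA; last first.
  rewrite (@eq_Rintegral _ _ _ _ _ (cst 0))//.
    by rewrite Rintegral_cst// mul0r.
  by move=> y _; rewrite patch_rect patchE (negbTE xA).
rewrite Rintegral_mkcond; apply: eq_Rintegral => y _.
by rewrite patch_rect [RHS]patchE xA.
Qed.

Lemma Rint_patch2' A B f :
  \int[m2]_(y in B) \int[m1]_(x in A) f x y =
  \int[m2]_y \int[m1]_x ((fun z => f z.1 z.2) \_ (A `*` B)) (x, y).
Proof.
rewrite Rintegral_mkcond; apply: eq_Rintegral => y _.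
rewrite patchE; case: ifPn => yB; last first.
  rewrite (@eq_Rintegral _ _ _ _ _ (cst 0))//.
    by rewrite Rintegral_cst// mul0r.
  by move=> x _; rewrite patch_rect patchE; case: ifP => // _; rewrite patchE (negbTE yB).
rewrite Rintegral_mkcond; apply: eq_Rintegral => x _.
by rewrite patch_rect 2!patchE; case: ifP => // _; rewrite patchE yB.
Qed.

Lemma integrable_rectP A B f : measurable A -> measurable B ->
  (m1 \x m2)%E.-integrable (A `*` B) (EFin \o (fun z => f z.1 z.2)) <->
  (m1 \x m2)%E.-integrable setT (EFin \o ((fun z => f z.1 z.2) \_ (A `*` B))).
Proof.
by move=> mA mB; rewrite -restrict_EFin; exact: (integrable_mkcond _ (measurableX mA mB)).
Qed.

Let Rint_fubini_F (g : T1 * T2 -> R) :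
  (m1 \x m2)%E.-integrable setT (EFin \o g) ->
  (\int[m1]_x \int[m2]_y g (x, y)%R)%R%:E =
  (\int[m1]_x \int[m2]_y (g (x, y))%:E)%E /\
  m1.-integrable setT (EFin \o (fun x => \int[m2]_y g (x, y))).
Proof.
move=> gi.
have ig := integrable_fubini_F gi.
have aeE : ae_eq m1 setT (fubini_F m2 (EFin \o g))
   (EFin \o (fun x => \int[m2]_y g (x, y))).
  have := ae_integrable1 gi; apply: filterS => x gx _ /=.
  by rewrite EFin_Rint.
have ig' : m1.-integrable setT (EFin \o (fun x => \int[m2]_y g (x, y))).
  have mF : measurable_fun setT (fubini_F m2 (EFin \o g)).
    exact: measurable_int ig.
  have mF' : measurable_fun setT (EFin \o (fun x => \int[m2]_y g (x, y))).
    apply/measurable_EFinP; exact: (measurableT_comp (fine_measurable measurableT)).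
  apply/integrableP; split => //.
  case/integrableP : ig => _; rewrite (@ae_eq_integral _ _ _ m1 setT
     (abse \o fubini_F m2 (EFin \o g))
     (abse \o (EFin \o (fun x => \int[m2]_y g (x, y)))))//.
  - exact: measurableT_comp.
  - exact: measurableT_comp.
  - by apply: filterS aeE => x + Dx => /(_ Dx)/= ->.
split => //; rewrite EFin_Rint//.
apply: ae_eq_integral => //.
- exact: measurable_int ig'.
- exact: measurable_int ig.
- by apply: filterS aeE => x + Dx => /(_ Dx).
Qed.

Let Rint_fubini_G (g : T1 * T2 -> R) :
  (m1 \x m2)%E.-integrable setT (EFin \o g) ->
  (\int[m2]_y \int[m1]_x g (x, y)%R)%R%:E =
  (\int[m2]_y \int[m1]_x (g (x, y))%:E)%E /\
  m2.-integrable setT (EFin \o (fun y => \int[m1]_x g (x, y))).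
Proof.
move=> gi.
have ig : m2.-integrable setT (fubini_G m1 (EFin \o g)).
  have mG := measurable_fubini_G gi.
  apply/integrableP; split => //.
  have mg := measurable_int _ gi.
  apply: le_lt_trans ((integrable21ltyP _ _ mg).1 gi).
  apply: ge0_le_integral => //.
  - exact: measurableT_comp.
  - apply: (measurable_fun_fubini_tonelli_G (abse \o (EFin \o g))).
      exact: measurableT_comp.
    by move=> z /=.
  - move=> y _; apply: le_abse_integral => //.
    exact: measurableT_comp (measurable_pair2 _).
have aeE : ae_eq m2 setT (fubini_G m1 (EFin \o g))
   (EFin \o (fun y => \int[m1]_x g (x, y))).
  have := ae_integrable2 gi; apply: filterS => y gy _ /=.
  by rewrite EFin_Rint.
have ig' : m2.-integrable setT (EFin \o (fun y => \int[m1]_x g (x, y))).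
  have mF : measurable_fun setT (fubini_G m1 (EFin \o g)).
    exact: measurable_int ig.
  have mF' : measurable_fun setT (EFin \o (fun y => \int[m1]_x g (x, y))).
    apply/measurable_EFinP; exact: (measurableT_comp (fine_measurable measurableT)).
  apply/integrableP; split => //.
  case/integrableP : ig => _; rewrite (@ae_eq_integral _ _ _ m2 setT
     (abse \o fubini_G m1 (EFin \o g))
     (abse \o (EFin \o (fun y => \int[m1]_x g (x, y)))))//.
  - exact: measurableT_comp.
  - exact: measurableT_comp.
  - by apply: filterS aeE => x + Dx => /(_ Dx)/= ->.
split => //; rewrite EFin_Rint//.
apply: ae_eq_integral => //.
- exact: measurable_int ig'.
- exact: measurable_int ig.
- by apply: filterS aeE => x + Dx => /(_ Dx).
Qed.

Lemma Rfubini A B f : measurable A -> measurable B ->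
  (m1 \x m2)%E.-integrable (A `*` B) (EFin \o (fun z => f z.1 z.2)) ->
  \int[m1]_(x in A) \int[m2]_(y in B) f x y =
  \int[m2]_(y in B) \int[m1]_(x in A) f x y.
Proof.
move=> mA mB /(integrable_rectP f mA mB) fi.
rewrite Rint_patch2 Rint_patch2'.
apply: EFin_inj; rewrite (Rint_fubini_F fi).1 (Rint_fubini_G fi).1.
exact: (Fubini fi).
Qed.

Lemma integrable_Rint1 A B f : measurable A -> measurable B ->
  (m1 \x m2)%E.-integrable (A `*` B) (EFin \o (fun z => f z.1 z.2)) ->
  m1.-integrable A (EFin \o (fun x => \int[m2]_(y in B) f x y)).
Proof.
move=> mA mB /(integrable_rectP f mA mB) fi.
apply/(integrable_mkcond _ mA); rewrite restrict_EFin.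
apply: eq_integrable (Rint_fubini_F fi).2 => // x _ /=; congr EFin.
rewrite patchE; case: ifPn => xA; last first.
  rewrite (@eq_Rintegral _ _ _ _ _ (cst 0))//.
    by rewrite Rintegral_cst// mul0r.
  by move=> y _; rewrite patch_rect patchE (negbTE xA).
rewrite [RHS]Rintegral_mkcond; apply: eq_Rintegral => y _.
by rewrite patch_rect patchE xA.
Qed.

Lemma integrable_Rint2 A B f : measurable A -> measurable B ->
  (m1 \x m2)%E.-integrable (A `*` B) (EFin \o (fun z => f z.1 z.2)) ->
  m2.-integrable B (EFin \o (fun y => \int[m1]_(x in A) f x y)).
Proof.
move=> mA mB /(integrable_rectP f mA mB) fi.
apply/(integrable_mkcond _ mB); rewrite restrict_EFin.
apply: eq_integrable (Rint_fubini_G fi).2 => // y _ /=; congr EFin.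
rewrite patchE; case: ifPn => yB; last first.
  rewrite (@eq_Rintegral _ _ _ _ _ (cst 0))//.
    by rewrite Rintegral_cst// mul0r.
  by move=> x _; rewrite patch_rect patchE; case: ifP => // _; rewrite patchE (negbTE yB).
rewrite [RHS]Rintegral_mkcond; apply: eq_Rintegral => x _.
by rewrite patch_rect !patchE yB.
Qed.

Lemma integrable_section1 A B f : measurable A -> measurable B ->
  (m1 \x m2)%E.-integrable (A `*` B) (EFin \o (fun z => f z.1 z.2)) ->
  {ae m1, forall x, A x -> m2.-integrable B (EFin \o (f x))}.
Proof.
move=> mA mB /(integrable_rectP f mA mB) fi.
have := ae_integrable1 fi; apply: filterS => x fx Ax.
apply/(integrable_mkcond _ mB); rewrite restrict_EFin.
apply: eq_integrable fx => // y _ /=; congr EFin.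
by rewrite patch_rect patchE mem_set.
Qed.

Lemma integrable_section2 A B f : measurable A -> measurable B ->
  (m1 \x m2)%E.-integrable (A `*` B) (EFin \o (fun z => f z.1 z.2)) ->
  {ae m2, forall y, B y -> m1.-integrable A (EFin \o (f ^~ y))}.
Proof.
move=> mA mB /(integrable_rectP f mA mB) fi.
have := ae_integrable2 fi; apply: filterS => y fy By.
apply/(integrable_mkcond _ mA); rewrite restrict_EFin.
apply: eq_integrable fy => // x _ /=; congr EFin.
by rewrite patch_rect !patchE [y \in B]mem_set.
Qed.

(** Tonelli: the bound g makes the iterated integral of the absolute value
    finite. *)
Lemma integrable_rect A B f (g : T1 -> R) : measurable A -> measurable B ->
  measurable_fun (A `*` B) (fun z => f z.1 z.2) ->
  m1.-integrable A (EFin \o g) ->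
  {ae m1, forall x, A x -> m2.-integrable B (EFin \o f x) /\
    \int[m2]_(y in B) `|f x y| <= g x} ->
  (m1 \x m2)%E.-integrable (A `*` B) (EFin \o (fun z => f z.1 z.2)).
Proof.
move=> mA mB mf gi fg; apply/(integrable_rectP f mA mB).
set F := (fun z => f z.1 z.2) \_ (A `*` B).
have mF : measurable_fun setT F := (measurable_restrictT _ (measurableX mA mB)).1 mf.
apply/integrable12ltyP; first exact/measurable_EFinP.
have gi' : m1.-integrable setT (EFin \o (g \_ A)).
  by rewrite -restrict_EFin; apply/(integrable_mkcond _ mA).1.
case/integrableP : gi' => mg gi'.
apply: le_lt_trans gi'.
apply: ae_ge0_le_integral => //.
- by move=> x _; exact: integral_ge0.
- apply: (measurable_fun_fubini_tonelli_F (abse \o (EFin \o F))) => //.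
  by apply: measurableT_comp => //; exact/measurable_EFinP.
  by move=> z /=.
- exact: measurableT_comp.
apply: filterS fg => x fg _ /=.
rewrite patchE; case: ifPn => xA; last first.
  rewrite integral0_eq// => y _ /=.
  by rewrite /F patch_rect patchE (negbTE xA) normr0.
have [fxi fxg] := fg (set_mem xA).
rewrite (eq_integral (fun y => ((fun y => `|f x y|%:E) \_ B) y)); last first.
  move=> y _ /=; rewrite /F patch_rect patchE xA 2!patchE.
  by case: ifP => //; rewrite normr0.
rewrite -integral_mkcond.
rewrite -[X in (X <= _)%E]EFin_Rint//; last exact: integrable_norm.
by rewrite lee_fin (le_trans fxg)// ler_norm.
Qed.

(** The case of a bound with separated variables, for which both integrability
    conditions can be checked one variable at a time. *)
Lemma integrable_prod A B (g : T1 -> R) (h : T2 -> R) f :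
  measurable A -> measurable B ->
  measurable_fun (A `*` B) (fun z => f z.1 z.2) ->
  m1.-integrable A (EFin \o g) -> m2.-integrable B (EFin \o h) ->
  (forall x y, A x -> B y -> `|f x y| <= g x * h y) ->
  (m1 \x m2)%E.-integrable (A `*` B) (EFin \o (fun z => f z.1 z.2)).
Proof.
move=> mA mB mf gi hi fgh.
have mfx x : A x -> measurable_fun B (f x).
  move=> Ax.
  have := measurableT_comp ((measurable_restrictT _ (measurableX mA mB)).1 mf)
    (measurable_pair1 x).
  move=> H; apply/(measurable_restrictT _ mB).2.
  apply: eq_measurable_fun H => y _ /=.
  by rewrite patch_rect patchE mem_set.
apply: (@integrable_rect _ _ _ (fun x => g x * \int[m2]_(y in B) h y)) => //.
  apply: eq_integrable (integrable_mull (\int[m2]_(y in B) h y) mA gi) => //.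
  by move=> x _ /=; rewrite mulrC.
apply: aeW => x Ax; split.
  apply: (@integrable_le _ _ _ _ _ _ (fun y => g x * h y)) => //.
  - exact: mfx.
  - exact: integrable_mull.
  - by move=> y By; exact: fgh.
rewrite -RintegralZl//; apply: le_Rintegral => //.
- apply: integrable_norm; apply: (@integrable_le _ _ _ _ _ _ (fun y => g x * h y)) => //.
  + exact: mfx.
  + exact: integrable_mull.
  + by move=> y By; exact: fgh.
- exact: integrable_mull.
- by move=> y By; exact: fgh.
Qed.

End fubini_rectangles.

(** * Parameters and limits of integrals *)

(** The positive and negative parts have integrals in the extended reals which
    are measurable in the parameter by Tonelli as extended reals; subtraction
    and the passage to real values preserve measurability. *)
Lemma measurable_fun_Rint d1 d2 (T1 : measurableType d1)
    (T2 : measurableType d2) (R : realType)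
    (m2 : {sigma_finite_measure set T2 -> \bar R}) (B : set T2)
    (f : T1 -> T2 -> R) : measurable B ->
  measurable_fun setT (fun z => f z.1 z.2) ->
  measurable_fun setT (fun x => \int[m2]_(y in B) f x y).
Proof.
move=> mB mf; apply: (measurableT_comp (fine_measurable measurableT)).
pose F (z : T1 * T2) := ((fun z => f z.1 z.2) \_ (setT `*` B)) z.
have mTB : measurable ([set: T1] `*` B) by exact: measurableX.
have mF : measurable_fun setT (EFin \o F).
  apply/measurable_EFinP; apply: (measurable_restrictT _ mTB).1.
  exact: (measurable_funS measurableT _ mf).
rewrite (_ : (fun x => _) = (fun x => (\int[m2]_y (EFin \o F)^\+ (x, y) -
    \int[m2]_y (EFin \o F)^\- (x, y))%E)).
  apply: emeasurable_funB.
  - apply: (measurable_fun_fubini_tonelli_F ((EFin \o F)^\+)%E) => //.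
    exact: measurable_funepos.
  - apply: (measurable_fun_fubini_tonelli_F ((EFin \o F)^\-)%E) => //.
    exact: measurable_funeneg.
apply/funext => x; rewrite integral_mkcond integralE.
have E : (fun y => (f x y)%:E) \_ B = (EFin \o F) \o pair x.
  by apply/funext => y; rewrite /= /F !patchE in_setX in_setT /=; case: ifP.
by rewrite E funepos_comp funeneg_comp.
Qed.

Lemma measurable_fun_expR d (T : measurableType d) (R : realType) (D : set T)
    (f : T -> R) :
  measurable_fun D f -> measurable_fun D (fun x => expR (f x)).
Proof. by move=> mf; apply: measurableT_comp => //; exact: measurable_expR. Qed.

Lemma Rint_dct d (T : measurableType d) (R : realType)
    (mu : {measure set T -> \bar R}) (D : set T) (f_ : nat -> T -> R)
    (f g : T -> R) : measurable D ->
  (forall n, measurable_fun D (f_ n)) -> measurable_fun D f ->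
  {ae mu, forall x, D x -> f_ n x @[n --> \oo] --> f x} ->
  mu.-integrable D (EFin \o g) ->
  (forall n x, D x -> `|f_ n x| <= g x) ->
  \int[mu]_(x in D) f_ n x @[n --> \oo] --> \int[mu]_(x in D) f x.
Proof.
move=> mD mf_ mf f_f gi fg.
have mf_E n : measurable_fun D (EFin \o f_ n) by exact/measurable_EFinP.
have mfE : measurable_fun D (EFin \o f) by exact/measurable_EFinP.
have := @dominated_convergence _ _ _ mu D mD (fun n => EFin \o f_ n)
  (EFin \o f) (EFin \o g) mf_E mfE _ gi _.
move=> [||fi _ cvg].
- apply: filterS f_f => x f_f Dx.
  by apply/fine_cvgP; split; [exact: nearW | exact: f_f].
- by apply: aeW => x n Dx; rewrite lee_fin fg.
- apply: fine_cvg; rewrite EFin_Rint//.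
Qed.

Lemma cvgn_normr_le (R : realType) (u : nat -> R) (l b : R) :
  u n @[n --> \oo] --> l -> (forall n, `|u n| <= b) -> `|l| <= b.
Proof.
move=> ul ub; rewrite -(cvg_lim (@Rhausdorff R) (cvg_norm ul)).
apply: limr_le; first exact: cvgP (cvg_norm ul).
by near=> n; exact: ub.
Unshelve. all: by end_near. Qed.

(** * Uniqueness for the Laplace transform *)

Section exponential_series.
Context {R : realType}.
Implicit Types (x z : R).

Lemma series_exp_coeff_le x n : 0 <= x -> series (exp_coeff x) n <= expR x.
Proof.
move=> x0; rewrite /expR; apply: nondecreasing_cvgn_le.
- apply/nondecreasing_seqP => m; rewrite seriesSr lerDl; exact: exp_coeff_ge0.
- exact: is_cvg_series_exp_coeff.
Qed.

Lemma normr_series_exp_coeff x n :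
  `|series (exp_coeff x) n| <= series (exp_coeff `|x|) n.
Proof.
rewrite /series /=; apply: (le_trans (ler_norm_sum _ _ _)).
rewrite le_eqVlt; apply/orP; left; apply/eqP/eq_bigr => i _.
by rewrite /exp_coeff /= normrM normrX normfV [`|_%:R|]ger0_norm.
Qed.

End exponential_series.

Section laplace_uniqueness.
Context {R : realType}.
Local Notation mu := (@lebesgue_measure R).

Let mexpM (k : R) : measurable_fun [set: R] (fun t => expR (k * t)).
Proof.
by apply: measurable_fun_expR; exact: mulrl_measurable.
Qed.

(** Mikusinski's summation. With z = e^(n (x - t)) the number 1 - exp(- z) tends
    to 1 for t < x and to 0 for t > x. Its expansion in powers of z is a
    combination of the exponentials e^(- k n t), so its integral against g is a
    combination of the values of the transform at the multiples of n, which the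
    assumed decay sums to a quantity of the order of exp(e^(n (x - lam))) - 1. *)
Lemma laplace_unique (l lam C x : R) (n0 : nat) (g : R -> R) : 0 < l ->
  mu.-integrable `]0, l[ (EFin \o g) ->
  (forall n, (n0 <= n)%N ->
    `|\int[mu]_(t in `]0, l[) (expR (- n%:R * t) * g t)| <= C * expR (- n%:R * lam)) ->
  0 < x -> x < lam -> x < l ->
  \int[mu]_(t in `]0, x[) g t = 0.
Proof.
move=> l0 gi gC x0 xlam xl.
have mg := integrable_measurable gi.
have mD : measurable (`]0, l[ : set R) by exact: measurable_itv.
have C0 : 0 <= C.
  have := gC n0 (leqnn _); move/(le_trans (normr_ge0 _)).
  by rewrite pmulr_lge0// expR_gt0.
pose z n t : R := expR (n.+1%:R * (x - t)).
have mz n : measurable_fun [set: R] (z n).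
  rewrite /z (_ : (fun t => _) = (fun t => expR (n.+1%:R * x) * expR (- n.+1%:R * t))).
    exact: measurable_funM.
  by apply/funext => t; rewrite -expRD mulrBr mulNr.
have zE n t k : z n t ^+ k = expR ((k * n.+1)%:R * x) * expR (- (k * n.+1)%:R * t).
  rewrite /z -expRM_natl -expRD; congr expR; rewrite natrM; ring.
pose delta := lam - x.
have d0 : 0 < delta by rewrite subr_gt0.
(* the exponentials e^(- m t) are bounded by 1 on t > 0 *)
have ei m : mu.-integrable `]0, l[ (EFin \o (fun t => expR (- m%:R * t) * g t)).
  apply: (@integrableMb _ _ _ mu _ _ _ 1) => //; first by apply: measurable_funTS; exact: mexpM.
  move=> t /=; rewrite in_itv/= => /andP[t0 _].
  by rewrite ger0_norm ?expR_ge0// -expR0 ler_expR mulNr oppr_le0 mulr_ge0// ltW.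
pose P K n t : R := - \sum_(1 <= k < K.+1) (- z n t) ^+ k / k`!%:R.
have PE K n t : P K n t = 1 - series (exp_coeff (- z n t)) K.+1.
  by rewrite /P /series /= [X in _ = 1 - X]big_ltn// {1}/exp_coeff/= expr0 fact0 divr1 opprD addrA subrr sub0r.
have mP K n : measurable_fun [set: R] (P K n).
  rewrite /P; apply: measurableT_comp => //.
  apply: measurable_sum => k.
  apply: measurable_funM => //; apply: measurable_funX.
  exact: measurableT_comp.
have z0 n t : 0 <= z n t by exact: expR_ge0.
have PK K n t : `|P K n t| <= 1 + expR (z n t).
  rewrite PE (le_trans (ler_normB _ _))// normr1 lerD2l.
  rewrite (le_trans (normr_series_exp_coeff _ _))// normrN ger0_norm//.
  exact: series_exp_coeff_le.
have zM n t : t \in `]0, l[ -> z n t <= expR (n.+1%:R * x).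
  rewrite in_itv/= => /andP[t0 _]; rewrite ler_expR ler_wpM2l//.
  by rewrite lerBlDr lerDl ltW.
pose I n := \int[mu]_(t in `]0, l[) ((1 - expR (- z n t)) * g t).
have stepK n : \int[mu]_(t in `]0, l[) (P K n t * g t) @[K --> \oo] --> I n.
  apply: (@Rint_dct _ _ _ mu _ _ _
      (fun t => (1 + expR (expR (n.+1%:R * x))) * `|g t|)) => //.
  - by move=> K; apply: measurable_funM => //; apply: measurable_funTS; exact: mP.
  - apply: measurable_funM => //; apply: measurable_funTS.
    apply: measurable_funB => //; apply: measurable_fun_expR.
    by apply: measurableT_comp => //; exact: mz.
  - apply: aeW => t _; apply: cvgMl.
    under eq_cvg do rewrite PE.
    apply: cvgB; first exact: cvg_cst.
    rewrite /expR (cvg_shiftS (series (exp_coeff (- z n t)))).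
    exact: is_cvg_series_exp_coeff.
  - by apply: integrable_mull => //; exact: integrable_norm.
  - move=> K t tl; rewrite normrM ler_wpM2r// (le_trans (PK _ _ _))// lerD2l.
    by rewrite ler_expR zM.
(* term by term: with N = k (n + 1), the transform at N times e^(N x) is at
   most C e^(- N (lam - x)) *)
have boundK n K : (n0 <= n)%N -> `|\int[mu]_(t in `]0, l[) (P K n t * g t)| <=
    C * (expR (expR (- n.+1%:R * delta)) - 1).
  move=> n0n.
  have -> : \int[mu]_(t in `]0, l[) (P K n t * g t) =
      - \sum_(1 <= k < K.+1) ((-1) ^+ k / k`!%:R * expR ((k * n.+1)%:R * x)) *
        \int[mu]_(t in `]0, l[) (expR (- (k * n.+1)%:R * t) * g t).
    transitivity (\int[mu]_(t in `]0, l[) - (\sum_(1 <= k < K.+1)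
       ((-1) ^+ k / k`!%:R * expR ((k * n.+1)%:R * x)) * (expR (- (k * n.+1)%:R * t) * g t))).
      apply: eq_Rintegral => t _; rewrite /P mulNr mulr_suml; congr (- _).
      apply: eq_bigr => k _; rewrite (exprNn (z n t)) zE; ring.
    have si : forall s : seq nat, mu.-integrable `]0, l[ (EFin \o (fun t =>
       \sum_(k <- s) ((-1) ^+ k / k`!%:R * expR ((k * n.+1)%:R * x)) *
           (expR (- (k * n.+1)%:R * t) * g t))) /\
      \int[mu]_(t in `]0, l[) (\sum_(k <- s) ((-1) ^+ k / k`!%:R * expR ((k * n.+1)%:R * x)) *
           (expR (- (k * n.+1)%:R * t) * g t)) =
      \sum_(k <- s) ((-1) ^+ k / k`!%:R * expR ((k * n.+1)%:R * x)) *
        \int[mu]_(t in `]0, l[) (expR (- (k * n.+1)%:R * t) * g t).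
      elim=> [|k s [IHi IHE]].
        split; first by apply: (@integrable_ext _ _ _ mu _ _ _ mD (integrable0 _ _)) => t _; rewrite big_nil.
        under eq_Rintegral do rewrite big_nil.
        by rewrite Rintegral_cst// mul0r big_nil.
      have ki := @integrable_mull _ _ _ mu _ _ ((-1) ^+ k / k`!%:R * expR ((k * n.+1)%:R * x)) mD (ei (k * n.+1)%N).
      split.
        have := @integrable_addr _ _ _ mu _ _ _ mD ki IHi.
        move=> /(@integrable_ext _ _ _ mu _ _ _ mD); apply => t _.
        by rewrite big_cons.
      under eq_Rintegral do rewrite big_cons.
      by rewrite RintegralD// RintegralZl// IHE big_cons.
    have [si1 si2] := si (index_iota 1 K.+1).
    by rewrite RintN// si2.
  rewrite normrN (le_trans (ler_norm_sum _ _ _))//.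
  apply: (@le_trans _ _ (C * (series (exp_coeff (expR (- n.+1%:R * delta))) K.+1 - 1))).
    rewrite /series /= [X in _ * (X - 1)]big_ltn// {1}/exp_coeff/= expr0 fact0 divr1.
    rewrite addrAC subrr add0r mulr_sumr; apply: ler_sum_nat => k /andP[k0 _].
    have := gC (k * n.+1)%N (leq_trans n0n (leq_trans (leqnSn _) (leq_pmull _ k0))).
    move=> H.
    rewrite normrM (le_trans (ler_wpM2l _ H))//.
    rewrite !normrM normrX normrN1 expr1n mul1r [`|expR _|]ger0_norm ?expR_ge0//.
    rewrite ger0_norm// le_eqVlt; apply/orP; left; apply/eqP.
    rewrite /exp_coeff /= -expRM_natl.
    rewrite (_ : k%:R * (- n.+1%:R * delta) = (k * n.+1)%:R * x + - (k * n.+1)%:R * lam).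
      by rewrite expRD; ring.
    by rewrite /delta natrM; ring.
  by rewrite ler_wpM2l// lerB// series_exp_coeff_le// expR_ge0.
have In n : (n0 <= n)%N -> `|I n| <= C * (expR (expR (- n.+1%:R * delta)) - 1).
  by move=> n0n; apply: (cvgn_normr_le (stepK n)) => K; exact: boundK.
have to0 (r : R) : 0 < r -> expR (- n.+1%:R * r) @[n --> \oo] --> 0.
  move=> r0.
  have : expR (- r) ^+ n @[n --> \oo] --> 0.
    apply: cvg_expr; rewrite ger0_norm ?expR_ge0// -expR0 ltr_expR.
    by rewrite oppr_lt0.
  rewrite -(cvg_shiftS (fun n => expR (- r) ^+ n)).
  apply: cvg_trans; apply: near_eq_cvg; near=> n.
  by rewrite /= -expRM_natl; congr expR; ring.
have I0 : I n @[n --> \oo] --> 0.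
  apply/norm_cvg0P.
  apply: (@squeeze_cvgr _ _ _ _ (cst 0) (fun n => C * (expR (expR (- n.+1%:R * delta)) - 1))).
  - by near=> n; rewrite normr_ge0/= In//; near: n; exact: nbhs_infty_ge.
  - exact: cvg_cst.
  - rewrite [X in _ --> X](_ : 0 = C * (expR 0 - 1)); last by rewrite expR0 subrr mulr0.
    apply: cvgMr; apply: cvgB; last exact: cvg_cst.
    exact: (cvg_comp _ _ (to0 _ d0) (@continuous_expR R 0)).
pose h (t : R) : R := (t < x)%R%:R.
have IL : I n @[n --> \oo] --> \int[mu]_(t in `]0, l[) (h t * g t).
  have mh : measurable_fun [set: R] h.
    rewrite /h (_ : (fun t => _) = \1_(`]-oo, x[)).
      by apply: measurable_indic; exact: measurable_itv.
    by apply/funext => t; rewrite indicE mem_setE in_itv.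
  apply: (@Rint_dct _ _ _ mu _ _ _ (fun t => `|g t|)) => //.
  - move=> n; apply: measurable_funM => //; apply: measurable_funTS.
    apply: measurable_funB => //; apply: measurable_fun_expR.
    by apply: measurableT_comp => //; exact: mz.
  - by apply: measurable_funM => //; apply: measurable_funTS; exact: mh.
  - exists [set x]; split => //; first exact: lebesgue_measure_set1.
    move=> t; apply: contra_notP => /eqP tx _; apply: cvgMl.
    have [tx'|tx'] := ltP t x.
    + rewrite /h tx' /=.
      rewrite [X in _ --> X](_ : 1%:R = 1 - 0); last by rewrite subr0.
      apply: cvgB; first exact: cvg_cst.
      have xt0 : 0 < x - t by rewrite subr_gt0.
      apply: (@squeeze_cvgr _ _ _ _ (cst 0) (fun n => expR (- n.+1%:R * (x - t)))).
      * near=> n; rewrite expR_ge0/= ler_expR mulNr lerN2.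
        by rewrite (le_trans _ (expR_ge1Dx _))// lerDr.
      * exact: cvg_cst.
      * exact: to0.
    + have tx'' : 0 < t - x by rewrite subr_gt0 lt_neqAle eq_sym tx' andbT.
      rewrite /h ltNge tx' /=.
      rewrite [X in _ --> X](_ : 0%:R = 1 - expR (- 0)); last by rewrite oppr0 expR0 subrr.
      apply: cvgB; first exact: cvg_cst.
      have zt : - z n t @[n --> \oo] --> - 0.
        apply: cvgN; have := to0 _ tx''; apply: cvg_trans; apply: near_eq_cvg.
        by near=> n; rewrite /z; congr expR; ring.
      exact: (cvg_comp _ _ zt (@continuous_expR R (- 0))).
  - exact: integrable_norm.
  - move=> n t _; rewrite normrM ler_piMl// ger0_norm.
      by rewrite lerBlDr lerDl expR_ge0.
    by rewrite subr_ge0 -expR0 ler_expR oppr_le0.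
have -> : \int[mu]_(t in `]0, x[) g t = \int[mu]_(t in `]0, l[) (h t * g t).
  rewrite (_ : `]0, x[%classic = `]0, l[ `&` `]-oo, x[%classic); last first.
    apply/seteqP; split=> t /=; rewrite !in_itv/=.
      by move=> /andP[-> tx]; rewrite tx (lt_trans tx xl).
    by move=> [/andP[-> _] ->].
  rewrite Rintegral_mkcondr; apply: eq_Rintegral => t _.
  by rewrite patchE mem_setE in_itv/= /h; case: ltP; rewrite ?mul1r ?mul0r.
exact: (cvg_unique _ IL I0).
Unshelve. all: by end_near. Qed.

End laplace_uniqueness.

(** * The Lebesgue measure *)

(** The preceding statements at the Lebesgue measure of the real line: fixing
    the measure lets unification treat plain sets of reals as sets of its
    measurable space. *)
Section lebesgue_integrals.
Context {R : realType}.
Local Notation mu := (@lebesgue_measure R).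
Implicit Types (D A B : set R) (f g : R -> R).

Lemma leb_integrable_le D f g : measurable D -> measurable_fun D f ->
  mu.-integrable D (EFin \o g) -> (forall x, D x -> `|f x| <= g x) ->
  mu.-integrable D (EFin \o f).
Proof. exact: (@integrable_le _ _ _ mu D f g). Qed.

Lemma leb_integrable_bnd D f (M : R) : measurable D -> (mu D < +oo)%E ->
  measurable_fun D f -> (forall x, D x -> `|f x| <= M) ->
  mu.-integrable D (EFin \o f).
Proof. exact: (@integrable_bnd _ _ _ mu D f M). Qed.

Lemma leb_measurable D f : mu.-integrable D (EFin \o f) -> measurable_fun D f.
Proof. exact: (@integrable_measurable _ _ _ mu D f). Qed.

Lemma leb_normr_le D f g : measurable D -> measurable_fun D f ->
  mu.-integrable D (EFin \o g) -> (forall x, D x -> `|f x| <= g x) ->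
  `|\int[mu]_(x in D) f x| <= \int[mu]_(x in D) g x.
Proof. exact: (@normr_Rint_le _ _ _ mu D f g). Qed.

Lemma leb_normr_bnd D f (M : R) : measurable D -> (mu D < +oo)%E ->
  measurable_fun D f -> (forall x, D x -> `|f x| <= M) ->
  `|\int[mu]_(x in D) f x| <= M * fine (mu D).
Proof. exact: (@normr_Rint_bnd _ _ _ mu D f M). Qed.

Lemma leb_ae_eq_Rint D f g : measurable D -> measurable_fun D f ->
  measurable_fun D g -> {ae mu, forall x, D x -> f x = g x} ->
  \int[mu]_(x in D) f x = \int[mu]_(x in D) g x.
Proof. exact: (@ae_eq_Rint _ _ _ mu D f g). Qed.

Lemma leb_integrableMb D f g (M : R) : measurable D -> measurable_fun D f ->
  mu.-integrable D (EFin \o g) -> (forall x, D x -> `|f x| <= M) ->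
  mu.-integrable D (EFin \o (fun x => f x * g x)).
Proof. exact: (@integrableMb _ _ _ mu D f g M). Qed.

Lemma leb_integrableD D f g : measurable D -> mu.-integrable D (EFin \o f) ->
  mu.-integrable D (EFin \o g) ->
  mu.-integrable D (EFin \o (fun x => f x + g x)).
Proof. exact: (@integrable_addr _ _ _ mu D f g). Qed.

Lemma leb_integrableB D f g : measurable D -> mu.-integrable D (EFin \o f) ->
  mu.-integrable D (EFin \o g) ->
  mu.-integrable D (EFin \o (fun x => f x - g x)).
Proof. exact: (@integrable_subr _ _ _ mu D f g). Qed.

Lemma leb_integrableZl D f (k : R) : measurable D -> mu.-integrable D (EFin \o f) ->
  mu.-integrable D (EFin \o (fun x => k * f x)).
Proof. exact: (@integrable_mull _ _ _ mu D f k). Qed.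

Lemma leb_integrable_norm D f : mu.-integrable D (EFin \o f) ->
  mu.-integrable D (EFin \o (fun x => `|f x|)).
Proof. exact: (@integrable_norm _ _ _ mu D f). Qed.

Lemma leb_eq_integrable D f g : measurable D -> mu.-integrable D (EFin \o f) ->
  (forall x, D x -> f x = g x) -> mu.-integrable D (EFin \o g).
Proof. exact: (@integrable_ext _ _ _ mu D f g). Qed.

Lemma leb_integrableS D A f : measurable D -> measurable A -> A `<=` D ->
  mu.-integrable D (EFin \o f) -> mu.-integrable A (EFin \o f).
Proof. exact: (@integrableS _ _ _ mu D A (EFin \o f)). Qed.

Lemma leb_integrable_cst D (k : R) : measurable D -> (mu D < +oo)%E ->
  mu.-integrable D (EFin \o (fun _ => k)).
Proof. exact: (@integrable_cst_lty _ _ _ mu D k). Qed.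

Lemma leb_ae_le_Rint D f g : measurable D -> mu.-integrable D (EFin \o f) ->
  mu.-integrable D (EFin \o g) -> {ae mu, forall x, D x -> f x <= g x} ->
  \int[mu]_(x in D) f x <= \int[mu]_(x in D) g x.
Proof. exact: (@ae_le_Rint _ _ _ mu D f g). Qed.

Lemma leb_eq_Rint D f g : (forall x, D x -> f x = g x) ->
  \int[mu]_(x in D) f x = \int[mu]_(x in D) g x.
Proof. by move=> fg; apply: eq_Rintegral => x /set_mem; exact: fg. Qed.

Lemma leb_RintZl D f (k : R) : measurable D -> mu.-integrable D (EFin \o f) ->
  \int[mu]_(x in D) (k * f x) = k * \int[mu]_(x in D) f x.
Proof. exact: (@RintegralZl _ _ _ mu D f k). Qed.

Lemma leb_RintD D f g : measurable D -> mu.-integrable D (EFin \o f) ->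
  mu.-integrable D (EFin \o g) ->
  \int[mu]_(x in D) (f x + g x) =
  \int[mu]_(x in D) f x + \int[mu]_(x in D) g x.
Proof. exact: (@RintegralD _ _ _ mu D f g). Qed.

Lemma leb_RintB D f g : measurable D -> mu.-integrable D (EFin \o f) ->
  mu.-integrable D (EFin \o g) ->
  \int[mu]_(x in D) (f x - g x) =
  \int[mu]_(x in D) f x - \int[mu]_(x in D) g x.
Proof. exact: (@RintegralB _ _ _ mu D f g). Qed.

Lemma leb_RintN D f : measurable D -> mu.-integrable D (EFin \o f) ->
  \int[mu]_(x in D) - f x = - \int[mu]_(x in D) f x.
Proof. exact: (@RintN _ _ _ mu D f). Qed.

Lemma leb_le_Rint D f g : measurable D -> mu.-integrable D (EFin \o f) ->
  mu.-integrable D (EFin \o g) -> (forall x, D x -> f x <= g x) ->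
  \int[mu]_(x in D) f x <= \int[mu]_(x in D) g x.
Proof. exact: (@le_Rintegral _ _ _ mu D f g). Qed.

Lemma leb_Rint_eq0_ae (D : set R) (f : R -> R) : measurable D -> mu.-integrable D (EFin \o f) ->
  (forall x, D x -> 0 <= f x) -> \int[mu]_(x in D) f x <= 0 ->
  {ae mu, forall x, D x -> f x = 0}.
Proof. exact: (@Rint_eq0_ae _ _ _ mu D f). Qed.

Lemma leb_integrable_patch D f : measurable D -> mu.-integrable D (EFin \o f) <->
  mu.-integrable setT (EFin \o (f \_ D)).
Proof.
by move=> mD; rewrite -restrict_EFin; exact: (@integrable_mkcond _ _ _ mu D _ mD).
Qed.

Lemma measurable_fun_onT d (T : measurableType d) (D : set T) (f : T -> R) :
  measurable_fun setT f -> measurable_fun D f.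
Proof. by move=> mf; apply: measurable_funTS; exact: mf. Qed.

Lemma leb_itv_lty (a b : R) (x y : bool) :
  (mu [set` Interval (BSide x a) (BSide y b)] < +oo)%E.
Proof.
rewrite lebesgue_measure_itv /=; case: ifPn => // _.
by rewrite -EFinB ltry.
Qed.

Lemma leb_fubini A B (f : R -> R -> R) : measurable A -> measurable B ->
  (mu \x mu)%E.-integrable (A `*` B) (EFin \o (fun z => f z.1 z.2)) ->
  \int[mu]_(x in A) \int[mu]_(y in B) f x y =
  \int[mu]_(y in B) \int[mu]_(x in A) f x y.
Proof. exact: (@Rfubini _ _ _ _ R mu mu A B f). Qed.

Lemma leb_integrable_prod A B g h (f : R -> R -> R) : measurable A -> measurable B ->
  measurable_fun (A `*` B) (fun z : R * R => f z.1 z.2) ->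
  mu.-integrable A (EFin \o g) -> mu.-integrable B (EFin \o h) ->
  (forall x y, A x -> B y -> `|f x y| <= g x * h y) ->
  (mu \x mu)%E.-integrable (A `*` B) (EFin \o (fun z => f z.1 z.2)).
Proof. exact: (@integrable_prod _ _ _ _ R mu mu A B g h f). Qed.

Lemma leb_integrable_rect A B g (f : R -> R -> R) : measurable A -> measurable B ->
  measurable_fun (A `*` B) (fun z : R * R => f z.1 z.2) ->
  mu.-integrable A (EFin \o g) ->
  {ae mu, forall x, A x -> mu.-integrable B (EFin \o f x) /\
    \int[mu]_(y in B) `|f x y| <= g x} ->
  (mu \x mu)%E.-integrable (A `*` B) (EFin \o (fun z => f z.1 z.2)).
Proof. exact: (@integrable_rect _ _ _ _ R mu mu A B f g). Qed.

Lemma leb_integrable_Rint1 A B (f : R -> R -> R) : measurable A -> measurable B ->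
  (mu \x mu)%E.-integrable (A `*` B) (EFin \o (fun z => f z.1 z.2)) ->
  mu.-integrable A (EFin \o (fun x => \int[mu]_(y in B) f x y)).
Proof. exact: (@integrable_Rint1 _ _ _ _ R mu mu A B f). Qed.

Lemma leb_integrable_Rint2 A B (f : R -> R -> R) : measurable A -> measurable B ->
  (mu \x mu)%E.-integrable (A `*` B) (EFin \o (fun z => f z.1 z.2)) ->
  mu.-integrable B (EFin \o (fun y => \int[mu]_(x in A) f x y)).
Proof. exact: (@integrable_Rint2 _ _ _ _ R mu mu A B f). Qed.

Lemma leb_integrable_section1 A B (f : R -> R -> R) : measurable A -> measurable B ->
  (mu \x mu)%E.-integrable (A `*` B) (EFin \o (fun z => f z.1 z.2)) ->
  {ae mu, forall x, A x -> mu.-integrable B (EFin \o (f x))}.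
Proof. exact: (@integrable_section1 _ _ _ _ R mu mu A B f). Qed.

Lemma leb_integrable_section2 A B (f : R -> R -> R) : measurable A -> measurable B ->
  (mu \x mu)%E.-integrable (A `*` B) (EFin \o (fun z => f z.1 z.2)) ->
  {ae mu, forall y, B y -> mu.-integrable A (EFin \o (f ^~ y))}.
Proof. exact: (@integrable_section2 _ _ _ _ R mu mu A B f). Qed.

Lemma leb_measurable_Rint d (T : measurableType d) B (f : T -> R -> R) : measurable B ->
  measurable_fun setT (fun z : T * R => f z.1 z.2) ->
  measurable_fun setT (fun x => \int[mu]_(y in B) f x y).
Proof. exact: (@measurable_fun_Rint _ _ T _ R mu B f). Qed.

Lemma leb_Rint_dct D (f_ : nat -> R -> R) f g : measurable D ->
  (forall n, measurable_fun D (f_ n)) -> measurable_fun D f ->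
  {ae mu, forall x, D x -> f_ n x @[n --> \oo] --> f x} ->
  mu.-integrable D (EFin \o g) ->
  (forall n x, D x -> `|f_ n x| <= g x) ->
  \int[mu]_(x in D) f_ n x @[n --> \oo] --> \int[mu]_(x in D) f x.
Proof. exact: (@Rint_dct _ _ _ mu D f_ f g). Qed.

Lemma measurable_fun2 d (T : measurableType d) (m : R -> R -> R)
    (f g : T -> R) :
  measurable_fun setT (fun z : R * R => m z.1 z.2) ->
  measurable_fun setT f -> measurable_fun setT g ->
  measurable_fun setT (fun x => m (f x) (g x)).
Proof.
by move=> mm mf mg; exact: (measurableT_comp mm (measurable_fun_pair mf mg)).
Qed.

Lemma measurable_fun1 d d' (T : measurableType d) (T' : measurableType d')
    (p : T' -> R) (f : T -> T') :
  measurable_fun setT p -> measurable_fun setT f ->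
  measurable_fun setT (fun x => p (f x)).
Proof. by move=> mm mf; exact: (measurableT_comp mm mf). Qed.

Lemma measurable_section1 (m : R -> R -> R) x :
  measurable_fun setT (fun z : R * R => m z.1 z.2) ->
  measurable_fun setT (m x).
Proof. by move=> mm; exact: (measurable_fun2 mm). Qed.

End lebesgue_integrals.

Lemma measurable_fun_normr d (T : measurableType d) (R : realType) (D : set T)
    (f : T -> R) : measurable_fun D f -> measurable_fun D (fun x => `|f x|).
Proof. by move=> mf; apply: measurableT_comp => //; exact: normr_measurable. Qed.

(** The recursion follows the arithmetic operations, expR, norms, projections
    and compositions; the leaves are closed by hypotheses of the context,
    applied to one or two arguments. *)
Ltac mfun :=
  cbv beta;
  match goal with
  | |- measurable_fun _ (fun x => @?f x + @?g x) =>
      apply: (@measurable_funD _ _ _ _ f g); mfun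
  | |- measurable_fun _ (fun x => - @?f x) =>
      apply: (@measurable_funN _ _ _ _ f); mfun
  | |- measurable_fun _ (fun x => @?f x * @?g x) =>
      apply: (@measurable_funM _ _ _ _ f g); mfun
  | |- measurable_fun _ (fun x => expR (@?f x)) =>
      apply: (@measurable_fun_expR _ _ _ _ f); mfun
  | |- measurable_fun _ (fun x => `| @?f x |) =>
      apply: (@measurable_fun_normr _ _ _ _ f); mfun
  | _ => first
    [ exact: measurable_cst | exact: measurable_id
    | exact: measurable_fst | exact: measurable_snd
    | eassumption
    | (apply: measurable_section1; eassumption)
    | match goal with
      | |- measurable_fun _ (fun x => (@?f x).1) =>
          apply: (measurableT_comp measurable_fst (g := f)); mfun
      | |- measurable_fun _ (fun x => (@?f x).2) =>
          apply: (measurableT_comp measurable_snd (g := f)); mfun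
      | H : measurable_fun setT (fun z => ?m z.1 z.2) |-
          measurable_fun _ (fun x => ?m (@?f x) (@?g x)) =>
          apply: (@measurable_fun2 _ _ _ m f g H); mfun
      | H : measurable_fun setT ?m |- measurable_fun _ (fun x => ?m (@?f x)) =>
          apply: (@measurable_fun1 _ _ _ _ _ m f H); mfun
      end
    | idtac ]
  end.



(** * Exponentials and the Heaviside function *)

Section exponential_integrals.
Context {R : realType}.
Local Notation mu := (@lebesgue_measure R).

Lemma is_derive_continuous (F : R -> R) (x f : R) :
  is_derive x 1 F f -> {for x, continuous F}.
Proof. by case=> dF _; apply/differentiable_continuous/derivable1_diffP. Qed.

Lemma Rint_FTC (F f : R -> R) (a b : R) : a <= b ->
  (forall x : R, is_derive x 1 F (f x)) -> continuous f ->
  \int[mu]_(x in `[a, b]) f x = F b - F a.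
Proof.
rewrite le_eqVlt => /predU1P[-> _ _|ab dF cf].
  by rewrite set_itv1 Rintegral_set1 subrr.
have cF : continuous F by move=> x; exact: is_derive_continuous (dF x).
rewrite /Rintegral (continuous_FTC2 (F := F) ab)//.
- exact: continuous_subspaceT.
- split; first by move=> x _; case: (dF x).
  + exact: cvg_at_right_filter (cF a).
  + exact: cvg_at_left_filter (cF b).
- by move=> x _; rewrite derive1E; apply: derive_val.
Qed.

Lemma Rint_oc_cc (f : R -> R) (a : R) (b : itv_bound R) :
  measurable_fun setT f ->
  \int[mu]_(x in [set` Interval (BRight a) b]) f x =
  \int[mu]_(x in [set` Interval (BLeft a) b]) f x.
Proof.
move=> mf; congr fine; apply: integral_itv_obnd_cbnd.
by apply/measurable_EFinP; apply: measurable_funTS; exact: mf.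
Qed.

Definition heaviside (r : R) : R := (0 <= r)%R%:R.

Lemma heaviside_ge0 r : 0 <= heaviside r.
Proof. by rewrite /heaviside; case: (0 <= r). Qed.

Lemma heaviside_le1 r : heaviside r <= 1.
Proof. by rewrite /heaviside; case: (0 <= r). Qed.

Lemma measurable_heaviside : measurable_fun [set: R] heaviside.
Proof.
apply: nondecreasing_measurable => //.
move=> x y xy; rewrite /heaviside; have [x0|//] := boolP (0 <= x).
by rewrite (le_trans x0 xy).
Qed.

Lemma Rint_heaviside_le (f : R -> R) (r : R) :
  \int[mu]_(t in `]0, +oo[) (f t * heaviside (r - t)) = \int[mu]_(t in `]0, r]) f t.
Proof.
rewrite (_ : `]0, r]%classic = `]0, +oo[ `&` `]-oo, r]%classic); last first.
  apply/seteqP; split=> t /=; rewrite !in_itv/= andbT.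
    by move=> /andP[-> ->].
  by move=> [-> ->].
rewrite Rintegral_mkcondr; apply: eq_Rintegral => t _.
rewrite patchE mem_setE in_itv/= /heaviside subr_ge0.
by case: ifP => _; rewrite ?mulr1 ?mulr0.
Qed.

Lemma Rint_heaviside_ge (f : R -> R) (r : R) : 0 <= r ->
  measurable_fun [set: R] f ->
  \int[mu]_(t in `]0, +oo[) (f t * heaviside (t - r)) = \int[mu]_(t in `[r, +oo[) f t.
Proof.
move=> r0 mf.
transitivity (\int[mu]_(t in `]0, +oo[ `&` `[r, +oo[) f t).
  rewrite Rintegral_mkcondr; apply: eq_Rintegral => t _.
  rewrite patchE mem_setE in_itv/= /heaviside subr_ge0 andbT.
  by case: ifP => _; rewrite ?mulr1 ?mulr0.
move: r0; rewrite le_eqVlt => /predU1P[<-|r0].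
  rewrite -Rint_oc_cc//.
  congr (Rintegral _ _ _); apply/seteqP; split=> t /=; rewrite !in_itv/= !andbT.
    by move=> [].
  by move=> t0; split => //; exact: ltW.
congr (Rintegral _ _ _); apply/seteqP; split=> t /=; rewrite !in_itv/= !andbT.
  by move=> [].
by move=> rt; split => //; exact: lt_le_trans rt.
Qed.

Lemma is_derive_expR_lin (k x : R) :
  is_derive x 1 (fun t => expR (k * t)) (k * expR (k * x)).
Proof.
apply: is_derive_eq.
by rewrite /GRing.scale /= mulr1 mulrC.
Qed.

Lemma is_derive_expR_scale (a k x : R) :
  is_derive x 1 (fun t => a * expR (k * t)) (a * (k * expR (k * x))).
Proof. exact: (is_deriveZ a (is_derive_expR_lin k x)). Qed.

Lemma continuous_expR_lin (k : R) : continuous (fun t => expR (k * t)).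
Proof. by move=> x; exact: is_derive_continuous (is_derive_expR_lin k x). Qed.

Lemma cvg_expR_lin (k : R) : 0 < k -> expR (- k * t) @[t --> +oo] --> (0 : R).
Proof.
move=> k0.
have H : k * t @[t --> +oo] --> +oo by apply: gt0_cvgMry => //; exact: cvg_id.
have := @cvg_comp _ _ _ (fun t => k * t) (fun t : R => expR (- t)) _ _ _ H (@cvgr_expR R).
by apply: cvg_trans; apply: near_eq_cvg; apply: nearW => t /=; rewrite mulNr.
Qed.

Let intexp (k r : R) : 0 < k ->
  (\int[mu]_(t in `[r, +oo[) (expR (- k * t))%:E)%E = (expR (- k * r) / k)%:E.
Proof.
move=> k0.
pose F (t : R) : R := - k^-1 * expR (- k * t).
have dF (x : R) : is_derive x 1 F (expR (- k * x)).
  have H := is_derive_expR_scale (- k^-1) (- k) x.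
  apply: is_derive_eq.
  by rewrite mulrA mulrNN mulVf ?mul1r// gt_eqF.
rewrite (@ge0_continuous_FTC2y R _ F r 0)//.
- by rewrite -EFinB; congr EFin; rewrite /F; ring.
- by apply: continuous_subspaceT; exact: continuous_expR_lin.
- rewrite [X in _ --> X](_ : 0 = - k^-1 * 0); last by rewrite mulr0.
  by apply: cvgMr; exact: cvg_expR_lin.
- apply: cvg_at_right_filter; exact: is_derive_continuous (dF r).
- by move=> x _; rewrite derive1E; apply: derive_val.
Qed.

Lemma integrable_expR (k : R) : 0 < k ->
  mu.-integrable `]0, +oo[ (EFin \o (fun t => expR (- k * t))).
Proof.
move=> k0.
have : mu.-integrable `[0, +oo[ (EFin \o (fun t => expR (- k * t))).
  apply/integrableP; split.
    by apply/measurable_EFinP; apply: measurable_fun_onT;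
       apply: continuous_measurable_fun; exact: continuous_expR_lin.
  under eq_integral do rewrite /= ger0_norm ?expR_ge0//.
  by rewrite intexp// ltry.
apply: leb_integrableS; [exact: measurable_itv|exact: measurable_itv|].
by apply: subset_itvr; rewrite bnd_simp.
Qed.

Lemma Rint_expR_ge (k r : R) : 0 < k -> 0 <= r ->
  \int[mu]_(t in `]0, +oo[) (expR (- k * t) * heaviside (t - r)) = expR (- k * r) / k.
Proof.
move=> k0 r0; rewrite Rint_heaviside_ge//.
  by rewrite /Rintegral intexp.
by apply: continuous_measurable_fun; exact: continuous_expR_lin.
Qed.

Lemma Rint_expR (k : R) : 0 < k ->
  \int[mu]_(t in `]0, +oo[) expR (- k * t) = k^-1.
Proof.
move=> k0; have := @Rint_expR_ge k 0 k0 (lexx _).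
rewrite mulr0 expR0 mul1r => <-; apply: leb_eq_Rint => t /=; rewrite in_itv/= andbT => t0.
by rewrite subr0 /heaviside ltW// mulr1.
Qed.

Lemma Rint_expR_le (c r : R) : 0 < c -> 0 <= r ->
  \int[mu]_(t in `]0, +oo[) (expR (c * t) * heaviside (r - t)) <= expR (c * r) / c.
Proof.
move=> c0 r0; rewrite Rint_heaviside_le.
have mf : measurable_fun setT (fun t : R => expR (c * t)).
  by apply: continuous_measurable_fun; exact: continuous_expR_lin.
rewrite Rint_oc_cc//.
have dF (x : R) : is_derive x 1 (fun t => c^-1 * expR (c * t)) (expR (c * x)).
  have H := is_derive_expR_scale c^-1 c x.
  by apply: is_derive_eq; rewrite mulrA mulVf ?mul1r// gt_eqF.
have -> := Rint_FTC r0 dF (@continuous_expR_lin c).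
by rewrite mulrC lerBlDr lerDl mulr0 expR0 mulr1 invr_ge0 ltW.
Qed.

Lemma integrable_heaviside_le (f : R -> R) (r B : R) : measurable_fun [set: R] f ->
  (forall t, 0 < t -> t <= r -> `|f t| <= B) ->
  mu.-integrable `]0, +oo[ (EFin \o (fun t => f t * heaviside (r - t))).
Proof.
move=> mf fB.
have mh := measurable_heaviside.
have H : mu.-integrable `]0, r] (EFin \o f).
  apply: (@leb_integrable_bnd _ _ _ B); [exact: measurable_itv|exact: leb_itv_lty| |].
    exact: measurable_funTS.
  by move=> t /=; rewrite in_itv/= => /andP[]; exact: fB.
have mI : measurable (`]0, +oo[ : set R) by exact: measurable_itv.
have mJ : measurable (`]0, r] : set R) by exact: measurable_itv.
apply/(leb_integrable_patch _ mI); move/(leb_integrable_patch _ mJ) : H => H.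
apply: (@leb_eq_integrable _ _ _ _ measurableT H) => t _; rewrite !patchE !mem_setE !in_itv/= andbT.
rewrite /heaviside subr_ge0; case: (0 < t) => //=.
by case: ifP; rewrite ?mulr1 ?mulr0.
Qed.

Lemma Rint_lt_heaviside (T t : R) (w : R -> R) : 0 < t -> t < T ->
  mu.-integrable `]0, T[ (EFin \o w) ->
  \int[mu]_(z in `]0, t[) w z = \int[mu]_(z in `]0, T[) (heaviside (t - z) * w z).
Proof.
move=> t0 tT wi; have mI : measurable (`]0, T[ : set R) by exact: measurable_itv.
pose w0 := w \_ `]0, T[.
have mw0 : measurable_fun setT w0.
  by have /(measurable_restrictT _ mI).1 := leb_measurable wi.
have w0E z : 0 < z -> z < T -> w0 z = w z.
  by move=> z0 zT; rewrite /w0 patchE mem_set//= in_itv/= z0.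
transitivity (\int[mu]_(z in `]0, t]) w0 z).
  rewrite (@leb_eq_Rint _ _ _ w0); last first.
    move=> z /=; rewrite in_itv/= => /andP[z0 zt]; rewrite w0E//; exact: lt_trans tT.
  by congr fine; apply: integral_itv_bndo_bndc; apply/measurable_EFinP; exact: measurable_fun_onT.
rewrite (_ : `]0, t]%classic = `]0, T[ `&` `]-oo, t]%classic); last first.
  apply/seteqP; split=> z /=; rewrite !in_itv/=.
    by move=> /andP[-> zt]; rewrite zt (le_lt_trans zt tT).
  by move=> [/andP[-> _] ->].
rewrite Rintegral_mkcondr; apply: leb_eq_Rint => z /=; rewrite in_itv/= => /andP[z0 zT].
rewrite patchE mem_setE in_itv/=.
by rewrite /heaviside subr_ge0; case: ifP; rewrite ?mul1r ?mul0r// w0E.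
Qed.

End exponential_integrals.

(** * The wave kernel with a Neumann condition *)

Section wave_operator.
Context {R : realType}.
Local Notation mu := (@lebesgue_measure R).
Implicit Types (m : R -> R -> R) (E p : R -> R).

(** The resolvent kernel of k^2 - d^2/dy^2 on the half line with the Neumann
    condition at 0, by reflection of the kernel of the whole line. *)
Definition neumann (k y z : R) : R :=
  (expR (- k * `|y - z|) + expR (- k * (y + z))) / (2 * k).

(** The solution of the wave equation on the half line with the Neumann
    condition, zero initial displacement and a unit initial velocity
    concentrated at z. *)
Definition wave_kernel (y z t : R) : R :=
  (heaviside (t - `|y - z|) + heaviside (t - (y + z))) / 2.

Definition laplace (k : R) (m : R -> R) : R :=
  \int[mu]_(t in `]0, +oo[) (expR (- k * t) * m t).

(** In time, the integral is a convolution: the kernel vanishes for s > t. *)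
Definition wave_conv m (y z t : R) : R :=
  \int[mu]_(s in `]0, +oo[) (m z s * wave_kernel y z (t - s)).

(** The waves emitted by the sources p m. The Heaviside factors extend it by 0
    outside the quadrant, so that bounds hold on the whole plane. *)
Definition wave_op l p m (y t : R) : R :=
  heaviside y * heaviside t * \int[mu]_(z in `]0, l[) (p z * wave_conv m y z t).

(** The norms used for the Volterra equations: c makes the operators contract,
    and E, nondecreasing, records how much of the data is inside the domain of
    dependence of (y, t), which meets t = 0 below y + t. *)
Definition cone_weight E (c y t : R) : R :=
  heaviside y * heaviside t * (E (y + t) * expR (c * t)).

Let mh := @measurable_heaviside R.

Lemma wave_kernel_ge0 y z t : 0 <= wave_kernel y z t.
Proof. by rewrite divr_ge0// addr_ge0// heaviside_ge0. Qed.

Lemma wave_kernel_le y z t : 0 <= y -> 0 <= z ->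
  wave_kernel y z t <= heaviside (t - `|y - z|).
Proof.
move=> y0 z0; rewrite /wave_kernel ler_pdivrMr// mulr_natr mulr2n lerD2l.
rewrite /heaviside !subr_ge0; have [h|//] := boolP (y + z <= t).
by rewrite (le_trans _ h)// ler_norml; apply/andP; split; lra.
Qed.

Lemma wave_kernel_le_heaviside y z t : 0 <= y -> 0 <= z ->
  wave_kernel y z t <= heaviside t.
Proof.
move=> y0 z0; apply: (le_trans (wave_kernel_le t y0 z0)).
rewrite /heaviside subr_ge0; have [h|//] := boolP (`|y - z| <= t).
by rewrite (le_trans _ h).
Qed.

Lemma measurable_wave_kernel d (T : measurableType d) (f g h : T -> R) :
  measurable_fun setT f -> measurable_fun setT g -> measurable_fun setT h ->
  measurable_fun setT (fun x => wave_kernel (f x) (g x) (h x)).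
Proof. by move=> mf mg mh'; rewrite /wave_kernel; mfun. Qed.

(** Both fronts, at distances |y - z| and y + z, transform into exponentials. *)
Lemma laplace_wave_kernel k y z s : 0 < k -> 0 <= y -> 0 <= z -> 0 <= s ->
  laplace k (fun t => wave_kernel y z (t - s)) = expR (- k * s) * neumann k y z.
Proof.
move=> k0 y0 z0 s0; rewrite /laplace.
have ih r : mu.-integrable `]0, +oo[ (EFin \o (fun t => expR (- k * t) * heaviside (t - r))).
  apply: (leb_integrable_le _ _ (integrable_expR k0)); first exact: measurable_itv.
    by apply: measurable_fun_onT; mfun.
  move=> t _; rewrite normrM ger0_norm ?expR_ge0// ler_piMr ?expR_ge0//.
  by rewrite ger0_norm ?heaviside_ge0// heaviside_le1.
rewrite (@leb_eq_Rint _ _ _ (fun t => 2^-1 * (expR (- k * t) * heaviside (t - (s + `|y - z|)) +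
   expR (- k * t) * heaviside (t - (s + (y + z)))))); last first.
  by move=> t _; rewrite /wave_kernel !opprD !addrA; field.
rewrite leb_RintZl; [|exact: measurable_itv|exact: leb_integrableD].
rewrite leb_RintD; [|exact: measurable_itv|exact: ih|exact: ih].
rewrite !Rint_expR_ge ?addr_ge0//.
rewrite /neumann !mulrDr !expRD; field.
by rewrite gt_eqF.
Qed.

Lemma measurable_wave_conv d (T : measurableType d) m (f g h : T -> R) :
  measurable_fun setT (fun z : R * R => m z.1 z.2) ->
  measurable_fun setT f -> measurable_fun setT g -> measurable_fun setT h ->
  measurable_fun setT (fun x => wave_conv m (f x) (g x) (h x)).
Proof.
move=> mm mf mg mh'.
apply: (@leb_measurable_Rint R _ T _ (fun x s => m (g x) s * wave_kernel (f x) (g x) (h x - s))).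
  exact: measurable_itv.
apply: measurable_funM; first by mfun.
apply: measurable_wave_kernel; mfun.
Qed.

Lemma measurable_wave_op l p m :
  measurable_fun setT (fun z : R * R => m z.1 z.2) -> measurable_fun setT p ->
  measurable_fun setT (fun z : R * R => wave_op l p m z.1 z.2).
Proof.
move=> mm mp; rewrite /wave_op.
apply: measurable_funM; first by mfun.
apply: (@leb_measurable_Rint R _ _ _ (fun (x : R * R) z => p z * wave_conv m x.1 z x.2)).
  exact: measurable_itv.
apply: measurable_funM; first by mfun.
by apply: measurable_wave_conv => //; mfun.
Qed.

Section bounds.
Context (E : R -> R) (c : R).
Context (E0 : forall r, 0 <= E r) (Emono : forall r s, r <= s -> E r <= E s).
Context (c0 : 0 < c).

Lemma cone_weight_ge0 y t : 0 <= cone_weight E c y t.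
Proof. by rewrite !mulr_ge0 ?heaviside_ge0 ?expR_ge0. Qed.

Context (m : R -> R -> R) (K : R) (K0 : 0 <= K).
Context (mm : measurable_fun setT (fun z : R * R => m z.1 z.2)).
Context (mK : forall y t, `|m y t| <= K * cone_weight E c y t).

(** Finite speed of propagation: the kernel vanishes unless z + s <= y + t, and
    E is nondecreasing. *)
Lemma wave_conv_integrand y z t s : 0 <= y -> 0 <= z -> 0 < s ->
  `|m z s * wave_kernel y z (t - s)| <=
    K * E (y + t) * (expR (c * s) * heaviside (t - s)).
Proof.
move=> y0 z0 s0; rewrite normrM [`|wave_kernel _ _ _|]ger0_norm ?wave_kernel_ge0//.
have [h|h] := leP `|y - z| (t - s); last first.
  have /le_anti -> : wave_kernel y z (t - s) <= 0 <= wave_kernel y z (t - s).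
    rewrite wave_kernel_ge0 andbT (le_trans (wave_kernel_le _ y0 z0))//.
    by rewrite /heaviside subr_ge0; have /negbTE -> : ~~ (`|y - z| <= t - s) by rewrite -ltNge.
  by rewrite mulr0 !mulr_ge0 ?expR_ge0 ?heaviside_ge0.
rewrite mulrA; apply: ler_pM => //; first exact: wave_kernel_ge0.
  apply: (le_trans (mK z s)); rewrite -mulrA ler_wpM2l// /cone_weight.
  rewrite {1 2}/heaviside z0 (ltW s0) !mul1r ler_wpM2r ?expR_ge0// Emono//.
  by have := ler_norm (z - y); rewrite distrC => h'; lra.
exact: wave_kernel_le_heaviside.
Qed.

Lemma wave_conv_integrable y z t : 0 <= y -> 0 <= z ->
  mu.-integrable `]0, +oo[ (EFin \o (fun s => m z s * wave_kernel y z (t - s))).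
Proof.
move=> y0 z0.
have H : mu.-integrable `]0, +oo[ (EFin \o (fun s => K * E (y + t) * (expR (c * s) * heaviside (t - s)))).
  apply: leb_integrableZl; first exact: measurable_itv.
  apply: (@integrable_heaviside_le _ _ _ (expR (c * t))); first by mfun.
  move=> s s0 st; rewrite ger0_norm ?expR_ge0// ler_expR ler_wpM2l//.
  exact: ltW.
apply: (leb_integrable_le _ _ H); first exact: measurable_itv.
  apply: measurable_fun_onT; apply: measurable_funM; first by mfun.
  by apply: measurable_wave_kernel; mfun.
by move=> s /=; rewrite in_itv/= andbT; exact: wave_conv_integrand.
Qed.

(** The factor 1 / c comes from integrating e^(c s) up to s = t. *)
Lemma wave_conv_bound y z t : 0 <= y -> 0 <= z -> 0 <= t ->
  `|wave_conv m y z t| <= K / c * (E (y + t) * expR (c * t)).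
Proof.
move=> y0 z0 t0.
have H : mu.-integrable `]0, +oo[ (EFin \o (fun s => expR (c * s) * heaviside (t - s))).
  apply: (@integrable_heaviside_le _ _ _ (expR (c * t))); first by mfun.
  move=> s s0 st; rewrite ger0_norm ?expR_ge0// ler_expR ler_wpM2l//.
  exact: ltW.
have mI : measurable (`]0, +oo[ : set R) by exact: measurable_itv.
rewrite (le_trans (leb_normr_le mI _ (leb_integrableZl (K * E (y + t)) mI H) _))//.
- exact: leb_measurable (wave_conv_integrable t y0 z0).
- by move=> s /=; rewrite in_itv/= andbT; exact: wave_conv_integrand.
rewrite leb_RintZl//; apply: (le_trans (ler_wpM2l _ (Rint_expR_le c0 t0))).
  exact: mulr_ge0.
by rewrite le_eqVlt; apply/orP; left; apply/eqP; ring.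
Qed.

Context (l M : R) (p : R -> R) (l0 : 0 < l).
Context (mp : measurable_fun setT p) (pM : forall z, `|p z| <= M).

Lemma wave_op_integrable y t : 0 <= y -> 0 <= t ->
  mu.-integrable `]0, l[ (EFin \o (fun z => p z * wave_conv m y z t)).
Proof.
move=> y0 t0.
apply: (@leb_integrable_bnd _ _ _ (M * (K / c * (E (y + t) * expR (c * t))))).
- exact: measurable_itv.
- exact: leb_itv_lty.
- apply: measurable_fun_onT; apply: measurable_funM => //.
  by apply: measurable_wave_conv => //; mfun.
- move=> z /=; rewrite in_itv/= => /andP[z0 _]; rewrite normrM ler_pM//.
  by rewrite wave_conv_bound// ltW.
Qed.

Lemma wave_op_bound y t :
  `|wave_op l p m y t| <= l * M / c * K * cone_weight E c y t.
Proof.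
have M0 : 0 <= M by exact: le_trans (pM 0).
rewrite /wave_op /cone_weight !normrM ![`|heaviside _|]ger0_norm ?heaviside_ge0//.
rewrite /heaviside; case: (leP 0 y) => y0; last by rewrite !mul0r mulr0.
case: (leP 0 t) => t0; last by rewrite !(mulr0, mul0r).
rewrite !mul1r.
apply: (le_trans (@leb_normr_bnd _ _ _ (M * (K / c * (E (y + t) * expR (c * t)))) _ _ _ _)).
- exact: measurable_itv.
- exact: leb_itv_lty.
- apply: measurable_fun_onT; apply: measurable_funM => //.
  by apply: measurable_wave_conv => //; mfun.
- move=> z /=; rewrite in_itv/= => /andP[z0 _]; rewrite normrM ler_pM//.
  by rewrite wave_conv_bound// ltW.
rewrite lebesgue_measure_itv/= lte_fin l0 -EFinB subr0 /=.
by rewrite le_eqVlt; apply/orP; left; apply/eqP; ring.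
Qed.

End bounds.

Lemma wave_opB E c m m' K K' l M p : (forall r, 0 <= E r) ->
  (forall r s, r <= s -> E r <= E s) -> 0 < c -> 0 <= K -> 0 <= K' ->
  measurable_fun setT (fun z : R * R => m z.1 z.2) ->
  measurable_fun setT (fun z : R * R => m' z.1 z.2) ->
  (forall y t, `|m y t| <= K * cone_weight E c y t) ->
  (forall y t, `|m' y t| <= K' * cone_weight E c y t) ->
  0 < l -> measurable_fun setT p -> (forall z, `|p z| <= M) ->
  forall y t, wave_op l p (fun y t => m y t - m' y t) y t =
    wave_op l p m y t - wave_op l p m' y t.
Proof.
move=> E0 Emono c0 K0 K'0 mm mm' mK mK' l0 mp pM y t.
rewrite /wave_op -mulrBr /heaviside.
case: (leP 0 y) => y0; last by rewrite !mul0r.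
case: (leP 0 t) => t0; last by rewrite mulr0 !mul0r.
congr (_ * _); rewrite -leb_RintB; [|exact: measurable_itv| |]; last 2 first.
- exact: (@wave_op_integrable E c E0 Emono c0 _ K K0 mm mK).
- exact: (@wave_op_integrable E c E0 Emono c0 _ K' K'0 mm' mK').
apply: leb_eq_Rint => z /=; rewrite in_itv/= => /andP[/ltW z0 _].
rewrite -mulrBr; congr (_ * _); rewrite /wave_conv -leb_RintB.
- by apply: leb_eq_Rint => s _; rewrite mulrBl.
- exact: measurable_itv.
- exact: (@wave_conv_integrable E c E0 Emono c0 _ K K0 mm mK).
- exact: (@wave_conv_integrable E c E0 Emono c0 _ K' K'0 mm' mK').
Qed.

End wave_operator.

(** * Volterra equations *)

Section volterra_fixpoint.
Context {R : realType}.
Context (w : R -> R -> R) (op : (R -> R -> R) -> R -> R -> R).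
Let meas (m : R -> R -> R) := measurable_fun setT (fun z : R * R => m z.1 z.2).
Context (w0 : forall y t, 0 <= w y t).
Context (op_meas : forall m, meas m -> meas (op m)).
Context (op_bound : forall K m, 0 <= K -> meas m ->
  (forall y t, `|m y t| <= K * w y t) ->
  forall y t, `|op m y t| <= K / 2 * w y t).
Context (opB : forall K K' m m', 0 <= K -> 0 <= K' -> meas m -> meas m' ->
  (forall y t, `|m y t| <= K * w y t) ->
  (forall y t, `|m' y t| <= K' * w y t) ->
  forall y t, op (fun y t => m y t - m' y t) y t = op m y t - op m' y t).

(** Picard iteration, convergent because the operator halves the bound by w. *)
Lemma volterra_fixpoint (phi : R -> R -> R) (K : R) :
  0 <= K -> meas phi -> (forall y t, `|phi y t| <= K * w y t) ->
  exists m, [/\ meas m, forall y t, `|m y t| <= 2 * K * w y t &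
    forall y t, m y t = phi y t - op m y t].
Proof.
move=> K0 mphi phiK.
pose it := fix it n := if n is n'.+1 then (fun y t => phi y t - op (it n') y t) else phi.
have mit n : meas (it n).
  by elim: n => [//|n IH] /=; apply: measurable_funB => //; exact: op_meas.
have Kw0 y t : 0 <= K * w y t by exact: le_trans (phiK y t).
have K20 : 0 <= 2 * K by rewrite mulr_ge0.
have itK n y t : `|it n y t| <= 2 * K * w y t.
  elim: n y t => [|n IH] y t /=.
    by rewrite (le_trans (phiK y t))// -mulrA mulr_natl mulr2n lerDl.
  rewrite (le_trans (ler_normB _ _))// (_ : 2 * K * w y t = K * w y t + (2 * K) / 2 * w y t); last by field.
  by rewrite lerD// op_bound.
have half_ge0 n : 0 <= K * 2^-1 ^+ n by rewrite mulr_ge0// exprn_ge0.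
have itS n y t : `|it n y t - it n.+1 y t| <= K * 2^-1 ^+ n.+1 * w y t.
  elim: n y t => [|n IH] y t.
    by rewrite /= opprB addrCA subrr addr0 expr1 op_bound.
  rewrite [it n.+1]/= [it n.+2]/= -/it.
  rewrite (_ : _ - _ = - (op (it n) y t - op (it n.+1) y t)); last by rewrite [it n.+1]/=; ring.
  rewrite normrN -(opB K20 K20)//.
  rewrite (_ : K * _ * _ = K * 2^-1 ^+ n.+1 / 2 * w y t); last by rewrite (exprSr _ n.+1); ring.
  apply: op_bound => //.
  exact: (measurable_funB (mit n) (mit n.+1)).
have itD n j y t : `|it n y t - it (n + j)%N y t| <= K * 2^-1 ^+ n * (1 - 2^-1 ^+ j) * w y t.
  elim: j => [|j IH]; first by rewrite addn0 subrr normr0 expr0 subrr mulr0 mul0r.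
  rewrite addnS (_ : it n y t - _ = (it n y t - it (n + j)%N y t) + (it (n + j)%N y t - it (n + j).+1 y t)); last by ring.
  rewrite (le_trans (ler_normD _ _))// (le_trans (lerD IH (itS _ _ _)))//.
  by rewrite -addnS exprD exprSr le_eqVlt; apply/orP; left; apply/eqP; field.
have cit y t : cvgn (fun n => it n y t).
  pose u n := it n.+1 y t - it n y t.
  have -> : (fun n => it n y t) = (fun n => phi y t + series u n).
    apply/funext => n; rewrite /series /= telescope_sumr//.
    by rewrite addrCA subrr addr0.
  apply: is_cvgD; first exact: is_cvg_cst.
  apply: normed_cvg.
  apply: (@series_le_cvg _ _ (geometric (K * 2^-1 * w y t) 2^-1)).
  - by move=> n; exact: normr_ge0.
  - by move=> n; rewrite /geometric /= mulrAC mulr_ge0// -?mulrA ?mulr_ge0 ?exprn_ge0// mulrCA mulr_ge0.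
  - move=> n; rewrite /u /= distrC (le_trans (itS n y t))//= exprS.
    by rewrite le_eqVlt; apply/orP; left; apply/eqP; ring.
  - by apply: is_cvg_geometric_series; rewrite ger0_norm// invf_lt1// ltr1n.
pose m y t := limn (fun n => it n y t).
have cm y t : it n y t @[n --> \oo] --> m y t by exact: cit.
have mm : meas m.
  apply: (@measurable_fun_cvg _ _ _ _ (fun n (z : R * R) => it n z.1 z.2)) => //.
have mit_m n y t : `|it n y t - m y t| <= K * 2^-1 ^+ n * w y t.
  apply: (@cvgn_normr_le _ (fun j => it n y t - it (n + j)%N y t)).
    apply: cvgB; first exact: cvg_cst.
    have := cm y t; rewrite -(cvg_shiftn n).
    by apply: cvg_trans; apply: near_eq_cvg; apply: nearW => j /=; rewrite addnC.
  move=> j; rewrite (le_trans (itD n j y t))// ler_wpM2r//.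
  by rewrite ler_piMr// lerBlDr lerDl exprn_ge0.
exists m; split => //.
  move=> y t; apply: (cvgn_normr_le (cm y t)) => n; exact: itK.
move=> y t; apply/eqP; rewrite -subr_eq0 -normr_le0.
have h n : `|m y t - (phi y t - op m y t)| <= K * 2^-1 ^+ n * w y t.
  rewrite (_ : m y t - _ = - (it n.+1 y t - m y t) - (op (it n) y t - op m y t)); last by rewrite /=; ring.
  rewrite (le_trans (ler_normB _ _))// normrN.
  rewrite (le_trans (lerD (mit_m n.+1 y t) (_ : _ <= K * 2^-1 ^+ n / 2 * w y t)))//.
    rewrite -(opB K20 K20)//; last first.
      by move=> y' t'; apply: (cvgn_normr_le (cm y' t')) => j; exact: itK.
    by apply: op_bound => //; exact: (measurable_funB (mit n) mm).
  by rewrite exprSr le_eqVlt; apply/orP; left; apply/eqP; field.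
have : K * 2^-1 ^+ n * w y t @[n --> \oo] --> K * 0 * w y t.
  apply: cvgMl; apply: cvgMr; apply: cvg_expr.
  by rewrite ger0_norm// invf_lt1// ltr1n.
rewrite mulr0 mul0r => h0.
rewrite -(cvg_lim (@Rhausdorff R) h0); apply: limr_ge; first exact: cvgP h0.
by near=> n; exact: h.
Unshelve. all: by end_near. Qed.

End volterra_fixpoint.

(** * From the wave kernel to the resolvent kernel *)

Section laplace_wave.
Context {R : realType}.
Local Notation mu := (@lebesgue_measure R).

Let mh := @measurable_heaviside R.
Let mP : measurable (`]0, +oo[ : set R) := measurable_itv _.

Lemma neumann_ge0 (k y z : R) : 0 < k -> 0 <= neumann k y z.
Proof. by move=> k0; rewrite divr_ge0 ?addr_ge0 ?expR_ge0// mulr_ge0// ltW. Qed.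

Lemma neumann_le (k y z : R) : 0 < k -> 0 <= y -> 0 <= z ->
  neumann k y z <= expR (- k * `|y - z|) / k.
Proof.
move=> k0 y0 z0; rewrite /neumann ler_pdivrMr; last by rewrite mulr_gt0.
rewrite (_ : _ / k * (2 * k) = expR (- k * `|y - z|) + expR (- k * `|y - z|)).
  rewrite lerD2l ler_expR !mulNr lerN2 ler_wpM2l ?(ltW k0)//.
  by rewrite ler_norml; apply/andP; split; lra.
by field; rewrite gt_eqF.
Qed.

Lemma neumann_le_inv (k y z : R) : 0 < k -> 0 <= y -> 0 <= z ->
  neumann k y z <= k^-1.
Proof.
move=> k0 y0 z0; apply: (le_trans (neumann_le k0 y0 z0)).
rewrite ler_piMl ?invr_ge0 ?(ltW k0)// -expR0 ler_expR mulNr oppr_le0.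
by rewrite mulr_ge0// ltW.
Qed.

Lemma neumann0 (k z : R) : 0 <= z -> k != 0 -> neumann k 0 z = expR (- k * z) / k.
Proof.
move=> z0 k0; rewrite /neumann sub0r normrN ger0_norm// add0r.
by field.
Qed.

Lemma measurable_neumann d (T : measurableType d) (k : R) (f g : T -> R) :
  measurable_fun setT f -> measurable_fun setT g ->
  measurable_fun setT (fun x => neumann k (f x) (g x)).
Proof. by move=> mf mg; rewrite /neumann; mfun. Qed.

Lemma laplace_integrable (k c K : R) (m : R -> R) : c < k ->
  measurable_fun setT m -> (forall t, 0 < t -> `|m t| <= K * expR (c * t)) ->
  mu.-integrable `]0, +oo[ (EFin \o (fun t => expR (- k * t) * m t)).
Proof.
move=> ck mm mK.
have kc : 0 < k - c by rewrite subr_gt0.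
apply: (leb_integrable_le mP _ (leb_integrableZl K mP (integrable_expR kc))).
  by apply: measurable_fun_onT; mfun.
move=> t /=; rewrite in_itv/= andbT => t0.
rewrite normrM ger0_norm ?expR_ge0//.
apply: (le_trans (ler_wpM2l (expR_ge0 _) (mK t t0))).
rewrite mulrCA -expRD.
by rewrite le_eqVlt; apply/orP; left; apply/eqP; congr (_ * expR _); ring.
Qed.

Lemma laplace_bound (k c K : R) (m : R -> R) : c < k ->
  measurable_fun setT m -> (forall t, 0 < t -> `|m t| <= K * expR (c * t)) ->
  `|laplace k m| <= K / (k - c).
Proof.
move=> ck mm mK.
have kc : 0 < k - c by rewrite subr_gt0.
rewrite -Rint_expR// -leb_RintZl//; last exact: integrable_expR.
apply: leb_normr_le => //.
- by apply: measurable_fun_onT; mfun.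
- by apply: leb_integrableZl => //; exact: integrable_expR.
- move=> t /=; rewrite in_itv/= andbT => t0.
  rewrite normrM ger0_norm ?expR_ge0//.
  apply: (le_trans (ler_wpM2l (expR_ge0 _) (mK t t0))).
  rewrite mulrCA -expRD.
  by rewrite le_eqVlt; apply/orP; left; apply/eqP; congr (_ * expR _); ring.
Qed.

Definition wave_source l (g : R -> R) (y t : R) : R :=
  heaviside y * heaviside t * \int[mu]_(z in `]0, l[) (g z * wave_kernel y z t).

Lemma measurable_wave_source l (g : R -> R) : measurable_fun setT g ->
  measurable_fun setT (fun z : R * R => wave_source l g z.1 z.2).
Proof.
move=> mg; rewrite /wave_source.
apply: measurable_funM; first by mfun.
apply: (@leb_measurable_Rint R _ _ _ (fun (x : R * R) z => g z * wave_kernel x.1 z x.2)).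
  exact: measurable_itv.
apply: measurable_funM; first by mfun.
by apply: measurable_wave_kernel => //; mfun.
Qed.

Let mD (l : R) : measurable (`]0, l[ : set R) := measurable_itv _.

Lemma laplace_wave_source (k l M y : R) (g : R -> R) : 0 < k -> 0 <= y ->
  measurable_fun setT g -> (forall z, `|g z| <= M) ->
  laplace k (wave_source l g y) = \int[mu]_(z in `]0, l[) (neumann k y z * g z).
Proof.
move=> k0 y0 mg gM.
rewrite /laplace.
transitivity (\int[mu]_(t in `]0, +oo[) \int[mu]_(z in `]0, l[)
    (g z * (expR (- k * t) * wave_kernel y z t))).
  apply: leb_eq_Rint => t /=; rewrite in_itv/= andbT => t0.
  rewrite /wave_source {1 2}/heaviside y0 (ltW t0) !mul1r -leb_RintZl//; last first.
    apply: (@leb_integrable_bnd _ _ _ M) => //; first exact: leb_itv_lty.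
      apply: measurable_fun_onT; apply: measurable_funM => //.
      by apply: measurable_wave_kernel; mfun.
    move=> z /=; rewrite in_itv/= => /andP[/ltW z0 _].
    rewrite normrM [`|wave_kernel _ _ _|]ger0_norm ?wave_kernel_ge0//.
    rewrite -[M]mulr1 ler_pM// ?wave_kernel_ge0//.
    exact: (le_trans (wave_kernel_le_heaviside _ y0 z0) (heaviside_le1 _)).
  by apply: leb_eq_Rint => z _; ring.
rewrite leb_fubini//; last first.
  apply: (@leb_integrable_prod R _ _ (fun t => M * expR (- k * t)) (fun=> 1) (fun t z => g z * (expR (- k * t) * wave_kernel y z t))) => //.
  - apply: measurable_fun_onT; apply: measurable_funM; first by mfun.
    apply: measurable_funM; first by mfun.
    by apply: measurable_wave_kernel; mfun.
  - by apply: leb_integrableZl => //; exact: integrable_expR.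
  - by apply: leb_integrable_cst => //; exact: leb_itv_lty.
  - move=> t z /=; rewrite !in_itv/= andbT => t0 /andP[/ltW z0 _].
    rewrite mulr1 normrM ler_pM// normrM ger0_norm ?expR_ge0//.
    rewrite ler_piMr ?expR_ge0// ger0_norm ?wave_kernel_ge0//.
    exact: (le_trans (wave_kernel_le_heaviside _ y0 z0) (heaviside_le1 _)).
apply: leb_eq_Rint => z /=; rewrite in_itv/= => /andP[/ltW z0 _].
have H := laplace_wave_kernel k0 y0 z0 (lexx 0).
rewrite mulr0 expR0 mul1r in H.
rewrite leb_RintZl//; first by rewrite mulrC -H; congr (_ * _); apply: leb_eq_Rint => t _; rewrite subr0.
apply: (@laplace_integrable k 0 1) => //.
  by apply: measurable_wave_kernel; mfun.
move=> t _; rewrite mul0r expR0 mulr1 ger0_norm ?wave_kernel_ge0//.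
exact: (le_trans (wave_kernel_le_heaviside _ y0 z0) (heaviside_le1 _)).
Qed.

(** The transform of a convolution in time is a product; the exchanges of
    integrals are licensed by the growth rate c < k. *)
Lemma laplace_wave_op (k c K l M y : R) (m : R -> R -> R) (p : R -> R) :
  0 < c -> c < k -> 0 <= y -> 0 <= K -> 0 < l ->
  measurable_fun setT (fun z : R * R => m z.1 z.2) ->
  (forall y t, `|m y t| <= K * cone_weight (fun=> 1) c y t) ->
  measurable_fun setT p -> (forall z, `|p z| <= M) ->
  laplace k (wave_op l p m y) =
  \int[mu]_(z in `]0, l[) (neumann k y z * (p z * laplace k (m z))).
Proof.
move=> c0 ck y0 K0 l0 mm mK mp pM.
have k0 : 0 < k by exact: lt_trans ck.
(* an exponent between c and k, so that two exponentials decay below *)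
pose e := (k + c) / 2.
have [ke ec e0] : [/\ 0 < k - e, 0 < e - c & 0 <= e].
  by rewrite /e; clear -c0 k0 ck; split; lra.
have E0 : forall r : R, 0 <= (fun=> 1 : R) r by [].
have Em : forall r s : R, r <= s -> (fun=> 1 : R) r <= (fun=> 1 : R) s by [].
have M0 : 0 <= M by exact: le_trans (pM 0).
have mconv : measurable_fun setT (fun z : R * R => wave_conv m y z.2 z.1).
  by apply: measurable_wave_conv => //; mfun.
have cb z t : 0 <= z -> 0 <= t -> `|wave_conv m y z t| <= K / c * expR (c * t).
  move=> z0 t0; have := @wave_conv_bound R _ c E0 Em c0 m K K0 mm mK y z t y0 z0 t0.
  by rewrite mul1r.
rewrite /laplace.
transitivity (\int[mu]_(t in `]0, +oo[) \int[mu]_(z in `]0, l[)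
    (p z * (expR (- k * t) * wave_conv m y z t))).
  apply: leb_eq_Rint => t /=; rewrite in_itv/= andbT => t0.
  rewrite /wave_op {1 2}/heaviside y0 (ltW t0) !mul1r -leb_RintZl//; last first.
    exact: (@wave_op_integrable R _ c E0 Em c0 m K K0 mm mK l M p mp pM y t y0 (ltW t0)).
  by apply: leb_eq_Rint => z _; ring.
rewrite leb_fubini//; last first.
  apply: (@leb_integrable_prod R _ _ (fun t => K / c * M * expR (- (k - c) * t)) (fun=> 1) (fun t z => p z * (expR (- k * t) * wave_conv m y z t))) => //.
  - apply: measurable_fun_onT; apply: measurable_funM; first by mfun.
    by apply: measurable_funM; first by mfun.
  - by apply: leb_integrableZl => //; apply: integrable_expR; rewrite subr_gt0.
  - by apply: leb_integrable_cst => //; exact: leb_itv_lty.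
  - move=> t z /=; rewrite !in_itv/= andbT => t0 /andP[/ltW z0 _].
    rewrite mulr1 !normrM [`|expR _|]ger0_norm ?expR_ge0//.
    rewrite (_ : K / c * M * _ = M * (expR (- k * t) * (K / c * expR (c * t)))).
      rewrite ler_pM// ?mulr_ge0 ?expR_ge0// ler_wpM2l ?expR_ge0//.
      exact: cb _ _ z0 (ltW t0).
    by rewrite (_ : - (k - c) * t = - k * t + c * t) ?expRD; ring.
apply: leb_eq_Rint => z /=; rewrite in_itv/= => /andP[/ltW z0 _].
rewrite leb_RintZl//; last first.
  apply: (@laplace_integrable k c (K / c)) => //.
    by apply: measurable_wave_conv => //; mfun.
  by move=> t t0; apply: cb => //; exact: ltW.
rewrite mulrCA; congr (_ * _).
transitivity (\int[mu]_(t in `]0, +oo[) \int[mu]_(s in `]0, +oo[)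
    (m z s * (expR (- k * t) * wave_kernel y z (t - s)))).
  apply: leb_eq_Rint => t _; rewrite /wave_conv -leb_RintZl//; last first.
    exact: (@wave_conv_integrable R _ c E0 Em c0 m K K0 mm mK y z t y0 z0).
  by apply: leb_eq_Rint => s _; ring.
rewrite leb_fubini//; last first.
  apply: (@leb_integrable_prod R _ _ (fun t => expR (- (k - e) * t)) (fun s => K * expR (- (e - c) * s)) (fun t s => m z s * (expR (- k * t) * wave_kernel y z (t - s)))) => //.
  - apply: measurable_fun_onT; apply: measurable_funM; first by mfun.
    apply: measurable_funM; first by mfun.
    by apply: measurable_wave_kernel; mfun.
  - exact: integrable_expR.
  - by apply: leb_integrableZl => //; exact: integrable_expR.
  - move=> t s /=; rewrite !in_itv/= !andbT => t0 s0.
    rewrite normrM [X in _ * X <= _]ger0_norm; last by rewrite mulr_ge0 ?expR_ge0 ?wave_kernel_ge0.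
    have h1 : `|m z s| <= K * expR (c * s).
      apply: (le_trans (mK z s)); rewrite /cone_weight /heaviside z0 (ltW s0).
      by rewrite !mul1r.
    have h2 : wave_kernel y z (t - s) <= expR (e * (t - s)).
      apply: (le_trans (wave_kernel_le_heaviside _ y0 z0)); rewrite /heaviside.
      have [ts|_] := boolP (0 <= t - s); last exact: expR_ge0.
      by rewrite -expR0 ler_expR mulr_ge0.
    rewrite (_ : _ * (K * _) = K * expR (c * s) * (expR (- k * t) * expR (e * (t - s)))); last first.
      rewrite -[K * _ * _]mulrA -!expRD mulrCA -expRD; congr (_ * expR _); ring.
    apply: ler_pM => //; last by rewrite ler_wpM2l ?expR_ge0.
    by apply: mulr_ge0; [exact: expR_ge0|exact: wave_kernel_ge0].
rewrite -leb_RintZl//; last first.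
  apply: (@laplace_integrable k c K) => //; first by mfun.
  move=> t t0; apply: (le_trans (mK z t)); rewrite /cone_weight /heaviside z0 (ltW t0).
  by rewrite !mul1r.
apply: leb_eq_Rint => s /=; rewrite in_itv/= andbT => /ltW s0.
rewrite leb_RintZl//; last first.
  apply: (@laplace_integrable k 0 1) => //.
    by apply: measurable_wave_kernel; mfun.
  move=> t _; rewrite mul0r expR0 mulr1 ger0_norm ?wave_kernel_ge0//.
  exact: (le_trans (wave_kernel_le_heaviside _ y0 z0) (heaviside_le1 _)).
by have := laplace_wave_kernel k0 y0 z0 s0; rewrite /laplace => ->; ring.
Qed.

End laplace_wave.

(** * Translations *)

Section translation.
Context {R : realType}.
Local Notation mu := (@lebesgue_measure R).

Definition shiftr (z : R) : measurableTypeR R -> measurableTypeR R :=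
  fun x => x + z.

Lemma measurable_shiftr z : measurable_fun setT (shiftr z).
Proof. by apply: measurable_funD => //; exact: measurable_id. Qed.

HB.instance Definition _ z :=
  isMeasurableFun.Build _ _ _ _ (shiftr z) (measurable_shiftr z).

Lemma lebesgue_measure_shift (z : R) (A : set R) : measurable A ->
  pushforward mu (shiftr z) A = mu A.
Proof.
move=> mA; apply/esym/lebesgue_measure_unique => //= _ [[a b]] _ <-.
rewrite /pushforward.
rewrite (_ : _ @^-1` _ = `]a - z, b - z]%classic); last first.
  by apply/seteqP; split=> x /=; rewrite !in_itv/= ltrBlDr lerBrDr.
rewrite !lebesgue_measure_itv/= !lte_fin ltrD2r; case: ifP => // _.
by rewrite -!EFinB; congr EFin; ring.
Qed.

Lemma ge0_integral_shift (z : R) (f : R -> \bar R) :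
  measurable_fun [set: R] f -> (forall x, 0 <= f x)%E ->
  (\int[mu]_x f (x + z)%R = \int[mu]_x f x)%E.
Proof.
move=> mf f0.
have := @ge0_integral_pushforward _ _ (measurableTypeR R) (measurableTypeR R) R
  (shiftr z) (measurable_shiftr z) mu setT f measurableT.
rewrite preimage_setT => <-//.
apply: eq_measure_integral => //= A mA _; exact/lebesgue_measure_shift.
Qed.

Lemma Rint_shift (z : R) (f : R -> R) : measurable_fun [set: R] f ->
  \int[mu]_x f (x + z) = \int[mu]_x f x.
Proof.
move=> mf; congr fine.
rewrite integralE [RHS]integralE.
have mE : measurable_fun [set: R] (EFin \o f) by exact/measurable_EFinP.
have -> : (fun x => (f (x + z))%:E) = (EFin \o f) \o (fun x => x + z) by [].
rewrite funepos_comp funeneg_comp; congr (_ - _)%E.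
- by apply: (@ge0_integral_shift z ((EFin \o f)^\+)%E) => //; exact: measurable_funepos.
- by apply: (@ge0_integral_shift z ((EFin \o f)^\-)%E) => //; exact: measurable_funeneg.
Qed.

Lemma laplace_shift (k z : R) (m : R -> R) : 0 <= z -> 0 < k ->
  measurable_fun [set: R] m ->
  (forall s, s < 0 -> m s = 0) ->
  mu.-integrable `]0, +oo[ (EFin \o (fun t => expR (- k * t) * m t)) ->
  laplace k (fun t => m (t - z)) = expR (- k * z) * laplace k m.
Proof.
move=> z0 k0 mm m0 mi; rewrite /laplace.
have mh := @measurable_heaviside R.
have mP : measurable (`]0, +oo[ : set R) by exact: measurable_itv.
pose F s := heaviside s * (expR (- k * (s + z)) * m s).
rewrite -leb_RintZl// [LHS]Rint_oc_cc; last by mfun.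
rewrite Rintegral_mkcond.
rewrite (_ : _ \_ _ = (fun t => F (t + - z))); last first.
  apply/funext => t; rewrite patchE mem_setE in_itv/= andbT /F subrK /heaviside.
  have [tz|tz] := ltP (t - z) 0; first by rewrite m0// !mulr0; case: ifP.
  by rewrite mul1r ifT//; lra.
rewrite Rint_shift; last by rewrite /F; mfun.
rewrite [RHS]Rint_oc_cc; last by mfun.
rewrite [RHS]Rintegral_mkcond; apply: leb_eq_Rint => s _.
rewrite patchE mem_setE in_itv/= andbT /F /heaviside.
case: (0 <= s); last by rewrite mul0r.
by rewrite mul1r mulrA -expRD; congr (expR _ * _); ring.
Qed.

Lemma leb_subset_Rint_le (A B : set R) (f : R -> R) : measurable A -> measurable B ->
  A `<=` B -> mu.-integrable B (EFin \o f) -> (forall x, B x -> 0 <= f x) ->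
  \int[mu]_(x in A) f x <= \int[mu]_(x in B) f x.
Proof.
move=> mA mB AB fi f0.
rewrite (_ : A = B `&` A); last by rewrite setIidr.
rewrite Rintegral_mkcondr; apply: leb_le_Rint => //.
  apply: (leb_integrable_le mB _ fi).
    have mBA : measurable_fun (B `&` A) f.
      by apply: (measurable_funS mB); [exact: subIsetl|exact: leb_measurable fi].
    exact: (measurable_restrict f mA mB).1 mBA.
  by move=> x Bx; rewrite /patch; case: ifP => _; rewrite ?normr0 ?f0// ger0_norm ?f0.
by move=> x Bx; rewrite /patch; case: ifP => // _; exact: f0.
Qed.

End translation.

(** * Finite speed of propagation *)

Section wave_equation.
Context {R : realType}.
Local Notation mu := (@lebesgue_measure R).
Let mh := @measurable_heaviside R.
Let mP : measurable (`]0, +oo[ : set R) := measurable_itv _.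
Let mD (l : R) : measurable (`]0, l[ : set R) := measurable_itv _.
Context (l c : R) (l0 : 0 < l) (c0 : 0 < c).

Lemma ball_le_add (y z t : R) : `|y - z| <= t -> z <= y + t.
Proof. by have := ler_norm (z - y); rewrite distrC => h h'; lra. Qed.

Lemma fine_lebesgue_itvoo : fine (mu `]0, l[) = l.
Proof. by rewrite lebesgue_measure_itv/= lte_fin l0 -EFinB subr0. Qed.

Lemma leb_Rint_cst (r : R) : \int[mu]_(_ in `]0, l[) r = r * l.
Proof. by rewrite (@Rintegral_cst _ _ _ mu)// fine_lebesgue_itvoo. Qed.

Lemma normrM_wave_kernel (x y z t : R) :
  `|x * wave_kernel y z t| = `|x| * wave_kernel y z t.
Proof. by rewrite normrM [X in _ * X]ger0_norm// wave_kernel_ge0. Qed.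

(** The smallness of l M / c makes the wave operator a contraction for the
    weight, as the Picard iteration requires. *)
Lemma wave_solve (E p : R -> R) (M K : R) (phi : R -> R -> R) :
  (forall r, 0 <= E r) -> (forall r s, r <= s -> E r <= E s) ->
  measurable_fun setT p -> (forall z, `|p z| <= M) -> l * M / c <= 2^-1 ->
  0 <= K -> measurable_fun setT (fun z : R * R => phi z.1 z.2) ->
  (forall y t, `|phi y t| <= K * cone_weight E c y t) ->
  exists m : R -> R -> R, [/\ measurable_fun setT (fun z : R * R => m z.1 z.2),
    forall y t, `|m y t| <= 2 * K * cone_weight E c y t &
    forall y t, m y t = phi y t - wave_op l p m y t].
Proof.
move=> E0 Em mp pM lMc K0 mphi phiK.
have w0 y t : 0 <= cone_weight E c y t by exact: cone_weight_ge0.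
apply: (@volterra_fixpoint R (cone_weight E c) (wave_op l p) w0 _ _ _ phi K) => //.
- by move=> m mm; exact: measurable_wave_op.
- move=> K' m K'0 mm mK' y t.
  apply: (le_trans (wave_op_bound E0 Em c0 K'0 mm mK' l0 mp pM y t)).
  by rewrite ler_wpM2r// mulrC ler_wpM2l.
- move=> K1 K2 m m' K10 K20 mm mm' mK1 mK2 y t.
  exact: (@wave_opB R E c m m' K1 K2 l M p).
Qed.

Lemma le_cone_weight (E : R -> R) x K y t : (0 <= y -> 0 <= t ->
    `|x| <= K * (E (y + t) * expR (c * t))) ->
  `|heaviside y * heaviside t * x| <= K * cone_weight E c y t.
Proof.
rewrite /cone_weight /heaviside.
case: (leP 0 y) => y0; last by rewrite !mul0r normr0 mulr0.
case: (leP 0 t) => t0; last by rewrite mulr0 !mul0r normr0 mulr0.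
by rewrite !mul1r; exact.
Qed.

Lemma wave_source_bound (g : R -> R) (M y t : R) :
  measurable_fun setT g -> (forall z, `|g z| <= M) ->
  `|wave_source l g y t| <= M * l * cone_weight (fun=> 1) c y t.
Proof.
move=> mg gM; have M0 : 0 <= M by exact: le_trans (gM 0).
apply: le_cone_weight => y0 t0; rewrite mul1r.
apply: (@le_trans _ _ (M * l)); last first.
  rewrite ler_peMr ?mulr_ge0 ?(ltW l0)//.
  by rewrite -expR0 ler_expR mulr_ge0// ltW.
apply: (@le_trans _ _ (M * fine (mu `]0, l[))); last by rewrite fine_lebesgue_itvoo.
apply: leb_normr_bnd; [exact: mD|exact: leb_itv_lty| |].
  by apply: measurable_fun_onT; apply: measurable_funM => //; apply: measurable_wave_kernel; mfun.
move=> z /=; rewrite in_itv/= => /andP[/ltW z0 _].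
rewrite normrM_wave_kernel.
rewrite -[M]mulr1 ler_pM// ?wave_kernel_ge0//.
exact: (le_trans (wave_kernel_le_heaviside _ y0 z0) (heaviside_le1 _)).
Qed.

Section density.
Context (f : R -> R) (Mf : R).
Context (mf : measurable_fun setT f) (fM : forall z, `|f z| <= Mf).

(** The Heaviside factor, instead of a bound of integration, makes this
    nondecreasing in r on the whole line. *)
Definition cumulative (r : R) : R :=
  \int[mu]_(z in `]0, l[) (`|f z| * heaviside (r - z)).

Lemma cumulative_integrable r :
  mu.-integrable `]0, l[ (EFin \o (fun z => `|f z| * heaviside (r - z))).
Proof.
apply: (@leb_integrable_bnd _ _ _ Mf); [exact: mD|exact: leb_itv_lty| |].
  by apply: measurable_fun_onT; mfun.
move=> z _; rewrite normrM normr_id -[Mf]mulr1 ler_pM//.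
by rewrite ger0_norm ?heaviside_ge0// heaviside_le1.
Qed.

Lemma cumulative_ge0 r : 0 <= cumulative r.
Proof. by apply: Rintegral_ge0 => z _; rewrite mulr_ge0// heaviside_ge0. Qed.

Lemma cumulative_le r s : r <= s -> cumulative r <= cumulative s.
Proof.
move=> rs; apply: leb_le_Rint; [exact: mD|exact: cumulative_integrable|exact: cumulative_integrable|].
move=> z _; rewrite ler_wpM2l// /heaviside !subr_ge0.
by have [zr|_] := boolP (z <= r); rewrite ?(le_trans zr rs)//; case: ifP.
Qed.

Lemma cumulative_bound r : cumulative r <= Mf * l.
Proof.
rewrite -[X in X <= _]ger0_norm ?cumulative_ge0//.
apply: (@le_trans _ _ (Mf * fine (mu `]0, l[))); last by rewrite fine_lebesgue_itvoo.
apply: leb_normr_bnd; [exact: mD|exact: leb_itv_lty| |].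
  by apply: measurable_fun_onT; mfun.
move=> z _; rewrite normrM normr_id -[Mf]mulr1 ler_pM//.
by rewrite ger0_norm ?heaviside_ge0// heaviside_le1.
Qed.

(** Finite speed of propagation again: at (y, t) only the values of f on ]0, y +
    t] are seen. *)
Lemma wave_source_density (a : R -> R) (A y t : R) :
  measurable_fun setT a -> (forall z, `|a z| <= A) ->
  `|wave_source l (fun z => f z * a z) y t| <= A * cone_weight cumulative c y t.
Proof.
move=> ma aA; have A0 : 0 <= A by exact: le_trans (aA 0).
apply: le_cone_weight => y0 t0.
have ect : 1 <= expR (c * t) by rewrite -expR0 ler_expR mulr_ge0// ltW.
apply: (@le_trans _ _ (A * cumulative (y + t))); last first.
  by rewrite ler_wpM2l// ler_peMr// cumulative_ge0.
rewrite /cumulative -leb_RintZl//; last exact: cumulative_integrable.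
apply: leb_normr_le => //.
- apply: measurable_fun_onT; apply: measurable_funM; first by mfun.
  by apply: measurable_wave_kernel; mfun.
- by apply: leb_integrableZl => //; exact: cumulative_integrable.
- move=> z /=; rewrite in_itv/= => /andP[/ltW z0 _].
  rewrite normrM_wave_kernel normrM [`|f z| * `|a z|]mulrC -mulrA.
  apply: ler_pM => //; first by apply: mulr_ge0 => //; exact: wave_kernel_ge0.
  rewrite ler_wpM2l// (le_trans (wave_kernel_le _ y0 z0))// /heaviside !subr_ge0.
  have [h|_] := boolP (`|y - z| <= t); last by case: (z <= y + t).
  have -> // : z <= y + t.
  exact: ball_le_add h.
Qed.

(** Where the kernel does not vanish, z <= y + t. The operator multiplies by
    f(z) before integrating in z, so a bound on m yields the mass of f. *)
Lemma wave_op_density (m : R -> R -> R) (K y t : R) : 0 <= K ->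
  measurable_fun setT (fun z : R * R => m z.1 z.2) ->
  (forall y t, `|m y t| <= K * cone_weight (fun=> 1) c y t) ->
  `|wave_op l f m y t| <= K / c * cone_weight cumulative c y t.
Proof.
move=> K0 mm mK.
have E0 : forall r : R, 0 <= (fun=> 1 : R) r by [].
have Em : forall r s : R, r <= s -> (fun=> 1 : R) r <= (fun=> 1 : R) s by [].
apply: le_cone_weight => y0 t0.
rewrite (_ : K / c * _ = K / c * expR (c * t) * cumulative (y + t)); last by ring.
rewrite /cumulative -leb_RintZl//; last exact: cumulative_integrable.
have mw : measurable_fun setT (fun z => wave_conv m y z t).
  by apply: measurable_wave_conv => //; mfun.
apply: leb_normr_le => //.
- by apply: measurable_fun_onT; mfun.
- by apply: leb_integrableZl => //; exact: cumulative_integrable.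
- move=> z /=; rewrite in_itv/= => /andP[/ltW z0 _].
  have [h|h] := leP `|y - z| t; last first.
    rewrite (_ : wave_conv m y z t = 0) ?mulr0 ?normr0.
      by rewrite !mulr_ge0 ?expR_ge0 ?heaviside_ge0 ?invr_ge0 ?(ltW c0).
    rewrite /wave_conv (@leb_eq_Rint _ _ _ (fun=> 0)) ?Rintegral_cst ?mul0r// => s /=.
    rewrite in_itv/= andbT => s0.
    have /le_anti -> : wave_kernel y z (t - s) <= 0 <= wave_kernel y z (t - s).
      rewrite wave_kernel_ge0 andbT (le_trans (wave_kernel_le _ y0 z0))//.
      rewrite /heaviside subr_ge0.
      have /negbTE -> // : ~~ (`|y - z| <= t - s).
      by rewrite -ltNge (le_lt_trans _ h)// gerBl ltW.
    by rewrite mulr0.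
  have zyt : z <= y + t.
    exact: ball_le_add h.
  rewrite {1}/heaviside subr_ge0 zyt mulr1 normrM mulrC ler_wpM2r//.
  have := @wave_conv_bound R _ c E0 Em c0 m K K0 mm mK y z t y0 z0 t0.
  by rewrite mul1r.
Qed.

End density.
End wave_equation.

(** * Two potentials seen by the wave equation *)

Section boundary_transform.
Context {R : realType}.
Local Notation mu := (@lebesgue_measure R).
Let mh := @measurable_heaviside R.
Let mP : measurable (`]0, +oo[ : set R) := measurable_itv _.
Let mD (l : R) : measurable (`]0, l[ : set R) := measurable_itv _.
Context (l c M : R) (l0 : 0 < l) (c0 : 0 < c) (M0 : 0 <= M) (lMc : l * M / c <= 2^-1).
Context (p q a b : R -> R) (a1 : R).
Context (mp : measurable_fun setT p) (mq : measurable_fun setT q)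
  (ma : measurable_fun setT a) (mb : measurable_fun setT b).
Context (pM : forall z, `|p z| <= M) (qM : forall z, `|q z| <= M)
  (aM : forall z, `|a z| <= M) (bM : forall z, `|b z| <= M).
Let f z := p z - q z.
Let mf : measurable_fun setT f. Proof. exact: measurable_funB. Qed.
Let fM z : `|f z| <= 2 * M.
Proof. by rewrite (le_trans (ler_normB _ _))// mulr_natl mulr2n lerD. Qed.
Let E := cumulative l f.
Let E0 := @cumulative_ge0 R l f.
Let Em := @cumulative_le R l f (2 * M) mf fM.
Let E1 : forall r : R, 0 <= (fun=> 1 : R) r. Proof. by []. Qed.
Let E1m : forall r s : R, r <= s -> (fun=> 1 : R) r <= (fun=> 1 : R) s.
Proof. by []. Qed.

(** Its transform is N(b - q a) + a1 N(., 0): the term in a1 is a source at the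
    boundary, which accounts for an inhomogeneous Neumann condition. *)
Definition boundary_source (y t : R) : R :=
  wave_source l (fun z => b z - q z * a z) y t +
  heaviside y * heaviside t * (a1 * wave_kernel y 0 t).

Lemma le_cone_weight1 K (x y t : R) : 0 <= K -> `|x| <= K * cone_weight E c y t ->
  `|x| <= K * (2 * M * l) * cone_weight (fun=> 1) c y t.
Proof.
move=> K0 xK; apply: (le_trans xK); rewrite -mulrA ler_wpM2l//.
rewrite /cone_weight mul1r [X in _ <= X]mulrCA; apply: ler_wpM2l.
  by rewrite mulr_ge0// heaviside_ge0.
by rewrite ler_wpM2r ?expR_ge0//; exact: (@cumulative_bound R l l0 f (2 * M) mf fM).
Qed.

Lemma cone_weight1_le (K x y t : R) : 0 <= K -> 0 < t ->
  `|x| <= K * cone_weight (fun=> 1) c y t -> `|x| <= K * expR (c * t).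
Proof.
move=> K0 t0 xK; apply: (le_trans xK); rewrite ler_wpM2l// /cone_weight mul1r.
by rewrite ler_piMl ?expR_ge0// /heaviside; case: (0 <= y); case: (0 <= t); rewrite ?mulr0 ?mulr1 ?mul0r.
Qed.

(** m belongs to the potential q, and m + d to p. Since the source of d is
    proportional to f = p - q, the weight for d can be taken to be the
    cumulative mass of f; this is what makes the final estimate local. *)
Lemma wave_families : exists (K : R) (m d : R -> R -> R),
  [/\ 0 <= K,
      measurable_fun setT (fun z : R * R => m z.1 z.2) /\
      measurable_fun setT (fun z : R * R => d z.1 z.2),
      (forall y t, `|m y t| <= K * cone_weight (fun=> 1) c y t) /\
      (forall y t, `|d y t| <= K * cone_weight E c y t),
      forall y t, m y t = boundary_source y t - wave_op l q m y t &
      forall y t, d y t = - (wave_source l (fun z => f z * a z) y t +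
         wave_op l f m y t) - wave_op l p d y t].
Proof.
have mg : measurable_fun setT (fun z => b z - q z * a z) by mfun.
have gM z : `|b z - q z * a z| <= M + M * M.
  by rewrite (le_trans (ler_normB _ _))// lerD// normrM ler_pM.
pose K1 := (M + M * M) * l + `|a1|.
have K10 : 0 <= K1 by rewrite addr_ge0// mulr_ge0 ?addr_ge0 ?mulr_ge0// ltW.
have mphi : measurable_fun setT (fun z : R * R => boundary_source z.1 z.2).
  apply: measurable_funD; first exact: measurable_wave_source.
  apply: measurable_funM; first by mfun.
  by apply: measurable_funM; first mfun; apply: measurable_wave_kernel; mfun.
have phiK y t : `|boundary_source y t| <= K1 * cone_weight (fun=> 1) c y t.
  rewrite (le_trans (ler_normD _ _))// mulrDl lerD//.
    exact: wave_source_bound.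
  apply: le_cone_weight => y0 t0; rewrite mul1r normrM_wave_kernel ler_wpM2l//.
  apply: (@le_trans _ _ 1).
    exact: (le_trans (wave_kernel_le_heaviside _ y0 (lexx 0)) (heaviside_le1 _)).
  by rewrite -expR0 ler_expR mulr_ge0// ltW.
have [m [mm mK mE]] := wave_solve l0 c0 E1 E1m mq qM lMc K10 mphi phiK.
have K20 : 0 <= 2 * K1 by rewrite mulr_ge0.
pose K3 := M + 2 * K1 / c.
have K30 : 0 <= K3 by rewrite addr_ge0// divr_ge0// ltW.
pose psi y t := - (wave_source l (fun z => f z * a z) y t + wave_op l f m y t).
have mpsi : measurable_fun setT (fun z : R * R => psi z.1 z.2).
  apply: measurable_funN; apply: measurable_funD.
    by apply: measurable_wave_source; mfun.
  exact: measurable_wave_op.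
have psiK y t : `|psi y t| <= K3 * cone_weight E c y t.
  rewrite normrN (le_trans (ler_normD _ _))// mulrDl lerD//.
    exact: (@wave_source_density R l c c0 f (2 * M) mf fM).
  exact: (@wave_op_density R l c c0 f (2 * M) mf fM).
have [d [md dK dE]] := wave_solve l0 c0 E0 Em mp pM lMc K30 mpsi psiK.
exists (2 * K1 + 2 * K3), m, d; split => //.
- by rewrite addr_ge0// mulr_ge0.
- split=> y t.
    apply: (le_trans (mK y t)); apply: ler_wpM2r; first exact: cone_weight_ge0.
    by rewrite lerDl mulr_ge0.
  apply: (le_trans (dK y t)); apply: ler_wpM2r; first exact: cone_weight_ge0.
  by rewrite lerDr mulr_ge0.
Qed.

Context (K : R) (m d : R -> R -> R) (K0 : 0 <= K).
Context (mm : measurable_fun setT (fun z : R * R => m z.1 z.2)).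
Context (md : measurable_fun setT (fun z : R * R => d z.1 z.2)).
Context (mK : forall y t, `|m y t| <= K * cone_weight (fun=> 1) c y t).
Context (dK : forall y t, `|d y t| <= K * cone_weight E c y t).
Context (mE : forall y t, m y t = boundary_source y t - wave_op l q m y t).
Context (dE : forall y t, d y t = - (wave_source l (fun z => f z * a z) y t +
         wave_op l f m y t) - wave_op l p d y t).

Let K' := K * (2 * M * l).
Let K'0 : 0 <= K'. Proof. by rewrite !mulr_ge0// ltW. Qed.
Let dK' y t : `|d y t| <= K' * cone_weight (fun=> 1) c y t.
Proof. exact: le_cone_weight1. Qed.

Let lap_int (k B : R) (u : R -> R -> R) y : c < k -> 0 <= B ->
  measurable_fun setT (fun z : R * R => u z.1 z.2) ->
  (forall y t, `|u y t| <= B * cone_weight (fun=> 1) c y t) ->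
  mu.-integrable `]0, +oo[ (EFin \o (fun t => expR (- k * t) * u y t)).
Proof.
move=> ck B0 mu' uB; apply: (@laplace_integrable R k c B) => //.
  exact: measurable_section1.
by move=> t t0; exact: cone_weight1_le (uB y t).
Qed.

Lemma measurable_laplace (k : R) (u : R -> R -> R) :
  measurable_fun setT (fun z : R * R => u z.1 z.2) ->
  measurable_fun setT (fun y => laplace k (u y)).
Proof.
move=> mu'; apply: (@leb_measurable_Rint R _ _ _ (fun y t => expR (- k * t) * u y t)) => //.
by mfun.
Qed.

(** The transform of the equation for m: it is the integral equation of the
    resolvent with potential q. *)
Lemma laplace_profile (k y : R) : c < k -> 0 <= y ->
  laplace k (m y) =
  \int[mu]_(z in `]0, l[) (neumann k y z * (b z - q z * a z)) +
  a1 * neumann k y 0 -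
  \int[mu]_(z in `]0, l[) (neumann k y z * (q z * laplace k (m z))).
Proof.
move=> ck y0; have k0 : 0 < k by exact: lt_trans ck.
have mg : measurable_fun setT (fun z => b z - q z * a z) by mfun.
have gM z : `|b z - q z * a z| <= M + M * M.
  by rewrite (le_trans (ler_normB _ _))// lerD// normrM ler_pM.
have mwk : measurable_fun setT (wave_kernel y 0).
  by apply: (@measurable_wave_kernel R _ R (fun=> y) (fun=> 0) id); mfun.
have i1 : mu.-integrable `]0, +oo[ (EFin \o (fun t => expR (- k * t) *
   wave_source l (fun z => b z - q z * a z) y t)).
  apply: (@lap_int k ((M + M * M) * l)) => //.
  - by rewrite mulr_ge0 ?addr_ge0 ?mulr_ge0// ltW.
  - exact: measurable_wave_source.
  - by move=> y' t; exact: wave_source_bound.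
have i2 : mu.-integrable `]0, +oo[ (EFin \o (fun t => expR (- k * t) *
    wave_kernel y 0 t)).
  apply: (@laplace_integrable R k 0 1) => // t _.
  rewrite mul0r expR0 mulr1 ger0_norm ?wave_kernel_ge0//.
  exact: (le_trans (wave_kernel_le_heaviside _ y0 (lexx _)) (heaviside_le1 _)).
have i3 : mu.-integrable `]0, +oo[ (EFin \o (fun t => expR (- k * t) *
    wave_op l q m y t)).
  apply: (@lap_int k (l * M / c * K)) => //.
  - by rewrite !mulr_ge0 ?invr_ge0// ltW.
  - exact: measurable_wave_op.
  - by move=> y' t; exact: (wave_op_bound E1 E1m c0 K0 mm mK l0 mq qM).
rewrite -(laplace_wave_op c0 ck y0 K0 l0 mm mK mq qM).
rewrite -(laplace_wave_source l k0 y0 mg gM).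
rewrite (_ : neumann k y 0 = laplace k (wave_kernel y 0)); last first.
  have := laplace_wave_kernel k0 y0 (lexx 0) (lexx 0).
  by rewrite mulr0 expR0 mul1r => <-; apply: leb_eq_Rint => t _; rewrite subr0.
rewrite /laplace -leb_RintZl// -leb_RintD//; last exact: leb_integrableZl.
rewrite -leb_RintB//; last by apply: leb_integrableD => //; exact: leb_integrableZl.
apply: leb_eq_Rint => t /=; rewrite in_itv/= andbT => t0.
rewrite mE /boundary_source {1 2}/heaviside y0 (ltW t0) !mul1r; ring.
Qed.

Lemma laplace_difference (k y : R) : c < k -> 0 <= y ->
  laplace k (d y) =
  - \int[mu]_(z in `]0, l[) (neumann k y z *
      (f z * (a z + laplace k (m z)) + p z * laplace k (d z))).
Proof.
move=> ck y0; have k0 : 0 < k by exact: lt_trans ck.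
have mfa : measurable_fun setT (fun z => f z * a z) by mfun.
have faM z : `|f z * a z| <= 2 * M * M by rewrite normrM ler_pM.
have i1 : mu.-integrable `]0, +oo[ (EFin \o (fun t => expR (- k * t) *
   wave_source l (fun z => f z * a z) y t)).
  apply: (@lap_int k (2 * M * M * l)) => //.
  - by rewrite !mulr_ge0// ltW.
  - exact: measurable_wave_source.
  - by move=> y' t; exact: wave_source_bound.
have i2 : mu.-integrable `]0, +oo[ (EFin \o (fun t => expR (- k * t) *
    wave_op l f m y t)).
  apply: (@lap_int k (l * (2 * M) / c * K)) => //.
  - by rewrite !mulr_ge0 ?invr_ge0// ltW.
  - exact: measurable_wave_op.
  - by move=> y' t; exact: (wave_op_bound E1 E1m c0 K0 mm mK l0 mf fM).
have i3 : mu.-integrable `]0, +oo[ (EFin \o (fun t => expR (- k * t) *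
    wave_op l p d y t)).
  apply: (@lap_int k (l * M / c * K')) => //.
  - by rewrite !mulr_ge0 ?invr_ge0// ltW.
  - exact: measurable_wave_op.
  - by move=> y' t; exact: (wave_op_bound E1 E1m c0 K'0 md dK' l0 mp pM).
have lb (u : R -> R -> R) (B : R) : 0 <= B -> measurable_fun setT (fun z : R * R => u z.1 z.2) ->
    (forall y t, `|u y t| <= B * cone_weight (fun=> 1) c y t) ->
    forall z, `|laplace k (u z)| <= B / (k - c).
  move=> B0 mu' uB z; apply: laplace_bound => //; first exact: measurable_section1.
  by move=> t t0; exact: cone_weight1_le (uB z t).
have bint (g : R -> R) (B : R) : measurable_fun setT g -> (forall z, `|g z| <= B) ->
    mu.-integrable `]0, l[ (EFin \o (fun z => neumann k y z * g z)).
  move=> mg gB; apply: (@leb_integrable_bnd _ _ _ (k^-1 * B)) => //; first exact: leb_itv_lty.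
    by apply: measurable_fun_onT; apply: measurable_funM => //; apply: measurable_neumann; mfun.
  move=> z /=; rewrite in_itv/= => /andP[/ltW z0 _]; rewrite normrM ler_pM//.
  by rewrite ger0_norm ?neumann_ge0// neumann_le_inv.
have ml : measurable_fun setT (fun z => laplace k (m z)) by exact: measurable_laplace.
have dl : measurable_fun setT (fun z => laplace k (d z)) by exact: measurable_laplace.
rewrite (@leb_eq_Rint _ _ _ (fun z => (neumann k y z * (f z * a z) +
   neumann k y z * (f z * laplace k (m z))) + neumann k y z * (p z * laplace k (d z)))); last first.
  by move=> z _; ring.
have j1 := bint _ _ mfa faM.
have j2 : mu.-integrable `]0, l[ (EFin \o (fun z => neumann k y z * (f z * laplace k (m z)))).
  apply: (@bint _ (2 * M * (K / (k - c)))); first by mfun.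
  by move=> z; rewrite normrM ler_pM// lb.
have j3 : mu.-integrable `]0, l[ (EFin \o (fun z => neumann k y z * (p z * laplace k (d z)))).
  apply: (@bint _ (M * (K' / (k - c)))); first by mfun.
  by move=> z; rewrite normrM ler_pM// lb.
rewrite leb_RintD//; last exact: leb_integrableD.
rewrite leb_RintD//.
rewrite -(laplace_wave_op c0 ck y0 K0 l0 mm mK mf fM).
rewrite -(laplace_wave_op c0 ck y0 K'0 l0 md dK' mp pM).
rewrite -(laplace_wave_source l k0 y0 mfa faM).
rewrite /laplace -(leb_RintD mP i1 i2) -(leb_RintD mP (leb_integrableD mP i1 i2) i3).
rewrite -(leb_RintN mP (leb_integrableD mP (leb_integrableD mP i1 i2) i3)).
apply: leb_eq_Rint => t _; rewrite dE.
move: (wave_source _ _ _ _) (wave_op _ f _ _ _) (wave_op _ p _ _ _) => S O1 O2.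
by ring.
Qed.

Lemma laplace_profile_bound (k y : R) : c + 1 <= k ->
  `|laplace k (m y)| <= K /\ `|laplace k (d y)| <= K'.
Proof.
move=> ck; have ck' : c < k by rewrite (lt_le_trans _ ck)// ltrDl.
have h B : 0 <= B -> B / (k - c) <= B.
  move=> B0; rewrite ler_piMr// invf_le1 ?subr_gt0//.
  by rewrite lerBrDl addrC addrC.
split.
- apply: (le_trans (@laplace_bound R k c K _ ck' _ _)) (h _ K0).
    exact: measurable_section1.
  by move=> t t0; exact: cone_weight1_le (mK y t).
- apply: (le_trans (@laplace_bound R k c K' _ ck' _ _)) (h _ K'0).
    exact: measurable_section1.
  by move=> t t0; exact: cone_weight1_le (dK' y t).
Qed.

(** Minus the time derivative of the trace of d at y = 0, without the part
    produced directly by the initial data: a wave from z reaches 0 after the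
    time z. *)
Definition trace_rate (t : R) : R :=
  \int[mu]_(z in `]0, l[) (p z * d z (t - z) + f z * m z (t - z)).

Lemma measurable_trace_rate : measurable_fun setT trace_rate.
Proof.
rewrite /trace_rate.
apply: (@leb_measurable_Rint R _ _ _ (fun t z : R => p z * d z (t - z) + f z * m z (t - z))) => //.
by mfun.
Qed.

Lemma trace_rate_integrand (z t : R) : 0 <= z ->
  `|p z * d z (t - z) + f z * m z (t - z)| <=
  heaviside t * expR (c * t) * (M * K * E t + K * (`|f z| * heaviside (t - z))).
Proof.
move=> z0.
have [tz|tz] := ltP t z.
  have v0 (e : R -> R) (u : R -> R -> R) : `|u z (t - z)| <= K * cone_weight e c z (t - z) -> u z (t - z) = 0.
    rewrite {1}/cone_weight /heaviside subr_ge0 [z <= t]leNgt tz !(mulr0, mul0r) => h.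
    by apply/eqP; rewrite -normr_le0.
  rewrite (v0 _ d (dK _ _)) (v0 _ m (mK _ _)) !mulr0 addr0 normr0.
  by rewrite mulr_ge0 ?addr_ge0 ?mulr_ge0 ?heaviside_ge0 ?expR_ge0 ?E0.
have t0 : 0 <= t by exact: le_trans tz.
rewrite {1}/heaviside t0 {1}/heaviside subr_ge0 tz mul1r mulr1.
have ez : expR (c * (t - z)) <= expR (c * t).
  by rewrite ler_expR ler_wpM2l ?(ltW c0)// gerBl.
have hd : `|d z (t - z)| <= K * (E t * expR (c * t)).
  apply: (le_trans (dK z (t - z))); rewrite /cone_weight /heaviside z0 subr_ge0 tz !mul1r.
  by rewrite addrC subrK !ler_wpM2l ?E0.
have hm : `|m z (t - z)| <= K * expR (c * t).
  apply: (le_trans (mK z (t - z))); rewrite /cone_weight /heaviside z0 subr_ge0 tz !mul1r.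
  by rewrite ler_wpM2l.
rewrite (le_trans (ler_normD _ _))// !normrM mulrDr lerD//.
  rewrite (_ : _ * (M * K * _) = M * (K * (E t * expR (c * t)))); last by ring.
  by rewrite ler_pM.
rewrite (_ : expR (c * t) * _ = `|f z| * (K * expR (c * t))); last by ring.
by rewrite ler_pM.
Qed.

(** At distance z the cone of d ends at z + (t - z) = t, so only the mass of f
    up to t enters. *)
Lemma trace_rate_bound (t : R) :
  `|trace_rate t| <= (M * K * l + K) * (heaviside t * expR (c * t) * E t).
Proof.
have ci := @cumulative_integrable R l f (2 * M) mf fM t.
have cst_i : mu.-integrable `]0, l[ (EFin \o (fun _ : R => M * K * E t)).
  by apply: leb_integrable_cst => //; exact: leb_itv_lty.
apply: (@le_trans _ _ (\int[mu]_(z in `]0, l[) (heaviside t * expR (c * t) *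
   (M * K * E t + K * (`|f z| * heaviside (t - z)))))).
  apply: leb_normr_le => //.
  - by apply: measurable_fun_onT; mfun.
  - by apply: leb_integrableZl => //; apply: leb_integrableD => //; exact: leb_integrableZl.
  - by move=> z /=; rewrite in_itv/= => /andP[/ltW z0 _]; exact: trace_rate_integrand.
rewrite leb_RintZl//; last by apply: leb_integrableD => //; exact: leb_integrableZl.
rewrite leb_RintD//; last exact: leb_integrableZl.
rewrite (leb_Rint_cst l0) leb_RintZl// -/(cumulative l f t) -/E.
by rewrite le_eqVlt; apply/orP; left; apply/eqP; ring.
Qed.

Lemma trace_rate_bound1 (t : R) : 0 <= t ->
  `|trace_rate t| <= (M * K * l + K) * (2 * M * l) * expR (c * t).
Proof.
move=> t0; apply: (le_trans (trace_rate_bound t)).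
rewrite -[X in _ <= X]mulrA; apply: ler_wpM2l.
  by rewrite addr_ge0 ?mulr_ge0// ltW.
rewrite /heaviside t0 mul1r mulrC ler_wpM2r ?expR_ge0//.
exact: (@cumulative_bound R l l0 f (2 * M) mf fM).
Qed.

(** At y = 0 the kernel N is e^(-kz) / k, so that the factor k turns the
    integral over z into a Laplace transform in the travel time z; a delay by z
    is a factor e^(-kz). *)
Lemma laplace_trace (k : R) : c < k ->
  - k * laplace k (d 0) =
  \int[mu]_(z in `]0, l[) (expR (- k * z) * (f z * a z)) + laplace k trace_rate.
Proof.
move=> ck; have k0 : 0 < k by exact: lt_trans ck.
have kc : 0 < k - c by rewrite subr_gt0.
have mfa : measurable_fun setT (fun z => f z * a z) by mfun.
have lb (u : R -> R -> R) (B : R) : 0 <= B -> measurable_fun setT (fun z : R * R => u z.1 z.2) ->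
    (forall y t, `|u y t| <= B * cone_weight (fun=> 1) c y t) ->
    forall z, `|laplace k (u z)| <= B / (k - c).
  move=> B0 mu' uB z; apply: laplace_bound => //; first exact: measurable_section1.
  by move=> t t0; exact: cone_weight1_le (uB z t).
have bint (g : R -> R) (B : R) : measurable_fun setT g -> (forall z, `|g z| <= B) ->
    mu.-integrable `]0, l[ (EFin \o (fun z => expR (- k * z) * g z)).
  move=> mg gB; apply: (@leb_integrable_bnd _ _ _ (1 * B)) => //; first exact: leb_itv_lty.
    by apply: measurable_fun_onT; mfun.
  move=> z /=; rewrite in_itv/= => /andP[/ltW z0 _]; rewrite normrM ler_pM//.
  by rewrite ger0_norm ?expR_ge0// -expR0 ler_expR mulNr oppr_le0 mulr_ge0// ltW.
have ml : measurable_fun setT (fun z => laplace k (m z)) by exact: measurable_laplace.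
have dl : measurable_fun setT (fun z => laplace k (d z)) by exact: measurable_laplace.
have j1 : mu.-integrable `]0, l[ (EFin \o (fun z => expR (- k * z) * (f z * a z))).
  by apply: (@bint _ (2 * M * M)) => // z; rewrite normrM ler_pM.
have j2 : mu.-integrable `]0, l[ (EFin \o (fun z => expR (- k * z) * (p z * laplace k (d z) + f z * laplace k (m z)))).
  apply: (@bint _ (M * (K' / (k - c)) + 2 * M * (K / (k - c)))); first by mfun.
  by move=> z; rewrite (le_trans (ler_normD _ _))// !normrM lerD// ler_pM// lb.
rewrite laplace_difference// mulrNN -leb_RintZl//; last first.
  apply: (leb_eq_integrable (mD l) (leb_integrableZl (k^-1) (mD l) (leb_integrableD (mD l) j1 j2))) => z /=.
  rewrite in_itv/= => /andP[/ltW z0 _].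
  by rewrite neumann0 ?gt_eqF//; field; rewrite gt_eqF.
rewrite (@leb_eq_Rint _ _ _ (fun z => expR (- k * z) * (f z * a z) +
   expR (- k * z) * (p z * laplace k (d z) + f z * laplace k (m z)))); last first.
  move=> z /=; rewrite in_itv/= => /andP[/ltW z0 _].
  by rewrite neumann0 ?gt_eqF//; field; rewrite gt_eqF.
rewrite leb_RintD//; congr (_ + _).
pose G z t := p z * d z t + f z * m z t.
have mG : measurable_fun setT (fun z : R * R => G z.1 z.2) by rewrite /G; mfun.
have Gz z : 0 <= z -> mu.-integrable `]0, +oo[ (EFin \o (fun t => expR (- k * t) * G z t)).
  move=> z0; apply: (@laplace_integrable R k c (M * K' + 2 * M * K)) => //.
    exact: measurable_section1.
  move=> t t0; rewrite (le_trans (ler_normD _ _))// !normrM mulrDl lerD// -mulrA ler_pM//.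
    exact: cone_weight1_le (dK' z t).
  exact: cone_weight1_le (mK z t).
transitivity (\int[mu]_(z in `]0, l[) \int[mu]_(t in `]0, +oo[) (expR (- k * t) * G z (t - z))).
  apply: leb_eq_Rint => z /=; rewrite in_itv/= => /andP[/ltW z0 _].
  rewrite -/(laplace k (fun t => G z (t - z))) laplace_shift//.
  - congr (_ * _); rewrite /laplace -!leb_RintZl//; last 2 first.
    + by apply: (@lap_int k K).
    + by apply: (@lap_int k K').
    rewrite -leb_RintD//; last 2 first.
    + by apply: leb_integrableZl => //; apply: (@lap_int k K').
    + by apply: leb_integrableZl => //; apply: (@lap_int k K).
    by apply: leb_eq_Rint => t _; rewrite /G; ring.
  - exact: measurable_section1.
  - move=> s s0; rewrite /G.
    have v0 (e : R -> R) (u : R -> R -> R) : `|u z s| <= K * cone_weight e c z s -> u z s = 0.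
      rewrite {1}/cone_weight /heaviside [0 <= s]leNgt s0 !(mulr0, mul0r) => h.
      by apply/eqP; rewrite -normr_le0.
    by rewrite (v0 _ d (dK _ _)) (v0 _ m (mK _ _)) !mulr0 addr0.
  - exact: Gz.
rewrite leb_fubini//.
  apply: leb_eq_Rint => t _; rewrite -leb_RintZl//.
  apply: (@leb_integrable_bnd _ _ _ (heaviside t * expR (c * t) * (M * K * E t + K * (2 * M)))) => //.
  - exact: leb_itv_lty.
  - by apply: measurable_fun_onT; mfun.
  - move=> z /=; rewrite in_itv/= => /andP[/ltW z0 _].
    apply: (le_trans (trace_rate_integrand t z0)).
    rewrite ler_wpM2l ?mulr_ge0 ?heaviside_ge0 ?expR_ge0// lerD2l ler_wpM2l//.
    by rewrite -[2 * M]mulr1 ler_pM// ?heaviside_ge0 ?heaviside_le1.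
apply: (@leb_integrable_prod R _ _ (fun=> 1) (fun t => (M * K * (2 * M * l) + K * (2 * M)) * expR (- (k - c) * t))
   (fun z t => expR (- k * t) * G z (t - z))) => //.
- by apply: measurable_fun_onT; mfun.
- by apply: leb_integrable_cst => //; exact: leb_itv_lty.
- by apply: leb_integrableZl => //; exact: integrable_expR.
- move=> z t /=; rewrite !in_itv/= andbT => /andP[/ltW z0 _] t0.
  rewrite mul1r normrM ger0_norm ?expR_ge0//.
  rewrite (_ : _ * expR (- (k - c) * t) = expR (- k * t) *
     (expR (c * t) * (M * K * (2 * M * l) + K * (2 * M)))); last first.
    by rewrite [in RHS]mulrA -expRD mulrC; congr (expR _ * _); ring.
  rewrite ler_wpM2l ?expR_ge0//; apply: (le_trans (trace_rate_integrand t z0)).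
  rewrite {1}/heaviside (ltW t0) mul1r ler_wpM2l ?expR_ge0// lerD//.
    by rewrite ler_wpM2l ?mulr_ge0//; exact: (@cumulative_bound R l l0 f (2 * M) mf fM).
  rewrite ler_wpM2l//.
  by rewrite -[2 * M]mulr1 ler_pM// ?heaviside_ge0 ?heaviside_le1.
Qed.

End boundary_transform.

(** * Pointwise bounds from primitives *)

Section density_estimates.
Context {R : realType}.
Local Notation mu := (@lebesgue_measure R).
Let mh := @measurable_heaviside R.
Let mD (l : R) : measurable (`]0, l[ : set R) := measurable_itv _.

Lemma continuous_measurable (h : R -> R) : continuous h -> measurable_fun setT h.
Proof. exact: continuous_measurable_fun. Qed.

(** If h(t) exceeded E(t), then by continuity it would keep its sign and exceed
    E(t) on a short interval to the left of t, where G is bounded by E(t) as E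
    is nondecreasing; h + G would then have a nonzero integral there. *)
Lemma le_of_zero_primitive (h G E : R -> R) (l : R) : continuous h ->
  mu.-integrable `]0, l[ (EFin \o (fun t => h t + G t)) ->
  (forall t, 0 < t -> t < l -> `|G t| <= E t) ->
  (forall s t, s <= t -> E s <= E t) ->
  (forall x, 0 < x -> x < l -> \int[mu]_(t in `]0, x[) (h t + G t) = 0) ->
  forall t, 0 < t -> t < l -> `|h t| <= E t.
Proof.
move=> ch hGi GE Em I0 t0 t00 t0l; rewrite leNgt; apply/negP => Eh.
pose sg : R := if 0 <= h t0 then 1 else -1.
have sgh : sg * h t0 = `|h t0|.
  rewrite /sg; have [h0|h0] := leP 0 (h t0); first by rewrite mul1r ger0_norm.
  by rewrite mulN1r ltr0_norm.
have sg1 : `|sg| = 1 by rewrite /sg; case: ifP; rewrite ?normrN normr1.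
pose e := (`|h t0| - E t0) / 2.
have e0 : 0 < e by rewrite divr_gt0// subr_gt0.
have ce : sg * h t @[t --> t0] --> `|h t0|.
  by rewrite -sgh; apply: cvgMr; exact: ch.
have [eta /= eta0 etaP] : \forall t \near t0, `|h t0| - e < sg * h t.
  by apply: (cvgr_gt _ ce); rewrite ltrBlDr ltrDl.
have [t1 [t10 t1t0 t1h]] : exists t1, [/\ 0 < t1, t1 < t0 &
    forall t, t1 < t -> t < t0 -> E t0 + e < sg * h t].
  exists (Num.max (t0 / 2) (t0 - eta / 2)); split.
  - by rewrite lt_max divr_gt0.
  - rewrite gt_max; apply/andP; split; lra.
  - move=> t; rewrite gt_max => /andP[_ ht] tt0.
    rewrite (_ : E t0 + e = `|h t0| - e); last by rewrite /e; field.
    by apply: etaP => /=; rewrite ltr_norml; apply/andP; split; lra.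
have mI (x y : R) : measurable (`[x, y[ : set R) by exact: measurable_itv.
have sub1 : `[t1, t0[%classic `<=` `]0, l[%classic.
  move=> t /=; rewrite !in_itv/= => /andP[h1 h2].
  by rewrite (lt_le_trans t10 h1) (lt_trans h2 t0l).
have i1 : mu.-integrable `[t1, t0[ (EFin \o (fun t => h t + G t)).
  exact: leb_integrableS (mD l) (mI _ _) sub1 hGi.
have Iz : \int[mu]_(t in `[t1, t0[) (h t + G t) = 0.
  have := I0 _ t00 t0l.
  rewrite (_ : `]0, t0[%classic = `]0, t1[ `|` `[t1, t0[); last first.
    by rewrite -itv_bndbnd_setU ?bnd_simp ?ltW.
  rewrite Rintegral_setU//=.
  - by rewrite I0 ?add0r// (lt_trans t1t0).
  - apply: (leb_integrableS (mD l) _ _ hGi); first by apply: measurableU => //; exact: mD.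
    move=> t [|]; last exact: sub1.
    move=> /=; rewrite !in_itv/= => /andP[-> tt1].
    by rewrite (lt_trans tt1)// (lt_trans t1t0).
  - apply/disj_setPS => t [] /=; rewrite !in_itv/= => /andP[_ h1] /andP[h2 _].
    by move: (lt_le_trans h1 h2); rewrite ltxx.
have : 0 < \int[mu]_(t in `[t1, t0[) (sg * (h t + G t)).
  apply: (@lt_le_trans _ _ (\int[mu]_(t in `[t1, t0[) e)).
    rewrite (@Rintegral_cst _ _ _ mu)//= lebesgue_measure_itv/= lte_fin t1t0 -EFinB/=.
    by rewrite mulr_gt0// subr_gt0.
  apply: leb_ae_le_Rint => //.
  - by apply: leb_integrable_cst => //; exact: leb_itv_lty.
  - exact: leb_integrableZl.
  - exists [set t1]; split => //; first exact: lebesgue_measure_set1.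
    move=> t; apply: contra_notP => /eqP tt1; rewrite /= in_itv/= => /andP[h1 h2].
    have t1t : t1 < t by rewrite lt_neqAle eq_sym tt1.
    have := t1h _ t1t h2; have := GE t (lt_trans t10 t1t) (lt_trans h2 t0l).
    have := Em _ _ (ltW h2).
    have : - `|G t| <= sg * G t.
      by rewrite lerNl (le_trans (ler_norm _))// normrN normrM sg1 mul1r.
    rewrite mulrDr => h3 h4 h5 h6.
    by apply/ltW; move: h3 h4 h5 h6; clear; lra.
by rewrite leb_RintZl// Iz mulr0 ltxx.
Qed.

(** By iteration |f(t)| <= B 2^(-n) e^(lam t): integrating the exponential
    brings the factor 1 / lam, and lam is chosen with C / lam <= 1 / 2. *)
Lemma gronwall_zero (f : R -> R) (l B C : R) : measurable_fun setT f ->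
  (forall z, `|f z| <= B) -> 0 <= C ->
  (forall t, 0 < t -> t < l -> `|f t| <= C * cumulative l f t) ->
  forall t, 0 < t -> t < l -> f t = 0.
Proof.
move=> mf fB C0 fC.
have B0 : 0 <= B by exact: le_trans (fB 0).
pose lam := 2 * C + 1.
have lam0 : 0 < lam by rewrite ltr_wpDl// mulr_ge0.
have mP : measurable (`]0, +oo[ : set R) by exact: measurable_itv.
have Clam : C / lam <= 2^-1.
  by rewrite ler_pdivrMr// /lam; clear -C0; lra.
have it n : forall t, 0 < t -> t < l -> `|f t| <= B * 2^-1 ^+ n * expR (lam * t).
  elim: n => [|n IH] t t0 tl.
    rewrite expr0 mulr1 (le_trans (fB t))// ler_peMr//.
    by rewrite -expR0 ler_expR mulr_ge0// ltW.
  apply: (le_trans (fC t t0 tl)).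
  have Bn : 0 <= B * 2^-1 ^+ n by rewrite mulr_ge0// exprn_ge0.
  have ie : mu.-integrable `]0, +oo[ (EFin \o (fun z => expR (lam * z) * heaviside (t - z))).
    apply: (@integrable_heaviside_le _ _ _ (expR (lam * t))); first by mfun.
    move=> s s0 st; rewrite ger0_norm ?expR_ge0// ler_expR ler_wpM2l//.
    exact: ltW.
  have sub : (`]0, l[%classic : set R) `<=` `]0, +oo[%classic.
    by move=> z /=; rewrite !in_itv/= => /andP[->].
  have : cumulative l f t <= B * 2^-1 ^+ n * (expR (lam * t) / lam).
    apply: (@le_trans _ _ (\int[mu]_(z in `]0, l[) (B * 2^-1 ^+ n * (expR (lam * z) * heaviside (t - z))))).
      apply: leb_le_Rint => //; first exact: (cumulative_integrable l mf fB).
        by apply: leb_integrableZl => //; exact: leb_integrableS mP (mD l) sub ie.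
      move=> z /=; rewrite in_itv/= => /andP[z0 zl].
      by rewrite mulrA ler_wpM2r ?heaviside_ge0// IH.
    rewrite leb_RintZl//; last exact: leb_integrableS mP (mD l) sub ie.
    rewrite ler_wpM2l//; apply: le_trans (Rint_expR_le lam0 (ltW t0)).
    apply: leb_subset_Rint_le => // z _.
    by rewrite mulr_ge0 ?expR_ge0 ?heaviside_ge0.
  move=> /(ler_wpM2l C0) h; apply: (le_trans h).
  rewrite (_ : C * _ = B * 2^-1 ^+ n * expR (lam * t) * (C / lam)); last by ring.
  rewrite [X in _ <= X](_ : _ = B * 2^-1 ^+ n * expR (lam * t) * 2^-1); last by rewrite exprSr; ring.
  by rewrite ler_wpM2l// mulr_ge0// expR_ge0.
move=> t t0 tl; apply/eqP; rewrite -normr_le0.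
have : B * 2^-1 ^+ n * expR (lam * t) @[n --> \oo] --> B * 0 * expR (lam * t).
  apply: cvgMl; apply: cvgMr; apply: cvg_expr.
  by rewrite ger0_norm// invf_lt1// ltr1n.
rewrite mulr0 mul0r => h0.
rewrite -(cvg_lim (@Rhausdorff R) h0); apply: limr_ge; first exact: cvgP h0.
by near=> n; exact: it.
Unshelve. all: by end_near. Qed.

Lemma continuous_eq_closed (p q : R -> R) (l : R) : 0 < l -> continuous p -> continuous q ->
  (forall t, 0 < t -> t < l -> p t = q t) -> forall t, t \in `[0, l] -> p t = q t.
Proof.
move=> l0 cp cq pq t; rewrite in_itv/= => /andP[t0 tl].
apply/eqP; rewrite -subr_eq0; apply/negPn/negP => n0.
have cpq : {for t, continuous (fun x => p x - q x)} by apply: cvgB; [exact: cp|exact: cq].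
have [e /= e0 eP] : \forall x \near t, p x - q x != 0.
  exact: (cvgr_neq0 _ cpq).
pose d := Num.min (e / 2) (l / 4).
have d0 : 0 < d by rewrite lt_min; apply/andP; split; lra.
have de : d <= e / 2 by rewrite ge_min lexx.
have dl : d <= l / 4 by rewrite ge_min lexx orbT.
pose x := if t < l / 2 then t + d else t - d.
have xe : `|t - x| < e.
  by rewrite /x; case: ifP => _; rewrite ltr_norml; apply/andP; split; lra.
have [x0 xl] : 0 < x /\ x < l.
  by rewrite /x; have [h|h] := ltP t (l / 2); split; lra.
by have := eP x xe; rewrite (pq x x0 xl) subrr eqxx.
Qed.

End density_estimates.

(** * The boundary values determine the potential *)

Section boundary_uniqueness.
Context {R : realType}.
Local Notation mu := (@lebesgue_measure R).
Let mD (l : R) : measurable (`]0, l[ : set R) := measurable_itv _.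
Let mP : measurable (`]0, +oo[ : set R) := measurable_itv _.

Lemma mul_expR_le (n dl : R) : 0 <= n -> 0 < dl -> n * expR (- n * dl) <= dl^-1.
Proof.
move=> n0 dl0; rewrite mulNr expRN ler_pdivrMr ?expR_gt0// ler_pdivlMl//.
by rewrite mulrC (le_trans _ (expR_ge1Dx _))// lerDr.
Qed.

(** The decay of the transform of d(0, .) and laplace_trace bound the transform
    of f a + G on ]0, l[ at large integers; the part of the transform of G over
    t > l is of the order of e^(-nl). Hence f a + G has zero primitive, and the
    bound of G by the cumulative mass of f closes a Gronwall argument. *)
Lemma potential_unique (l c M K : R) (p q a : R -> R) (m d : R -> R -> R) :
  0 < l -> 0 < c -> 0 <= M -> 0 <= K ->
  continuous p -> continuous q -> continuous a ->
  (forall z, `|p z| <= M) -> (forall z, `|q z| <= M) -> (forall z, `|a z| <= M) ->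
  measurable_fun setT (fun z : R * R => m z.1 z.2) ->
  measurable_fun setT (fun z : R * R => d z.1 z.2) ->
  (forall y t, `|m y t| <= K * cone_weight (fun=> 1) c y t) ->
  (forall y t, `|d y t| <= K * cone_weight (cumulative l (fun z => p z - q z)) c y t) ->
  (forall y t, d y t = - (wave_source l (fun z => (p z - q z) * a z) y t +
     wave_op l (fun z => p z - q z) m y t) - wave_op l p d y t) ->
  (forall lam, lam < l -> exists C n0, forall n, (n0 <= n)%N ->
     `|laplace n%:R (d 0)| <= C * expR (- n%:R * lam)) ->
  (forall x, x \in `[0, l] -> a x != 0) ->
  forall x, x \in `[0, l] -> p x = q x.
Proof.
move=> l0 c0 M0 K0 cp cq ca pM qM aM mm md mK dK dE decay a0.
have mp := continuous_measurable cp; have mq := continuous_measurable cq.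
have ma := continuous_measurable ca.
pose f z := p z - q z.
have cf : continuous f by move=> z; apply: cvgB; [exact: cp|exact: cq].
have mf : measurable_fun setT f := continuous_measurable cf.
have fM z : `|f z| <= 2 * M.
  by rewrite (le_trans (ler_normB _ _))// mulr_natl mulr2n lerD.
pose G := trace_rate l p q m d.
have mG : measurable_fun setT G := measurable_trace_rate l mp mq mm md.
have G1 t : 0 <= t -> `|G t| <= (M * K * l + K) * (2 * M * l) * expR (c * t).
  exact: (trace_rate_bound1 l0 c0 M0 mp mq pM qM K0 mm md mK dK).
pose B := (M * K * l + K) * (2 * M * l).
have B0 : 0 <= B by rewrite !mulr_ge0 ?addr_ge0 ?mulr_ge0// ltW.
have fai : mu.-integrable `]0, l[ (EFin \o (fun t => f t * a t)).
  apply: (@leb_integrable_bnd _ _ _ (2 * M * M)) => //; first exact: leb_itv_lty.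
    by apply: measurable_fun_onT; mfun.
  by move=> z _; rewrite normrM ler_pM.
have Gi : mu.-integrable `]0, l[ (EFin \o G).
  apply: (@leb_integrable_bnd _ _ _ (B * expR (c * l))) => //; first exact: leb_itv_lty.
    exact: measurable_fun_onT.
  move=> t /=; rewrite in_itv/= => /andP[t0 tl]; apply: (le_trans (G1 t (ltW t0))).
  by rewrite ler_wpM2l// ler_expR ler_wpM2l ?ltW.
have zero x : 0 < x -> x < l -> \int[mu]_(t in `]0, x[) (f t * a t + G t) = 0.
  move=> x0 xl.
  pose lam := (x + l) / 2.
  have xlam : x < lam by rewrite /lam; lra.
  have laml : lam < l by rewrite /lam; lra.
  (* the gap between lam and lam' absorbs the factor n of laplace_trace *)
  pose lam' := (lam + l) / 2.
  have [C [n0 decayC]] : exists C n0, forall n, (n0 <= n)%N ->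
     `|laplace n%:R (d 0)| <= C * expR (- n%:R * lam') by apply: decay; rewrite /lam'; lra.
  have dl0 : 0 < lam' - lam by rewrite /lam'; lra.
  have C0 : 0 <= C.
    by have := le_trans (normr_ge0 _) (decayC _ (leqnn _)); rewrite pmulr_lge0// expR_gt0.
  pose N := maxn n0 (Num.truncn (c + 1)).+1.
  apply: (@laplace_unique R l lam (C * (lam' - lam)^-1 + B * expR (c * l)) x N) => //.
    exact: leb_integrableD.
  move=> n Nn.
  have n0n : (n0 <= n)%N by rewrite (leq_trans _ Nn)// leq_maxl.
  have cn : c + 1 <= n%:R.
    have c10 : 0 <= c + 1 by rewrite addr_ge0// ltW.
    rewrite ltW// (lt_le_trans (truncnS_gt _))//.
    by rewrite ler_nat (leq_trans _ Nn)// leq_maxr.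
  have cn' : c < n%:R by rewrite (lt_le_trans _ cn)// ltrDl.
  have nn0 : 0 < n%:R :> R by exact: lt_trans cn'.
  have nc : 0 < n%:R - c by rewrite subr_gt0.
  have := laplace_trace l0 c0 M0 mp mq ma pM qM aM K0 mm md mK dK dE cn'.
  rewrite -/f -/G => HL.
  have eG : mu.-integrable `]0, +oo[ (EFin \o (fun t => expR (- n%:R * t) * G t)).
    apply: (@laplace_integrable R n%:R c B) => // t t0; exact: G1 (ltW t0).
  have mI : measurable (`[l, +oo[ : set R) by exact: measurable_itv.
  have split : laplace n%:R G = \int[mu]_(t in `]0, l[) (expR (- n%:R * t) * G t) +
      \int[mu]_(t in `[l, +oo[) (expR (- n%:R * t) * G t).
    rewrite /laplace (_ : `]0, +oo[%classic = `]0, l[ `|` `[l, +oo[); last first.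
      by rewrite -itv_bndbnd_setU ?bnd_simp ?ltW.
    rewrite Rintegral_setU//=.
    - by rewrite -itv_bndbnd_setU ?bnd_simp ?ltW.
    - apply/disj_setPS => t [] /=; rewrite !in_itv/= => /andP[_ h1] /andP[h2 _].
      by move: (lt_le_trans h1 h2); rewrite ltxx.
  have i1 : mu.-integrable `]0, l[ (EFin \o (fun t => expR (- n%:R * t) * G t)).
    by apply: leb_integrableS mP (mD l) _ eG => t /=; rewrite !in_itv/= => /andP[->].
  have i2 : mu.-integrable `]0, l[ (EFin \o (fun t => expR (- n%:R * t) * (f t * a t))).
    apply: (@leb_integrableMb _ _ _ _ 1) => //; first by apply: measurable_fun_onT; mfun.
    move=> t /=; rewrite in_itv/= => /andP[t0 _].
    by rewrite ger0_norm ?expR_ge0// -expR0 ler_expR mulNr oppr_le0 mulr_ge0// ltW.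
  rewrite (@leb_eq_Rint _ _ _ (fun t => expR (- n%:R * t) * (f t * a t) + expR (- n%:R * t) * G t)); last first.
    by move=> t _; rewrite mulrDr.
  rewrite leb_RintD//.
  rewrite (_ : _ + _ = - n%:R * laplace n%:R (d 0) -
     \int[mu]_(t in `[l, +oo[) (expR (- n%:R * t) * G t)); last by rewrite HL split; ring.
  rewrite (le_trans (ler_normB _ _))// mulrDl lerD//.
    rewrite normrM normrN [`|n%:R|]ger0_norm ?ler0n//.
    apply: (le_trans (ler_wpM2l (ltW nn0) (decayC _ n0n))).
    rewrite mulrCA -mulrA ler_wpM2l//.
    rewrite (_ : - n%:R * lam' = - n%:R * (lam' - lam) + - n%:R * lam); last by ring.
    by rewrite expRD mulrA ler_wpM2r ?expR_ge0// mul_expR_le// ltW.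
  have em : mu.-integrable `]0, +oo[ (EFin \o (fun t => expR (- (n%:R - c) * t) * heaviside (t - l))).
    apply: (leb_integrable_le mP _ (integrable_expR nc)).
      by apply: measurable_fun_onT; have := @measurable_heaviside R => ?; mfun.
    move=> t _; rewrite normrM ger0_norm ?expR_ge0// ler_piMr ?expR_ge0//.
    by rewrite ger0_norm ?heaviside_ge0// heaviside_le1.
  rewrite -Rint_heaviside_ge ?(ltW l0)//; last by mfun.
  apply: (@le_trans _ _ (\int[mu]_(t in `]0, +oo[) (B * (expR (- (n%:R - c) * t) * heaviside (t - l))))).
    apply: leb_normr_le => //; [|exact: leb_integrableZl|].
      by apply: measurable_fun_onT; have := @measurable_heaviside R => ?; mfun.
    move=> t /=; rewrite in_itv/= andbT => t0.
    rewrite normrM [`|heaviside _|]ger0_norm ?heaviside_ge0// mulrA ler_wpM2r ?heaviside_ge0//.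
    rewrite normrM ger0_norm ?expR_ge0//.
    apply: (le_trans (ler_wpM2l (expR_ge0 _) (G1 t (ltW t0)))).
    rewrite -/B mulrCA -expRD le_eqVlt; apply/orP; left; apply/eqP.
    by congr (_ * expR _); ring.
  rewrite leb_RintZl// Rint_expR_ge ?(ltW l0)// -[X in _ <= X]mulrA; apply: (ler_wpM2l B0).
  apply: (@le_trans _ _ (expR (- (n%:R - c) * l))).
    by rewrite ler_piMr ?expR_ge0// invf_le1// lerBrDr addrC.
  rewrite -expRD ler_expR (_ : - (n%:R - c) * l = c * l - n%:R * l); last by ring.
  by rewrite lerD2l mulNr lerN2 ler_wpM2l ?ltW.
pose E := cumulative l f.
pose C2 := (M * K * l + K) * expR (c * l).
have C20 : 0 <= C2 by rewrite mulr_ge0 ?expR_ge0 ?addr_ge0 ?mulr_ge0// ltW.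
have E0 t : 0 <= E t := @cumulative_ge0 R l f t.
have Em s t : s <= t -> E s <= E t := @cumulative_le R l f (2 * M) mf fM s t.
have cfa : continuous (fun t => f t * a t).
  by move=> z; apply: cvgM; [exact: cf|exact: ca].
have fa t : 0 < t -> t < l -> `|f t * a t| <= C2 * E t.
  apply: (@le_of_zero_primitive R (fun t => f t * a t) G (fun t => C2 * E t) l) => //.
  - exact: leb_integrableD.
  - move=> s s0 sl.
    have := trace_rate_bound l0 c0 M0 mp mq pM qM K0 mm md mK dK s.
    move=> h; apply: (le_trans h); rewrite /heaviside (ltW s0) mul1r mulrA.
    rewrite ler_wpM2r// ler_wpM2l ?addr_ge0 ?mulr_ge0 ?(ltW l0)//.
    by rewrite ler_expR ler_wpM2l ?ltW.
  - by move=> s t' st; rewrite ler_wpM2l// Em.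
have [x0 x0l a0min] : exists2 x0, x0 \in `[0, l] & forall t, t \in `[0, l] -> `|a x0| <= `|a t|.
  apply: (@EVT_min R (fun t => `|a t|) 0 l (ltW l0)).
  by apply: continuous_subspaceT => t; apply: cvg_norm; exact: ca.
have ax0 : 0 < `|a x0| by rewrite normr_gt0 a0.
apply: continuous_eq_closed => // t t0 tl; apply/eqP; rewrite -subr_eq0; apply/eqP.
apply: (@gronwall_zero R f l (2 * M) (C2 / `|a x0|)) => //.
  by rewrite divr_ge0.
move=> s s0 sl; rewrite mulrAC ler_pdivlMr//.
apply: le_trans (fa s s0 sl); rewrite normrM ler_wpM2l// a0min//.
by rewrite in_itv/= !ltW.
Qed.

End boundary_uniqueness.

(** * Almost everywhere statements *)

Section almost_everywhere.
Context {R : realType}.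
Local Notation mu := (@lebesgue_measure R).

Lemma leb_ae_imp (P Q : R -> Prop) : {ae mu, forall x, P x} ->
  (forall x, P x -> Q x) -> {ae mu, forall x, Q x}.
Proof. by move=> h PQ; apply: (@filterS _ _ (ae_filter_ringOfSetsType mu) _ _ PQ h). Qed.

Lemma leb_ae_imp2 (P Q S : R -> Prop) : {ae mu, forall x, P x} ->
  {ae mu, forall x, Q x} ->
  (forall x, P x -> Q x -> S x) -> {ae mu, forall x, S x}.
Proof. by move=> hP hQ PQ; apply: (@filterS2 _ _ (ae_filter_ringOfSetsType mu) _ _ _ PQ hP hQ). Qed.

Lemma leb_ae_and (P Q : R -> Prop) : {ae mu, forall x, P x} ->
  {ae mu, forall x, Q x} -> {ae mu, forall x, P x /\ Q x}.
Proof. by move=> hP hQ; apply: (leb_ae_imp2 hP hQ). Qed.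

End almost_everywhere.

(** * Representation by the resolvent kernel *)

Section green_representation.
Context {R : realType}.
Local Notation mu := (@lebesgue_measure R).
Let mh := @measurable_heaviside R.
Let mD (l : R) : measurable (`]0, l[ : set R) := measurable_itv _.

Definition ramp (x : R) : R := x * heaviside x.

Lemma measurable_ramp : measurable_fun [set: R] ramp.
Proof. by rewrite /ramp; mfun. Qed.

Lemma ramp_ge0 x : 0 <= ramp x.
Proof.
by rewrite /ramp /heaviside; have [h|h] := leP 0 x; rewrite ?mulr1 ?mulr0.
Qed.

Lemma ger0_ramp x : 0 <= x -> ramp x = x.
Proof. by move=> x0; rewrite /ramp /heaviside x0 mulr1. Qed.

Lemma ler0_ramp x : x <= 0 -> ramp x = 0.
Proof.
rewrite le_eqVlt /ramp /heaviside => /predU1P[->|x0]; first by rewrite mul0r.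
by rewrite leNgt x0 mulr0.
Qed.

Lemma ramp_le x y : 0 <= y -> x <= y -> ramp x <= y.
Proof.
by move=> y0 xy; have [h|h] := leP 0 x; [rewrite ger0_ramp|rewrite ler0_ramp// ltW].
Qed.

Lemma Rint_itv_split (f : R -> R) (a x b : R) : measurable_fun setT f ->
  mu.-integrable `[a, b] (EFin \o f) -> a <= x -> x <= b ->
  \int[mu]_(t in `[a, b]) f t = \int[mu]_(t in `[a, x]) f t + \int[mu]_(t in `[x, b]) f t.
Proof.
move=> mf fi ax xb.
rewrite -[X in _ = _ + X]Rint_oc_cc// -Rintegral_setU//=.
- by congr (Rintegral _ _ _); rewrite -itv_bndbnd_setU ?bnd_simp.
- by rewrite -itv_bndbnd_setU ?bnd_simp.
- apply/disj_setPS => t [] /=; rewrite !in_itv/= => /andP[_ h1] /andP[h2 _].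
  by move: (le_lt_trans h1 h2); rewrite ltxx.
Qed.

Lemma Rint_oo_cc (f : R -> R) (a b : R) : measurable_fun setT f ->
  \int[mu]_(t in `]a, b[) f t = \int[mu]_(t in `[a, b]) f t.
Proof.
move=> mf; rewrite -Rint_oc_cc//; congr fine.
apply: integral_itv_bndo_bndc.
by apply/measurable_EFinP; apply: measurable_funTS; exact: mf.
Qed.

(** For F a combination of e^(kz) and e^(-kz) and h affine, k^2 F h = (F' h - F
    h')'. *)
Lemma Rint_exp_affine (k A B w s a b : R) : a <= b ->
  \int[mu]_(z in `[a, b]) ((A * expR (k * z) + B * expR (- k * z)) * (k ^+ 2 * (w + s * z))) =
  ((k * A * expR (k * b) - k * B * expR (- k * b)) * (w + s * b)
     - s * (A * expR (k * b) + B * expR (- k * b))) -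
  ((k * A * expR (k * a) - k * B * expR (- k * a)) * (w + s * a)
     - s * (A * expR (k * a) + B * expR (- k * a))).
Proof.
move=> ab.
pose F (z : R) : R := (k * A * expR (k * z) - k * B * expR (- k * z)) * (w + s * z)
     - s * (A * expR (k * z) + B * expR (- k * z)).
pose f (z : R) : R := (A * expR (k * z) + B * expR (- k * z)) * (k ^+ 2 * (w + s * z)).
have dF x : is_derive x (1 : R) F (f x).
  have H1 := is_derive_expR_lin k x.
  have H2 := is_derive_expR_lin (- k) x.
  rewrite /F; apply: is_derive_eq.
  rewrite /f /GRing.scale /= !mulr1 ?mulr0; ring.
have cf : continuous f.
  move=> x; rewrite /f; apply: cvgM.
    by apply: cvgD; apply: cvgMr; exact: continuous_expR_lin.
  apply: cvgMr; apply: cvgD; first exact: cvg_cst.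
  by apply: cvgMr; exact: cvg_id.
exact: (Rint_FTC ab dF cf).
Qed.

Lemma neumann_left (k y z : R) : k != 0 -> z <= y ->
  neumann k y z = expR (- k * y) / (2 * k) * expR (k * z) +
     expR (- k * y) / (2 * k) * expR (- k * z).
Proof.
move=> k0 zy; rewrite /neumann ger0_norm ?subr_ge0//.
rewrite (_ : - k * (y - z) = - k * y + k * z); last by ring.
rewrite (_ : - k * (y + z) = - k * y + - k * z); last by ring.
by rewrite !expRD; ring.
Qed.

Lemma neumann_right (k y z : R) : k != 0 -> y <= z ->
  neumann k y z = 0 * expR (k * z) +
     (expR (k * y) + expR (- k * y)) / (2 * k) * expR (- k * z).
Proof.
move=> k0 zy; rewrite /neumann distrC ger0_norm ?subr_ge0//.
rewrite (_ : - k * (z - y) = k * y + - k * z); last by ring.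
rewrite (_ : - k * (y + z) = - k * y + - k * z); last by ring.
by rewrite !expRD; ring.
Qed.

Let expRNK (k x : R) : expR (k * x) * expR (- k * x) = 1.
Proof. by rewrite -expRD mulNr subrr expR0. Qed.

Context (l k : R) (l0 : 0 < l) (k0 : 0 < k).
Let kn0 : k != 0. Proof. by rewrite gt_eqF. Qed.

Let nint (y : R) (h : R -> R) (B : R) : 0 <= y ->
  measurable_fun setT h -> (forall z, 0 <= z -> z <= l -> `|h z| <= B) ->
  mu.-integrable `[0, l] (EFin \o (fun z => neumann k y z * h z)).
Proof.
move=> y0 mh' hB; apply: (@leb_integrable_bnd _ _ _ (k^-1 * B)).
- exact: measurable_itv.
- exact: leb_itv_lty.
- by apply: measurable_fun_onT; apply: measurable_funM => //; apply: measurable_neumann; mfun.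
- move=> z /=; rewrite in_itv/= => /andP[z0 zl]; rewrite normrM ler_pM ?hB//.
  by rewrite ger0_norm ?neumann_ge0// neumann_le_inv.
Qed.

Lemma neumann_int_cst (y : R) : 0 <= y -> y <= l ->
  k ^+ 2 * \int[mu]_(z in `]0, l[) neumann k y z = 1 - k * neumann k y l.
Proof.
move=> y0 yl.
have mn : measurable_fun setT (fun z => neumann k y z * k ^+ 2).
  by apply: measurable_funM; [apply: measurable_neumann; mfun|mfun].
have ni : mu.-integrable `[0, l] (EFin \o (fun z => neumann k y z * k ^+ 2)).
  by apply: (@nint y (fun=> k ^+ 2) `|k ^+ 2|).
rewrite mulrC -RintegralZr//; last first.
  apply: (leb_integrableS _ _ _ (leb_eq_integrable _ (leb_integrableZl (k ^- 2) _ ni) _)) => //.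
    by apply: subset_itvW; rewrite bnd_simp.
  by move=> x _ /=; field.
rewrite Rint_oo_cc// (Rint_itv_split mn ni y0 yl).
rewrite (@leb_eq_Rint _ _ _ (fun z => (expR (- k * y) / (2 * k) * expR (k * z) +
     expR (- k * y) / (2 * k) * expR (- k * z)) * (k ^+ 2 * (1 + 0 * z)))); last first.
  by move=> z /=; rewrite in_itv/= => /andP[_ zy]; rewrite neumann_left//; ring.
rewrite Rint_exp_affine//.
rewrite (@leb_eq_Rint _ `[y, l] _ (fun z => (0 * expR (k * z) +
     (expR (k * y) + expR (- k * y)) / (2 * k) * expR (- k * z)) * (k ^+ 2 * (1 + 0 * z)))); last first.
  by move=> z /=; rewrite in_itv/= => /andP[zy _]; rewrite neumann_right//; ring.
rewrite Rint_exp_affine// neumann_right// !mulr0 expR0.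
have h := expRNK k y.
rewrite (_ : expR (- k * y) = (expR (k * y))^-1); last first.
  by rewrite mulNr expRN.
by field; rewrite kn0 gt_eqF ?expR_gt0.
Qed.

(** Green's formula for the ramp with a corner at w, that is for a fundamental
    solution of the second derivative. Superposed over w it gives the general
    formula, so that functions with a merely integrable second derivative are
    covered by explicit integrals of exponentials. *)
Lemma neumann_int_ramp (y w : R) : 0 <= y -> y <= l -> 0 <= w -> w <= l ->
  k ^+ 2 * \int[mu]_(z in `]0, l[) (neumann k y z * ramp (z - w)) =
  ramp (y - w) + neumann k y w - neumann k y l * (1 + k * (l - w)).
Proof.
move=> y0 yl w0 wl.
have mr := measurable_ramp.
pose F z := neumann k y z * (k ^+ 2 * ramp (z - w)).
have mn : measurable_fun setT F.
  by rewrite /F; apply: measurable_funM; [apply: measurable_neumann; mfun|mfun].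
have rl z : 0 <= z -> z <= l -> `|k ^+ 2 * ramp (z - w)| <= k ^+ 2 * l.
  move=> z0 zl; rewrite normrM ger0_norm ?sqr_ge0// ler_wpM2l ?sqr_ge0//.
  by rewrite ger0_norm ?ramp_ge0//; apply: (ramp_le (ltW l0)); lra.
have ni : mu.-integrable `[0, l] (EFin \o F).
  by apply: (nint y0 _ rl); mfun.
rewrite mulrC -RintegralZr//; last first.
  apply: (leb_integrableS _ _ _ (leb_eq_integrable _ (leb_integrableZl (k ^- 2) _ ni) _)) => //.
    by apply: subset_itvW; rewrite bnd_simp.
  by move=> x _ /=; rewrite /F; field.
rewrite (@leb_eq_Rint _ _ _ F); last by move=> z _; rewrite /F; ring.
rewrite Rint_oo_cc// (Rint_itv_split mn ni w0 wl).
rewrite (@leb_eq_Rint _ `[0, w] _ (fun=> 0)); last first.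
  by move=> z /=; rewrite in_itv/= => /andP[_ zw]; rewrite /F ler0_ramp ?mulr0// subr_le0.
rewrite (@Rintegral_cst _ _ _ mu)// mul0r add0r.
have Fw z : w <= z -> F z = neumann k y z * (k ^+ 2 * (- w + 1 * z)).
  by move=> wz; rewrite /F ger0_ramp ?subr_ge0// mul1r addrC.
have [wy|/ltW yw] := leP w y; last first.
  rewrite (@leb_eq_Rint _ _ _ (fun z => (0 * expR (k * z) +
     (expR (k * y) + expR (- k * y)) / (2 * k) * expR (- k * z)) * (k ^+ 2 * (- w + 1 * z)))); last first.
    move=> z /=; rewrite in_itv/= => /andP[wz _]; rewrite Fw// neumann_right//.
    exact: le_trans wz.
  rewrite Rint_exp_affine// ler0_ramp ?subr_le0// !neumann_right//.
  by field.
have nwi : mu.-integrable `[w, l] (EFin \o F).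
  by apply: (leb_integrableS _ _ _ ni) => //; apply: subset_itvr; rewrite bnd_simp.
rewrite (Rint_itv_split mn nwi wy yl).
rewrite (@leb_eq_Rint _ `[w, y] _ (fun z => (expR (- k * y) / (2 * k) * expR (k * z) +
     expR (- k * y) / (2 * k) * expR (- k * z)) * (k ^+ 2 * (- w + 1 * z)))); last first.
  by move=> z /=; rewrite in_itv/= => /andP[wz zy]; rewrite Fw// neumann_left.
rewrite (@leb_eq_Rint _ `[y, l] _ (fun z => (0 * expR (k * z) +
     (expR (k * y) + expR (- k * y)) / (2 * k) * expR (- k * z)) * (k ^+ 2 * (- w + 1 * z)))); last first.
  move=> z /=; rewrite in_itv/= => /andP[yz _]; rewrite Fw; last exact: le_trans yz.
  by rewrite neumann_right.
rewrite !Rint_exp_affine// ger0_ramp ?subr_ge0// (neumann_right kn0 yl) (neumann_left kn0 wy).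
rewrite (_ : expR (- k * y) = (expR (k * y))^-1); last first.
  by rewrite mulNr expRN.
by field; rewrite kn0 gt_eqF ?expR_gt0.
Qed.

(** The function with value v0 and slope v1 at 0 and second derivative g. On ]0,
    l[ the integral runs over w < y only, and a fixed domain of integration is
    convenient for Fubini. *)
Definition taylor2 (v0 v1 : R) (g : R -> R) (y : R) : R :=
  v0 + v1 * y + \int[mu]_(w in `]0, l[) (ramp (y - w) * g w).

Context (v0 v1 : R) (g : R -> R) (gi : mu.-integrable `]0, l[ (EFin \o g)).

Let ramp_int (y : R) : 0 <= y -> y <= l ->
  mu.-integrable `]0, l[ (EFin \o (fun w => ramp (y - w) * g w)).
Proof.
move=> y0 yl; apply: (@leb_integrableMb _ _ _ _ l) => //.
  by apply: measurable_fun_onT; have := measurable_ramp => ?; mfun.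
move=> w /=; rewrite in_itv/= => /andP[w0 _].
by rewrite ger0_norm ?ramp_ge0//; apply: (ramp_le (ltW l0)); lra.
Qed.

Lemma taylor2_bound (y : R) : 0 <= y -> y <= l ->
  `|taylor2 v0 v1 g y| <= `|v0| + `|v1| * l + l * \int[mu]_(w in `]0, l[) `|g w|.
Proof.
move=> y0 yl; rewrite (le_trans (ler_normD _ _))// lerD//.
  by rewrite (le_trans (ler_normD _ _))// lerD// normrM ler_wpM2l// ger0_norm.
rewrite -leb_RintZl//; last exact: leb_integrable_norm.
apply: leb_normr_le => //; first exact: leb_measurable (ramp_int y0 yl).
  by apply: leb_integrableZl => //; exact: leb_integrable_norm.
move=> w /=; rewrite in_itv/= => /andP[w0 _]; rewrite normrM ler_wpM2r//.
by rewrite ger0_norm ?ramp_ge0//; apply: (ramp_le (ltW l0)); lra.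
Qed.

(** It makes the integrand globally measurable. *)
Lemma taylor2_patch : taylor2 v0 v1 g = taylor2 v0 v1 (g \_ `]0, l[).
Proof.
apply/funext => y; rewrite /taylor2; congr (_ + _); apply: leb_eq_Rint => w wl.
by rewrite patchE mem_set.
Qed.

Lemma measurable_taylor2 : measurable_fun setT (taylor2 v0 v1 g).
Proof.
rewrite taylor2_patch.
have mg : measurable_fun setT (g \_ `]0, l[).
  by have /(measurable_restrictT _ (mD l)).1 := leb_measurable gi.
have mr := measurable_ramp.
apply: measurable_funD; first by mfun.
apply: (@leb_measurable_Rint R _ _ _ (fun y w : R => ramp (y - w) * (g \_ `]0, l[) w)) => //.
by mfun.
Qed.

(** By linearity from the ramps. The boundary term at l is multiplied by N(y,
    l), exponentially small for y away from l; its coefficient contains the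
    unknown value and slope at l. *)
Lemma green_formula (y : R) : 0 <= y -> y <= l ->
  taylor2 v0 v1 g y =
  \int[mu]_(z in `]0, l[) (neumann k y z * (k ^+ 2 * taylor2 v0 v1 g z - g z)) +
  neumann k y l * (v1 + \int[mu]_(z in `]0, l[) g z + k * taylor2 v0 v1 g l)
  - v1 * neumann k y 0.
Proof.
move=> y0 yl.
have mr := measurable_ramp.
have ll : 0 <= l <= l by rewrite lexx ltW.
have mn : measurable_fun setT (fun z => neumann k y z).
  by apply: measurable_neumann; mfun.
have nb z : `]0, l[%classic z -> `|neumann k y z| <= k^-1.
  move=> /=; rewrite in_itv/= => /andP[/ltW z0 _].
  by rewrite ger0_norm ?neumann_ge0// neumann_le_inv.
have ni (h : R -> R) (B : R) : measurable_fun setT h ->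
   (forall z, 0 <= z -> z <= l -> `|h z| <= B) ->
   mu.-integrable `]0, l[ (EFin \o (fun z => neumann k y z * h z)).
  move=> mh' hB; apply: (leb_integrableS _ _ _ (nint y0 mh' hB)) => //.
  by apply: subset_itvW; rewrite bnd_simp.
have i1 := ni _ _ measurable_taylor2 taylor2_bound.
have i2 : mu.-integrable `]0, l[ (EFin \o (fun z => neumann k y z * g z)).
  by apply: (@leb_integrableMb _ _ _ _ k^-1) => //; exact: measurable_fun_onT.
have swap : \int[mu]_(z in `]0, l[) (neumann k y z * taylor2 v0 v1 g z) =
   v0 * \int[mu]_(z in `]0, l[) neumann k y z +
   v1 * \int[mu]_(z in `]0, l[) (neumann k y z * ramp (z - 0)) +
   \int[mu]_(w in `]0, l[) (g w * \int[mu]_(z in `]0, l[) (neumann k y z * ramp (z - w))).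
  have j0 : mu.-integrable `]0, l[ (EFin \o (fun z => neumann k y z)).
    have H := @ni (fun=> 1) 1; apply: (leb_eq_integrable (mD l) (H _ _)) => //.
      by move=> z _ _; rewrite normr1.
    by move=> z _; rewrite mulr1.
  have j1 w : 0 <= w -> mu.-integrable `]0, l[ (EFin \o (fun z => neumann k y z * ramp (z - w))).
    move=> w0; apply: (@ni (fun z => ramp (z - w)) l); first by mfun.
    by move=> z z0 zl; rewrite ger0_norm ?ramp_ge0//; apply: (ramp_le (ltW l0)); lra.
  have j2 : (mu \x mu)%E.-integrable (`]0, l[ `*` `]0, l[)
      (EFin \o (fun z => neumann k y z.1 * (ramp (z.1 - z.2) * (g \_ `]0, l[) z.2))).
    have mg : measurable_fun setT (g \_ `]0, l[).
      by have /(measurable_restrictT _ (mD l)).1 := leb_measurable gi.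
    apply: (@leb_integrable_prod R _ _ (fun=> k^-1 * l) (fun w => `|g w|)
       (fun z w => neumann k y z * (ramp (z - w) * (g \_ `]0, l[) w))) => //.
    - apply: measurable_fun_onT; apply: measurable_funM; last by mfun.
      by apply: measurable_neumann; mfun.
    - by apply: leb_integrable_cst => //; exact: leb_itv_lty.
    - exact: leb_integrable_norm.
    - move=> z w zl wl; rewrite /= patchE mem_set// normrM -[X in _ <= X]mulrA.
      apply: ler_pM => //; first exact: nb.
      rewrite normrM ler_wpM2r// ger0_norm ?ramp_ge0//.
      move: zl wl; rewrite /= !in_itv/= => /andP[z0 zl] /andP[w0 wl].
      by apply: (ramp_le (ltW l0)); lra.
  transitivity (\int[mu]_(z in `]0, l[) (v0 * neumann k y z + v1 * (neumann k y z * ramp (z - 0))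
      + \int[mu]_(w in `]0, l[) (neumann k y z * (ramp (z - w) * (g \_ `]0, l[) w)))).
    apply: leb_eq_Rint => z /=; rewrite in_itv/= => /andP[z0 zl].
    rewrite subr0 ger0_ramp ?ltW// /taylor2 !mulrDr -leb_RintZl//; last by apply: ramp_int; exact: ltW.
    congr (_ + _); first by ring.
    by apply: leb_eq_Rint => w wl; rewrite patchE mem_set.
  have := leb_integrable_Rint1 (f := fun z w => neumann k y z * (ramp (z - w) * (g \_ `]0, l[) w)) (mD l) (mD l) j2.
  move=> j3.
  rewrite leb_RintD//; last by apply: leb_integrableD => //; apply: leb_integrableZl => //; exact: j1.
  rewrite leb_RintD//; [|by apply: leb_integrableZl|by apply: leb_integrableZl => //; exact: j1].
  rewrite !leb_RintZl//; last exact: j1.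
  congr (_ + _).
  rewrite (leb_fubini (f := fun z w => neumann k y z * (ramp (z - w) * (g \_ `]0, l[) w)))//.
  apply: leb_eq_Rint => w /= wl; rewrite -leb_RintZl//; last first.
    by apply: j1; move: wl; rewrite in_itv/= => /andP[/ltW].
  by apply: leb_eq_Rint => z _; rewrite patchE mem_set//; ring.
rewrite (_ : \int[mu]_(z in `]0, l[) (neumann k y z * (k ^+ 2 * taylor2 v0 v1 g z - g z)) =
   k ^+ 2 * \int[mu]_(z in `]0, l[) (neumann k y z * taylor2 v0 v1 g z) -
   \int[mu]_(z in `]0, l[) (neumann k y z * g z)); last first.
  rewrite -leb_RintZl// -leb_RintB//; last exact: leb_integrableZl.
  by apply: leb_eq_Rint => z _; ring.
rewrite swap.
have -> : k ^+ 2 * (v0 * \int[mu]_(z in `]0, l[) neumann k y z +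
   v1 * \int[mu]_(z in `]0, l[) (neumann k y z * ramp (z - 0)) +
   \int[mu]_(w in `]0, l[) (g w * \int[mu]_(z in `]0, l[) (neumann k y z * ramp (z - w)))) =
   v0 * (1 - k * neumann k y l) +
   v1 * (y + neumann k y 0 - neumann k y l * (1 + k * l)) +
   (\int[mu]_(w in `]0, l[) (ramp (y - w) * g w) +
    \int[mu]_(w in `]0, l[) (neumann k y w * g w) -
    neumann k y l * (\int[mu]_(w in `]0, l[) g w + k * \int[mu]_(w in `]0, l[) (ramp (l - w) * g w))).
  rewrite 2!mulrDr; congr (_ + _ + _).
  - by rewrite mulrCA neumann_int_cst.
  - by rewrite mulrCA neumann_int_ramp ?lexx ?(ltW l0)// !subr0 ger0_ramp.
  - have r1 := ramp_int y0 yl.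
    have r2 : mu.-integrable `]0, l[ (EFin \o (fun w => ramp (l - w) * g w)).
      exact: (ramp_int (ltW l0) (lexx l)).
    rewrite -leb_RintD// -[k * _]leb_RintZl// -leb_RintD//; last exact: leb_integrableZl.
    rewrite -[neumann k y l * _]leb_RintZl//; last by apply: leb_integrableD => //; exact: leb_integrableZl.
    have r3 : mu.-integrable `]0, l[ (EFin \o (fun w =>
        neumann k y l * (g w + k * (ramp (l - w) * g w)))).
      by apply: leb_integrableZl => //; apply: leb_integrableD => //; exact: leb_integrableZl.
    have r4 := leb_integrableB (mD l) (leb_integrableD (mD l) r1 i2) r3.
    rewrite -leb_RintB//; last exact: leb_integrableD.
    rewrite -[RHS](@mulVKf _ (k ^+ 2)) ?expf_neq0//; congr (_ * _).
    rewrite -leb_RintZl//; apply: leb_eq_Rint => w /=; rewrite in_itv/= => /andP[w0 wl].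
    rewrite -[LHS](@mulKf _ (k ^+ 2)) ?expf_neq0//; congr (_ * _).
    rewrite mulrCA neumann_int_ramp ?(ltW w0) ?(ltW wl)//.
    by rewrite [ramp (l - w)]ger0_ramp ?subr_ge0 ?ltW//; ring.
by rewrite /taylor2; ring.
Qed.

End green_representation.

(** * Stability of the resolvent equation *)

Section resolvent_comparison.
Context {R : realType}.
Local Notation mu := (@lebesgue_measure R).
Let mD (l : R) : measurable (`]0, l[ : set R) := measurable_itv _.

(** With the weight e^(ky) the operator d |-> N(p d) is a contraction for k >= 2
    M l, because N(y, z) e^(kz) <= e^(ky) / k. The solution inherits the size of
    the right-hand side, and the a priori bound D is used up by iteration. *)
Lemma resolvent_bound (l k M B D : R) (p d r : R -> R) : 0 < l -> 0 < k ->
  measurable_fun setT p -> (forall z, `|p z| <= M) -> 2 * M * l <= k ->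
  measurable_fun setT d -> (forall y, 0 <= y -> y <= l -> `|d y| <= D) ->
  (forall y, 0 <= y -> y <= l -> `|r y| <= B * expR (k * y)) ->
  (forall y, 0 <= y -> y <= l ->
     d y = r y - \int[mu]_(z in `]0, l[) (neumann k y z * (p z * d z))) ->
  `|d 0| <= 2 * B.
Proof.
move=> l0 k0 mp pM Mlk md dD rB dE.
have D0 : 0 <= D by apply: le_trans (dD 0 (lexx 0) (ltW l0)).
have M0 : 0 <= M by exact: le_trans (pM 0).
have B0 : 0 <= B.
  have := le_trans (normr_ge0 _) (rB 0 (lexx 0) (ltW l0)).
  by rewrite mulr0 expR0 mulr1.
have it n : forall y, 0 <= y -> y <= l -> `|d y| <= (2 * B + D * 2^-1 ^+ n) * expR (k * y).
  elim: n => [|n IH] y y0 yl.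
    apply: (le_trans (dD y y0 yl)); rewrite expr0 mulr1.
    apply: (@le_trans _ _ (D * expR (k * y))).
      by rewrite ler_peMr// -expR0 ler_expR mulr_ge0// ltW.
    by rewrite ler_wpM2r ?expR_ge0// lerDr mulr_ge0.
  set C := 2 * B + D * 2^-1 ^+ n in IH.
  have C0 : 0 <= C by rewrite addr_ge0 ?mulr_ge0 ?exprn_ge0.
  have I1 : `|\int[mu]_(z in `]0, l[) (neumann k y z * (p z * d z))| <=
      M * C / k * expR (k * y) * l.
    have muD : fine (mu `]0, l[) = l := fine_lebesgue_itvoo l0.
    rewrite -[X in _ <= _ * X]muD; apply: leb_normr_bnd => //; first exact: leb_itv_lty.
      apply: measurable_fun_onT; apply: measurable_funM; last by mfun.
      by apply: measurable_neumann; mfun.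
    move=> z /=; rewrite in_itv/= => /andP[z0 zl].
    rewrite (normrM (neumann k y z)) (normrM (p z)) [`|neumann _ _ _|]ger0_norm ?neumann_ge0//.
    apply: (@le_trans _ _ (expR (- k * `|y - z|) / k * (M * (C * expR (k * z))))).
      apply: ler_pM => //; first exact: neumann_ge0.
        by apply: neumann_le => //; exact: ltW.
      by apply: ler_pM => //; apply: IH; exact: ltW.
    rewrite (_ : _ * (M * _) = M * C / k * (expR (- k * `|y - z|) * expR (k * z))); last by ring.
    rewrite ler_wpM2l ?mulr_ge0 ?invr_ge0 ?(ltW k0)// -expRD ler_expR.
    rewrite mulNr addrC -mulrBr ler_wpM2l ?(ltW k0)//.
    by have := ler_norm (z - y); rewrite distrC => ?; lra.
  rewrite dE// (le_trans (ler_normB _ _))//.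
  apply: (le_trans (lerD (rB y y0 yl) I1)).
  rewrite (_ : M * C / k * expR (k * y) * l = C * (M * l / k) * expR (k * y)); last by ring.
  rewrite -mulrDl ler_wpM2r ?expR_ge0//.
  have h : M * l / k <= 2^-1.
    by rewrite ler_pdivrMr//; lra.
  apply: (@le_trans _ _ (B + C * 2^-1)); first by rewrite lerD2l ler_wpM2l.
  by rewrite exprSr /C le_eqVlt; apply/orP; left; apply/eqP; field.
have : 2 * B + D * 2^-1 ^+ n @[n --> \oo] --> 2 * B + D * 0.
  apply: cvgD; first exact: cvg_cst.
  apply: cvgMr; apply: cvg_expr.
  by rewrite ger0_norm// invf_lt1// ltr1n.
rewrite mulr0 addr0 => h0.
rewrite -(cvg_lim (@Rhausdorff R) h0); apply: limr_ge; first exact: cvgP h0.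
near=> n; have := it n 0 (lexx 0) (ltW l0).
by rewrite mulr0 expR0 mulr1.
Unshelve. all: by end_near. Qed.

(** The difference of the two functions solves the resolvent equation with
    right-hand side the boundary term of green_formula at l and the contribution
    of e, to which resolvent_bound applies: N(y, l) = O(e^(-kl) e^(ky) / k). *)
Lemma boundary_value_estimate (l k M Dh : R) (p a b rh : R -> R) (a1 v0 : R) (g e : R -> R) :
  0 < l -> 0 < k -> measurable_fun setT p -> measurable_fun setT a ->
  measurable_fun setT b ->
  (forall z, `|p z| <= M) -> (forall z, `|a z| <= M) -> (forall z, `|b z| <= M) ->
  2 * M * l <= k ->
  measurable_fun setT rh -> (forall y, 0 <= y -> y <= l -> `|rh y| <= Dh) ->
  (forall y, 0 <= y -> y <= l -> rh y =
     \int[mu]_(z in `]0, l[) (neumann k y z * (b z - p z * a z)) + a1 * neumann k y 0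
     - \int[mu]_(z in `]0, l[) (neumann k y z * (p z * rh z))) ->
  mu.-integrable `]0, l[ (EFin \o g) -> mu.-integrable `]0, l[ (EFin \o e) ->
  {ae mu, forall z, `]0, l[%classic z ->
     g z = (p z + k ^+ 2) * taylor2 l v0 (- a1) g z + p z * a z - b z + e z} ->
  `|v0 - rh 0| <= 2 * k^-1 * (expR (- k * l) * (`|a1| + \int[mu]_(z in `]0, l[) `|g z| +
      k * (`|v0| + `|a1| * l + l * \int[mu]_(z in `]0, l[) `|g z|)) +
      \int[mu]_(z in `]0, l[) `|e z|).
Proof.
move=> l0 k0 mp ma mb pM aM bM Mlk mrh rhD rhE gi ei gE.
have M0 : 0 <= M by exact: le_trans (pM 0).
pose T := taylor2 l v0 (- a1) g.
have mT : measurable_fun setT T by exact: measurable_taylor2.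
pose IG := \int[mu]_(z in `]0, l[) `|g z|.
pose DT := `|v0| + `|a1| * l + l * IG.
have Tb y : 0 <= y -> y <= l -> `|T y| <= DT.
  by move=> y0 yl; have := taylor2_bound l0 v0 (- a1) gi y0 yl; rewrite normrN.
pose r y := neumann k y l * (- a1 + \int[mu]_(z in `]0, l[) g z + k * T l)
   - \int[mu]_(z in `]0, l[) (neumann k y z * e z).
have T0 : T 0 = v0.
  rewrite /T /taylor2 mulr0 addr0 (@leb_eq_Rint _ _ _ (fun=> 0)).
    by rewrite (@Rintegral_cst _ _ _ mu)// mul0r addr0.
  move=> w /=; rewrite in_itv/= => /andP[/ltW w0 _].
  by rewrite ler0_ramp ?mul0r// sub0r oppr_le0.
have ni (y B : R) (h : R -> R) : 0 <= y -> measurable_fun setT h ->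
   (forall z, 0 <= z -> z <= l -> `|h z| <= B) ->
   mu.-integrable `]0, l[ (EFin \o (fun z => neumann k y z * h z)).
  move=> y0 mh' hB; apply: (@leb_integrable_bnd _ _ _ (k^-1 * B)) => //; first exact: leb_itv_lty.
    by apply: measurable_fun_onT; apply: measurable_funM => //; apply: measurable_neumann; mfun.
  move=> z /=; rewrite in_itv/= => /andP[/ltW z0 /ltW zl]; rewrite normrM ler_pM ?hB//.
  by rewrite ger0_norm ?neumann_ge0// neumann_le_inv.
have nf y (h : R -> R) : 0 <= y -> mu.-integrable `]0, l[ (EFin \o h) ->
   mu.-integrable `]0, l[ (EFin \o (fun z => neumann k y z * h z)).
  move=> y0 hi; apply: (@leb_integrableMb _ _ _ _ k^-1) => //.
    by apply: measurable_fun_onT; apply: measurable_neumann; mfun.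
  move=> z /=; rewrite in_itv/= => /andP[/ltW z0 _].
  by rewrite ger0_norm ?neumann_ge0// neumann_le_inv.
have -> : v0 - rh 0 = T 0 - rh 0 by rewrite T0.
have IG0 : 0 <= IG by apply: Rintegral_ge0.
rewrite -mulrA; apply: (@resolvent_bound l k M _ (DT + Dh) p (fun y => T y - rh y) r) => //.
- exact: measurable_funB.
- by move=> y y0 yl; rewrite (le_trans (ler_normB _ _))// lerD ?Tb ?rhD.
- move=> y y0 yl; rewrite (le_trans (ler_normB _ _))//.
  rewrite -/IG -/DT [k^-1 * (_ + _)]mulrDr [X in _ <= X]mulrDl lerD//.
    rewrite normrM ger0_norm ?neumann_ge0//.
    rewrite (_ : _ * expR (k * y) = expR (- k * (l - y)) / k *
      (`|a1| + IG + k * DT)); last first.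
      rewrite (_ : - k * (l - y) = - k * l + k * y) ?expRD; last by ring.
      by rewrite /DT /IG; ring.
    apply: ler_pM => //; first exact: neumann_ge0.
      apply: (le_trans (neumann_le k0 y0 (ltW l0))).
      by rewrite distrC ger0_norm ?subr_ge0.
    rewrite (le_trans (ler_normD _ _))// lerD//.
      rewrite (le_trans (ler_normD _ _))// normrN lerD//.
      exact: le_normr_Rintegral.
    by rewrite normrM gtr0_norm// ler_wpM2l ?(ltW k0)// Tb// ltW.
  apply: (@le_trans _ _ (k^-1 * \int[mu]_(z in `]0, l[) `|e z|)); last first.
    rewrite ler_peMr//; last by rewrite -expR0 ler_expR mulr_ge0// ltW.
    by rewrite mulr_ge0 ?invr_ge0 ?(ltW k0)//; exact: Rintegral_ge0.
  rewrite -leb_RintZl//; last exact: leb_integrable_norm.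
  apply: leb_normr_le => //; first exact: leb_measurable (nf _ _ y0 ei).
    by apply: leb_integrableZl => //; exact: leb_integrable_norm.
  move=> z /=; rewrite in_itv/= => /andP[/ltW z0 _]; rewrite normrM ler_wpM2r//.
  by rewrite ger0_norm ?neumann_ge0// neumann_le_inv.
- move=> y y0 yl.
  have pr z : 0 <= z -> z <= l -> `|p z * rh z| <= M * Dh.
    by move=> z0 zl; rewrite normrM ler_pM// rhD.
  have pt z : 0 <= z -> z <= l -> `|p z * T z| <= M * DT.
    by move=> z0 zl; rewrite normrM ler_pM// Tb.
  have bpa z : 0 <= z -> z <= l -> `|b z - p z * a z| <= M + M * M.
    by move=> _ _; rewrite (le_trans (ler_normB _ _))// lerD// normrM ler_pM.
  have mpr : measurable_fun setT (fun z => p z * rh z) by mfun.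
  have mpt : measurable_fun setT (fun z => p z * T z) by mfun.
  have mba : measurable_fun setT (fun z => b z - p z * a z) by mfun.
  have n1 := ni y _ _ y0 mpr pr; have n2 := ni y _ _ y0 mpt pt.
  have n3 := ni y _ _ y0 mba bpa; have n4 := nf y _ y0 ei.
  have E : T y = (\int[mu]_(z in `]0, l[) (neumann k y z * (b z - p z * a z)) -
      \int[mu]_(z in `]0, l[) (neumann k y z * (p z * T z)) -
      \int[mu]_(z in `]0, l[) (neumann k y z * e z)) +
      neumann k y l * (- a1 + \int[mu]_(z in `]0, l[) g z + k * T l)
      + a1 * neumann k y 0.
    rewrite {1}/T (green_formula l0 k0 v0 (- a1) gi y0 yl) mulNr opprK; congr (_ + _ + _).
    rewrite -leb_RintB// -leb_RintB//; last exact: leb_integrableB.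
    have m1 : measurable_fun (`]0, l[ : set R) g := leb_measurable gi.
    have m2 : measurable_fun (`]0, l[ : set R) e := leb_measurable ei.
    have m3 : measurable_fun (`]0, l[ : set R) (neumann k y).
      by apply: measurable_fun_onT; apply: measurable_neumann; mfun.
    have m4 : measurable_fun (`]0, l[ : set R) T by exact: measurable_fun_onT.
    have m5 : measurable_fun (`]0, l[ : set R) (fun z => b z - p z * a z) by exact: measurable_fun_onT.
    have m6 : measurable_fun (`]0, l[ : set R) (fun z => p z * T z) by exact: measurable_fun_onT.
    apply: leb_ae_eq_Rint => //.
    - by apply: measurable_funM => //; apply: measurable_funB => //; apply: measurable_funM.
    - by apply: measurable_funB; [apply: measurable_funB|]; apply: measurable_funM.
    - by apply: (leb_ae_imp gE) => z gEz zl; rewrite (gEz zl) -/T; ring.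
  rewrite {1}E (rhE y y0 yl) /r.
  rewrite (_ : \int[mu]_(z in `]0, l[) (neumann k y z * (p z * (T z - rh z))) =
     \int[mu]_(z in `]0, l[) (neumann k y z * (p z * T z)) -
     \int[mu]_(z in `]0, l[) (neumann k y z * (p z * rh z))); last first.
    by rewrite -leb_RintB//; apply: leb_eq_Rint => z _; ring.
  by ring.
Qed.

End resolvent_comparison.

(** * Smooth steps *)

Section smooth_functions.
Context {R : realType}.
Local Notation mu := (@lebesgue_measure R).
Implicit Types f g : R -> R.

(** Explicit successive derivatives, which are easier to combine than the
    iterated operator derive1n. *)
Fixpoint smooth_upto (n : nat) f : Prop :=
  if n is m.+1 then
    exists2 g : R -> R, (forall x : R, is_derive x 1 f (g x)) & smooth_upto m g
  else True.

Definition smooth f := forall n, smooth_upto n f.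

Lemma smooth_derivable1n f : smooth f -> forall n (x : R), derivable (derive1n n f) x 1.
Proof.
move=> sf n; have := sf n.+1; elim: n f {sf} => [|n IH] f [g fg sg] x.
  by have [] := fg x.
rewrite derive1Sn (_ : derive1 f = g); last first.
  by apply/funext => y; rewrite derive1E; have := fg y => ?; exact: derive_val.
by apply: IH; exact: sg.
Qed.

Lemma smooth_uptoW n f : smooth_upto n.+1 f -> smooth_upto n f.
Proof.
elim: n f => [//|n IH] f [g fg sg]; exists g => //; exact: IH sg.
Qed.

Lemma smooth_upto_cst n (c : R) : smooth_upto n (fun=> c).
Proof.
elim: n c => [//|n IH] c; exists (fun=> 0) => // x; exact: is_derive_cst.
Qed.

Lemma smooth_uptoD n f g : smooth_upto n f -> smooth_upto n g ->
  smooth_upto n (fun x => f x + g x).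
Proof.
elim: n f g => [//|n IH] f g [f' df sf] [g' dg sg].
exists (fun x => f' x + g' x); last exact: IH.
by move=> x; have := df x; have := dg x => ? ?; exact: is_deriveD.
Qed.

Lemma smooth_uptoM n f g : smooth_upto n f -> smooth_upto n g ->
  smooth_upto n (fun x => f x * g x).
Proof.
elim: n f g => [//|n IH] f g hf hg.
have [sf0 sg0] := (smooth_uptoW hf, smooth_uptoW hg).
case: hf => f' df sf; case: hg => g' dg sg.
exists (fun x => f x * g' x + g x * f' x); last by apply: smooth_uptoD; exact: IH.
by move=> x; have := df x; have := dg x => ? ?; exact: is_deriveM.
Qed.

Lemma smooth_upto_affine n f (a b : R) : smooth_upto n f ->
  smooth_upto n (fun x => f (a * x + b)).
Proof.
elim: n f => [//|n IH] f [f' df sf].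
exists (fun x => f' (a * x + b) * a); last first.
  by apply: smooth_uptoM; [exact: IH|exact: smooth_upto_cst].
move=> x; have h : is_derive x 1 (fun x => a * x + b) a.
  by apply: is_derive_eq; rewrite /GRing.scale/= !mulr1 addr0.
have := df (a * x + b) => ?.
exact: (@is_derive1_comp R f (fun x => a * x + b)).
Qed.

(** The functions x^(-k) e^(-1/x), extended by 0: a family stable under
    differentiation up to linear combinations, so that all its members are
    smooth. *)
Definition flat (k : nat) (x : R) : R :=
  if 0 < x then x ^- k * expR (- x^-1) else 0.

Lemma flat_ge0 k x : 0 <= flat k x.
Proof. by rewrite /flat; case: ifP => // x0; rewrite mulr_ge0 ?expR_ge0// invr_ge0 exprn_ge0// ltW. Qed.

Lemma flatS k x : x != 0 -> x^-1 * flat k x = flat k.+1 x.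
Proof.
by move=> x0; rewrite /flat; case: ifP => _; rewrite ?mulr0// mulrA exprS invfM.
Qed.

(** e^(1/x) is at least the term of order k + 1 of its series. *)
Lemma flat_le k x : 0 < x -> flat k x <= k.+1`!%:R * x.
Proof.
move=> x0; rewrite /flat x0 expRN.
have h : x^-1 ^+ k.+1 / k.+1`!%:R <= expR x^-1.
  by apply: le_trans (expR_ge1Dxn k _); rewrite ?lerDr ?invr_ge0 ?(ltW x0).
have F0 : (0 : R) < k.+1`!%:R by rewrite ltr0n fact_gt0.
have p0 : 0 < x^-1 ^+ k.+1 / k.+1`!%:R by rewrite divr_gt0 ?exprn_gt0 ?invr_gt0.
have h2 : (expR x^-1)^-1 <= (x^-1 ^+ k.+1 / k.+1`!%:R)^-1.
  by rewrite lef_pV2 ?posrE ?expR_gt0.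
apply: (@le_trans _ _ (x ^- k * (x^-1 ^+ k.+1 / k.+1`!%:R)^-1)).
  by rewrite ler_wpM2l// invr_ge0 exprn_ge0// ltW.
have xn : x ^+ k != 0 by rewrite expf_neq0 ?gt_eqF.
rewrite le_eqVlt; apply/orP; left; apply/eqP.
rewrite exprVn exprS; field.
by rewrite xn !gt_eqF.
Qed.

(** The derivative at 0 is the limit of x^(-1) flat k x = flat (k + 1) x, which
    tends to 0 by flat_le. *)
Lemma is_derive_flat k (x : R) :
  is_derive x 1 (flat k) (flat k.+2 x - k%:R * flat k.+1 x).
Proof.
case: (ltgtP 0 x) => [x0|x0|<-].
- apply: (@near_eq_is_derive _ _ _ (fun y : R => y ^- k * expR (- y^-1))).
  + near=> y; rewrite /flat ifT//; near: y; exact: lt_nbhsr.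
  have xn0 : x != 0 by rewrite gt_eqF.
  have hV : is_derive x 1 (fun y : R => y^-1) (- x ^- 2).
    have := @is_deriveV R id x 1 1 xn0 _; rewrite /GRing.scale /= mulr1; exact.
  have hX : is_derive x 1 (fun y : R => y^-1 ^+ k) (k%:R * x^-1 ^+ k.-1 * (- x ^- 2)).
    have := is_deriveX k hV; rewrite (_ : _ ^+ k = (fun y : R => y^-1 ^+ k)).
      by move=> h; exact: (is_derive_eq h).
    by apply/funext => y; rewrite exprfctE.
  have hE : is_derive x 1 (fun y : R => expR (- y^-1)) (expR (- x^-1) * x ^- 2).
    have h2 : is_derive x 1 (fun y : R => - y^-1) (x ^- 2).
      by apply: is_derive_eq; rewrite opprK.
    exact: is_derive1_comp.
  have := is_deriveM hX hE.
  rewrite (_ : (fun y : R => y^-1 ^+ k) * _ = (fun y => y ^- k * expR (- y^-1))); last first.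
    by apply/funext => y /=; rewrite /GRing.mul/= exprVn.
  move=> h; apply: (is_derive_eq h).
  rewrite /flat x0 /GRing.scale /= !exprVn.
  case: k {hX h} => [|k] /=; first by rewrite !expr0 expr1 expr2 !invr1; field.
  have xk : x ^+ k != 0 by rewrite expf_neq0.
  by rewrite !exprS; field; rewrite xk xn0.
- apply: (@near_eq_is_derive _ _ _ (fun=> 0)).
  + near=> y; rewrite /flat ifF//; apply/negbTE; rewrite -leNgt; near: y.
    by apply: lt_le_nbhsl.
  by rewrite /flat !ltNge (ltW x0)/= mulr0 subrr; exact: is_derive_cst.
- rewrite {2 3}/flat ltxx mulr0 subrr.
  have H : h^-1 *: (flat k (h *: 1 + 0) - flat k 0) @[h --> (0 : R)^'] --> (0 : R).
    apply/cvgrPdist_le => e e0; near=> h.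
    have h0 : h != 0 by near: h; exact: nbhs_dnbhs_neq.
    rewrite sub0r normrN {2}/flat ltxx subr0 /GRing.scale /= mulr1 addr0 flatS//.
    have [hp|hn] := ltP 0 h; last by rewrite /flat ltNge hn/= normr0 ltW.
    rewrite ger0_norm ?flat_ge0// (le_trans (flat_le _ hp))//.
    rewrite mulrC -ler_pdivlMr ?ltr0n ?fact_gt0//.
    near: h; apply: nbhs_dnbhs.
    have d0 : 0 < e / k.+2`!%:R by rewrite divr_gt0// ltr0n fact_gt0.
    exact: nbhs0_ltW.
  split; first by apply: cvgP H.
  exact: (cvg_lim (@Rhausdorff R) H).
Unshelve. all: by end_near. Qed.

Lemma smooth_flat k : smooth (flat k).
Proof.
move=> n; elim: n k => [//|n IH] k.
exists (fun x => flat k.+2 x + - k%:R * flat k.+1 x).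
  by move=> x; have := is_derive_flat k x; rewrite mulNr.
by apply: smooth_uptoD => //; apply: smooth_uptoM => //; exact: smooth_upto_cst.
Qed.

Definition bump (x : R) : R := flat 0 x * flat 0 (-1 * x + 1).

Lemma smooth_bump : smooth bump.
Proof.
by move=> n; apply: smooth_uptoM; [|apply: (@smooth_upto_affine n (flat 0))]; exact: smooth_flat.
Qed.

Lemma bump_ge0 x : 0 <= bump x.
Proof. by rewrite mulr_ge0 ?flat_ge0. Qed.

Lemma bump_gt0 x : 0 < x -> x < 1 -> 0 < bump x.
Proof.
move=> x0 x1; rewrite /bump /flat x0 ifT; last by lra.
by rewrite !expr0 invr1 !mul1r mulr_gt0// expR_gt0.
Qed.

Lemma bump_eq0 x : x <= 0 \/ 1 <= x -> bump x = 0.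
Proof.
rewrite /bump /flat => -[x0|x1]; first by rewrite ltNge x0 mul0r.
by rewrite [X in _ * (if X then _ else _)]ltNge (_ : -1 * x + 1 <= 0) ?mulr0//; lra.
Qed.

Lemma continuous_bump : continuous bump.
Proof.
move=> x; have [g bg _] := smooth_bump 1; exact: is_derive_continuous (bg x).
Qed.

Let bprim (x : R) : R := \int[mu]_(t in `[-1, x]) bump t.

Let mbump : measurable_fun setT bump.
Proof. by apply: continuous_measurable_fun; exact: continuous_bump. Qed.

Let bumpi (a b : R) : mu.-integrable `[a, b] (EFin \o bump).
Proof.
apply: continuous_compact_integrable; first exact: segment_compact.
exact: continuous_subspaceT continuous_bump.
Qed.

Let bprim0 (x : R) : x <= 0 -> bprim x = 0.
Proof.
move=> x0; rewrite /bprim (@leb_eq_Rint _ _ _ (fun=> 0)).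
  by rewrite (@Rintegral_cst _ _ _ mu)// mul0r.
by move=> t /=; rewrite in_itv/= => /andP[_ tx]; rewrite bump_eq0//; left; lra.
Qed.

Let is_derive_bprim (x : R) : is_derive x 1 bprim (bump x).
Proof.
have [x0|x0] := ltP x 0.
  rewrite bump_eq0; last by left; exact: ltW.
  apply: (@near_eq_is_derive _ _ _ (fun=> 0)).
  - by near=> y; rewrite bprim0//; near: y; apply: lt_le_nbhsl.
have x1 : x < x + 1 by rewrite ltrDl.
have [|//|d1 d2] := @continuous_FTC1_closed R bump (-1) x (x + 1) x1 (bumpi _ _).
- by lra.
- exact: continuous_bump.
- by apply: DeriveDef; [exact: d1|rewrite -derive1E; exact: d2].
Unshelve. all: by end_near. Qed.

Let bprim_ge1 (x : R) : 1 <= x -> bprim x = bprim 1.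
Proof.
have m1 : (-1 : R) <= 1 by lra.
move=> x1; rewrite /bprim (Rint_itv_split mbump (bumpi _ _) m1 x1).
rewrite [X in _ + X](@leb_eq_Rint _ _ _ (fun=> 0)); last first.
  by move=> t /=; rewrite in_itv/= => /andP[t1 _]; rewrite bump_eq0//; right.
by rewrite (@Rintegral_cst _ _ _ mu)// mul0r addr0.
Qed.

Let bprim_gt0 : 0 < bprim 1.
Proof.
rewrite lt_neqAle; apply/andP; split; last first.
  by apply: Rintegral_ge0 => t _; exact: bump_ge0.
apply/eqP => b0.
have bc x : -1 <= x -> x <= 1 -> bprim x = 0.
  move=> xm1 x1; apply/eqP; rewrite eq_le; apply/andP; split; last first.
    by apply: Rintegral_ge0 => t _; exact: bump_ge0.
  rewrite [leRHS]b0 /bprim (Rint_itv_split mbump (bumpi _ _) xm1 x1) lerDl.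
  by apply: Rintegral_ge0 => t _; exact: bump_ge0.
have h : is_derive (2^-1 : R) 1 bprim 0.
  apply: (@near_eq_is_derive _ _ _ (fun=> 0)).
  - near=> y; rewrite bc//; last by near: y; apply: lt_le_nbhsl; lra.
    by near: y; apply: lt_le_nbhsr; lra.
have h2 := is_derive_bprim 2^-1.
have e1 : 'D_1 bprim 2^-1 = 0 by exact: derive_val.
have e2 : 'D_1 bprim 2^-1 = bump 2^-1 by case: h2.
have : 0 < bump 2^-1 by apply: bump_gt0; lra.
by rewrite -e2 e1 ltxx.
Unshelve. all: by end_near. Qed.

Definition smooth_step (x : R) : R := (bprim 1)^-1 * bprim x.
Definition step_slope (x : R) : R := (bprim 1)^-1 * bump x.

Lemma is_derive_smooth_step (x : R) : is_derive x 1 smooth_step (step_slope x).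
Proof. by have := is_derive_bprim x => ?; exact: is_deriveZ. Qed.

Lemma smooth_smooth_step : smooth smooth_step.
Proof.
move=> [//|n]; exists step_slope; first exact: is_derive_smooth_step.
by apply: smooth_uptoM; [exact: smooth_upto_cst|exact: smooth_bump].
Qed.

Lemma step_slope_ge0 x : 0 <= step_slope x.
Proof. by rewrite mulr_ge0 ?bump_ge0 ?invr_ge0 ?(ltW bprim_gt0). Qed.

Lemma step_slope_eq0 x : x <= 0 \/ 1 <= x -> step_slope x = 0.
Proof. by move=> h; rewrite /step_slope bump_eq0// mulr0. Qed.

Lemma continuous_step_slope : continuous step_slope.
Proof. by move=> x; apply: cvgMr; exact: continuous_bump. Qed.

Lemma smooth_step_eq0 (x : R) : x <= 0 -> smooth_step x = 0.
Proof. by move=> x0; rewrite /smooth_step (bprim0 x0) mulr0. Qed.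

Lemma smooth_step_eq1 x : 1 <= x -> smooth_step x = 1.
Proof. by move=> x1; rewrite /smooth_step bprim_ge1// mulVf// gt_eqF// bprim_gt0. Qed.

Lemma smooth_step_ge0 x : 0 <= smooth_step x.
Proof.
by rewrite mulr_ge0 ?invr_ge0 ?(ltW bprim_gt0)//; apply: Rintegral_ge0 => t _; exact: bump_ge0.
Qed.

Lemma smooth_step_le1 x : smooth_step x <= 1.
Proof.
have [x1|x1] := leP 1 x; first by rewrite smooth_step_eq1.
have [x0|x0] := leP x 0; first by rewrite smooth_step_eq0.
rewrite /smooth_step mulrC ler_pdivrMr ?bprim_gt0// mul1r.
have xm1 : -1 <= x by lra.
rewrite [leRHS]/bprim (Rint_itv_split mbump (bumpi _ _) xm1 (ltW x1)).
by rewrite lerDl; apply: Rintegral_ge0 => t _; exact: bump_ge0.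
Qed.

End smooth_functions.

(** * Primitives of weak derivatives *)

Section weak_derivatives.
Context {R : realType}.
Local Notation mu := (@lebesgue_measure R).

(** Composition with the projection onto [0, l] extends continuous functions on
    [0, l] to the line. *)
Definition clamp (l x : R) : R := Num.max 0 (Num.min l x).

Lemma clamp_in l x : 0 <= l -> 0 <= clamp l x <= l.
Proof. by move=> l0; rewrite /clamp le_max lexx/= ge_max l0 ge_min lexx. Qed.

Lemma clamp_id l x : 0 <= x -> x <= l -> clamp l x = x.
Proof. by move=> x0 xl; rewrite /clamp min_r// max_r. Qed.

Lemma continuous_clamp l : continuous (clamp l).
Proof.
move=> x; rewrite /clamp; apply: (@continuous_max R R (fun=> 0) (fun x => Num.min l x)).
  exact: cvg_cst.
by apply: (@continuous_min R R (fun=> l) id); [exact: cvg_cst|exact: cvg_id].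
Qed.

Lemma continuous_comp_clamp l (g : R -> R) : 0 <= l ->
  {within `[0, l], continuous g} -> continuous (fun x => g (clamp l x)).
Proof.
move=> l0 /subspace_continuousP cg x.
have clA y : `[0, l]%classic (clamp l y) by rewrite /= in_itv/= clamp_in.
have h : clamp l y @[y --> x] --> within `[0, l] (nbhs (clamp l x)).
  move=> P; rewrite /within /= => PA.
  have H : \forall y \near x, `[0, l]%classic (clamp l y) -> P (clamp l y).
    exact: (@continuous_clamp l x _ PA).
  have : \forall y \near x, P (clamp l y) by apply: filterS H => y; exact.
  exact.
exact: (@cvg_comp _ _ _ (clamp l) g _ _ _ h (cg _ (clA x))).
Qed.

Lemma normr_sub_sub_le (a b x y e : R) :
  `|a - x| <= e / 2 -> `|b - y| <= e / 2 -> `|x - y - (a - b)| <= e.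
Proof.
rewrite !ler_norml => /andP[a1 a2] /andP[b1 b2]; apply/andP; split; lra.
Qed.

Lemma continuous_bounded_itv (a b : R) (g : R -> R) : continuous g ->
  exists M, forall x, a <= x -> x <= b -> `|g x| <= M.
Proof.
move=> cg; have [ab|ba] := leP a b; last first.
  by exists 0 => x ax xb; have := le_trans ax xb; rewrite leNgt ba.
have [|c _ cM] := @EVT_max R (fun x => `|g x|) a b ab.
  by apply: continuous_subspaceT => x; apply: cvg_norm; exact: cg.
by exists `|g c| => x ax xb; apply: cM; rewrite in_itv/= ax.
Qed.

(** The slope of a rescaled step is a nonnegative weight of mass 1 on ]c, c +
    1/n[, an interval contained in a small neighbourhood of y. *)
Lemma step_slope_average (l c y d e : R) (n : nat) (g : R -> R) :
  (0 < n)%N -> continuous g -> 0 <= c -> c + n%:R^-1 <= l -> 0 <= e ->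
  `|c - y| + n%:R^-1 < d -> (forall t, `|t - y| < d -> `|g t - g y| <= e) ->
  `|\int[mu]_(t in `]0, l[) (g t * (n%:R * step_slope (n%:R * (t - c)))) - g y| <= e.
Proof.
move=> n0 cg c0 cl e0 cyd gy.
have nR : (0 : R) < n%:R by rewrite ltr0n.
pose s (t : R) : R := n%:R * step_slope (n%:R * (t - c)).
have l0 : 0 <= l by apply: le_trans cl; rewrite addr_ge0// invr_ge0 ltW.
have s0 t : 0 <= s t by rewrite mulr_ge0 ?step_slope_ge0// ltW.
have cs : continuous s.
  move=> t; apply: cvgMr.
  have h : n%:R * (x - c) @[x --> t] --> n%:R * (t - c).
    by apply: cvgMr; apply: cvgB; [exact: cvg_id|exact: cvg_cst].
  exact: (@continuous_comp R R R (fun x => n%:R * (x - c)) step_slope t h (@continuous_step_slope R _)).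
have ci (h : R -> R) : continuous h -> mu.-integrable `]0, l[ (EFin \o h).
  move=> ch; apply: (@leb_integrableS R `[0, l]); [exact: measurable_itv|exact: measurable_itv| |].
    by apply: subset_itvW; rewrite bnd_simp.
  apply: continuous_compact_integrable; first exact: segment_compact.
  exact: continuous_subspaceT ch.
(* the step rises from 0 to 1 within ]0, l[ as c + 1 / n <= l *)
have sint : \int[mu]_(t in `]0, l[) s t = 1.
  rewrite Rint_oo_cc//; last by apply: continuous_measurable_fun.
  have dF (x : R) : is_derive x 1 (fun t => smooth_step (n%:R * (t - c))) (s x).
    have h : is_derive x 1 (fun t => n%:R * (t - c)) n%:R.
      by apply: is_derive_eq; rewrite /GRing.scale/= subr0 mulr1.
    have := is_derive_smooth_step (n%:R * (x - c)) => ?.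
    rewrite /s mulrC; exact: (@is_derive1_comp R smooth_step (fun t => n%:R * (t - c))).
  rewrite (Rint_FTC l0 dF cs) smooth_step_eq1 ?smooth_step_eq0 ?subr0//.
    by rewrite sub0r mulrN oppr_le0 mulr_ge0// ltW.
  by rewrite -(ler_pM2l (_ : 0 < n%:R^-1)) ?invr_gt0// mulrA mulVf ?gt_eqF// mul1r mulr1; lra.
have -> : \int[mu]_(t in `]0, l[) (g t * s t) - g y = \int[mu]_(t in `]0, l[) ((g t - g y) * s t).
  rewrite -[g y in LHS]mulr1 -sint -leb_RintZl//; last exact: ci.
  rewrite -leb_RintB//; first by apply: leb_eq_Rint => t _; rewrite mulrBl.
  - by apply: ci => t; apply: cvgM; [exact: cg|exact: cs].
  - by apply: leb_integrableZl => //; exact: ci.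
rewrite -[leRHS]mulr1 -sint -leb_RintZl//; last exact: ci.
have mI : measurable (`]0, l[ : set R) by exact: measurable_itv.
apply: leb_normr_le => //.
- apply: measurable_fun_onT; apply: continuous_measurable_fun => t; apply: cvgM; last exact: cs.
  by apply: cvgB; [exact: cg|exact: cvg_cst].
- by apply: leb_integrableZl => //; exact: ci.
- move=> t _; rewrite normrM [`|s t|]ger0_norm//.
  have [h|h] := leP (n%:R * (t - c)) 0.
    by rewrite /s step_slope_eq0 ?mulr0//; left.
  have [h1|h1] := leP 1 (n%:R * (t - c)).
    by rewrite /s step_slope_eq0 ?mulr0//; right.
  apply: ler_wpM2r => //; apply: gy; apply: le_lt_trans cyd.
  rewrite (_ : t - y = (c - y) + (t - c)); last by ring.
  rewrite (le_trans (ler_normD _ _))// lerD2l.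
  have tc : 0 < t - c by move: h; rewrite pmulr_rgt0.
  by rewrite gtr0_norm// -(ler_pM2l nR) mulfV ?gt_eqF// ltW.
Qed.

(** Rises on [1/n, 2/n] and falls on [x - 3/n, x - 2/n]: the constants keep the
    support inside a compact subset of ]0, x[, even for x = l. *)
Definition cutoff (n : nat) (x t : R) : R :=
  smooth_step (n%:R * t - 1) - smooth_step (n%:R * t + (3 - n%:R * x)).

Lemma cutoff_eq0 n x t : 4 <= n%:R * x ->
  n%:R * t <= 1 \/ n%:R * x - 2 <= n%:R * t -> cutoff n x t = 0.
Proof.
move=> nx [h|h]; rewrite /cutoff.
  by rewrite !smooth_step_eq0 ?subrr//; lra.
by rewrite !smooth_step_eq1 ?subrr//; lra.
Qed.

Lemma cutoff_eq1 n x t : 2 <= n%:R * t -> n%:R * t <= n%:R * x - 3 -> cutoff n x t = 1.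
Proof.
move=> h1 h2; rewrite /cutoff smooth_step_eq1 ?smooth_step_eq0 ?subr0//; lra.
Qed.

Lemma cutoff_le1 n x t : `|cutoff n x t| <= 1.
Proof.
have := smooth_step_ge0 (n%:R * t - 1); have := smooth_step_le1 (n%:R * t - 1).
have := smooth_step_ge0 (n%:R * t + (3 - n%:R * x)).
have := smooth_step_le1 (n%:R * t + (3 - n%:R * x)).
rewrite /cutoff => *; rewrite ler_norml; apply/andP; split; lra.
Qed.

Lemma is_derive_cutoff n (x t : R) : (0 < n)%N -> is_derive t 1 (cutoff n x)
  (n%:R * step_slope (n%:R * (t - n%:R^-1)) -
   n%:R * step_slope (n%:R * (t - (x - 3 * n%:R^-1)))).
Proof.
move=> n0; have nR : (n%:R : R) != 0 by rewrite pnatr_eq0 -lt0n.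
have H b : is_derive t 1 (fun t => smooth_step (n%:R * t + b)) (n%:R * step_slope (n%:R * t + b)).
  have h : is_derive t 1 (fun t => n%:R * t + b) n%:R.
    by apply: is_derive_eq; rewrite /GRing.scale/= addr0 mulr1.
  have := is_derive_smooth_step (n%:R * t + b) => ?.
  rewrite mulrC; exact: (@is_derive1_comp R smooth_step (fun t => n%:R * t + b)).
have := is_deriveB (H (- 1)) (H (3 - n%:R * x)).
rewrite (_ : n%:R * (t - n%:R^-1) = n%:R * t - 1); last by field.
by rewrite (_ : n%:R * (t - (x - 3 * n%:R^-1)) = n%:R * t + (3 - n%:R * x)); last by field.
Qed.

Lemma smooth_cutoff n x : smooth (cutoff n x).
Proof.
have e : cutoff n x = (fun t => smooth_step (n%:R * t - 1) +
    (fun=> -1) t * smooth_step (n%:R * t + (3 - n%:R * x))).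
  by apply/funext => t; rewrite /cutoff mulN1r.
rewrite e => k; apply: smooth_uptoD.
  by apply: (@smooth_upto_affine R k smooth_step); exact: smooth_smooth_step.
apply: smooth_uptoM; first exact: smooth_upto_cst.
by apply: (@smooth_upto_affine R k smooth_step); exact: smooth_smooth_step.
Qed.

Lemma test_function_cutoff (l x : R) n : x <= l -> 4 <= n%:R * x ->
  test_function 0 l (cutoff n x).
Proof.
move=> xl nx; split; first exact: smooth_derivable1n (@smooth_cutoff n x).
have n0 : (0 < n)%N.
  by case: n nx => //; rewrite mul0r; lra.
have nR : (0 : R) < n%:R by rewrite ltr0n.
have nV : 0 < n%:R^-1 :> R by rewrite invr_gt0.
exists n%:R^-1, (x - 2 * n%:R^-1); split=> //; first lra.
move=> t; rewrite in_itv/= negb_and -!ltNge => /orP h; apply: cutoff_eq0 => //.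
case: h => h; [left|right].
  by rewrite -[leRHS](mulfV (lt0r_neq0 nR)) ler_wpM2l// ltW.
rewrite (_ : n%:R * x - 2 = n%:R * (x - 2 * n%:R^-1)); last by field; rewrite gt_eqF.
by rewrite ler_wpM2l// ltW.
Qed.

(** Testing with the cutoffs, which converge to the indicator of ]0, x[: their
    derivatives concentrate at 0 and at x, with masses 1 and - 1. *)
Lemma weak_derivative_FTC (l x : R) (g h : R -> R) : 0 < x -> x <= l ->
  continuous g -> mu.-integrable `]0, l[ (EFin \o h) -> weak_derivative l g h ->
  g x - g 0 = \int[mu]_(t in `]0, x[) h t.
Proof.
move=> x0 xl cg hi gh.
have mI (a : R) : measurable (`]0, a[ : set R) by exact: measurable_itv.
have nbig (b : R) : \forall n \near \oo, b <= n%:R * x.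
  near=> n; rewrite -ler_pdivrMr//; near: n; exact: nbhs_infty_ger.
have c1 : \int[mu]_(t in `]0, l[) (h t * cutoff n x t) @[n --> \oo] -->
    \int[mu]_(t in `]0, x[) h t.
  have -> : \int[mu]_(t in `]0, x[) h t = \int[mu]_(t in `]0, l[) (h t * \1_`]0, x[ t).
    rewrite (_ : `]0, x[%classic = `]0, l[ `&` `]0, x[%classic) ?Rintegral_mkcondr.
      apply: eq_Rintegral => t _; rewrite patchE indicE mem_setE.
      rewrite (_ : (t \in (`]0, l[ `&` `]0, x[)%classic) = (t \in `]0, x[)).
        by case: ifP; rewrite ?mulr1 ?mulr0.
      apply/idP/idP => [/set_mem[]//|tx]; apply/mem_set; split => //=.
      by move: tx; rewrite !in_itv/= => /andP[-> /lt_le_trans]; exact.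
    apply/seteqP; split=> t /= => [|[]//]; rewrite !in_itv/= => /andP[t0 tx].
    by rewrite t0 tx (lt_le_trans tx xl).
  apply: (@leb_Rint_dct R _ _ _ (fun t => `|h t|)) => //.
  - move=> n; apply: measurable_funM; first exact: leb_measurable.
    apply: measurable_fun_onT; apply: continuous_measurable_fun => t.
    have [f' df _] := smooth_cutoff n x 1; exact: is_derive_continuous (df t).
  - by apply: measurable_funM; [exact: leb_measurable|exact: measurable_indic].
  - apply: aeW => t /=; rewrite in_itv/= => /andP[t0 tl].
    apply: cvgMr.
    have [tx|xt] := ltP t x.
      rewrite indicE mem_set/=; last by rewrite in_itv/= t0.
      apply: cvg_near_cst; near=> n; apply: cutoff_eq1.
        by rewrite -ler_pdivrMr//; near: n; exact: nbhs_infty_ger.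
      have xt0 : 0 < x - t by rewrite subr_gt0.
      suff : 3 <= n%:R * (x - t) by rewrite mulrBr; lra.
      by rewrite -ler_pdivrMr//; near: n; exact: nbhs_infty_ger.
    rewrite indicE memNset/=; last by rewrite in_itv/= t0/= ltNge xt.
    apply: cvg_near_cst; near=> n; apply: cutoff_eq0; first by near: n; exact: nbig.
    by right; have := ler_wpM2l (ler0n R n) xt; lra.
  - exact: leb_integrable_norm.
  - by move=> n t _; rewrite normrM ler_piMr// cutoff_le1.
have c2 : \int[mu]_(t in `]0, l[) (g t * derive1 (cutoff n x) t) @[n --> \oo] -->
    g 0 - g x.
  apply/cvgrPdist_le => e e0.
  have e2 : 0 < e / 2 by rewrite divr_gt0.
  have /cvgrPdist_le/(_ _ e2) /nbhs_ballP[d0 /= d00 g0] := cg 0.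
  have /cvgrPdist_le/(_ _ e2) /nbhs_ballP[d1 /= d10 g1] := cg x.
  near=> n.
  have nx : 4 <= n%:R * x by near: n; exact: nbig.
  have n0 : (0 < n)%N by near: n; exact: nbhs_infty_gt.
  have nR : (0 : R) < n%:R by rewrite ltr0n.
  have nV : 0 < n%:R^-1 :> R by rewrite invr_gt0.
  have xn : 4 * n%:R^-1 <= x.
    by rewrite -ler_pdivlMr ?invr_gt0// invrK mulrC.
  pose s (c t : R) : R := n%:R * step_slope (n%:R * (t - c)).
  have ci (c : R) : mu.-integrable `]0, l[ (EFin \o (fun t => g t * s c t)).
    apply: (@leb_integrableS R `[0, l]); [exact: measurable_itv|exact: measurable_itv| |].
      by apply: subset_itvW; rewrite bnd_simp.
    apply: continuous_compact_integrable; first exact: segment_compact.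
    apply: continuous_subspaceT => t; apply: cvgM; first exact: cg.
    apply: cvgMr.
    have hh : n%:R * (x - c) @[x --> t] --> n%:R * (t - c).
      by apply: cvgMr; apply: cvgB; [exact: cvg_id|exact: cvg_cst].
    exact: (@continuous_comp R R R (fun x => n%:R * (x - c)) step_slope t hh (@continuous_step_slope R _)).
  have -> : \int[mu]_(t in `]0, l[) (g t * derive1 (cutoff n x) t) =
     \int[mu]_(t in `]0, l[) (g t * s n%:R^-1 t) -
     \int[mu]_(t in `]0, l[) (g t * s (x - 3 * n%:R^-1) t).
    rewrite -leb_RintB//; apply: leb_eq_Rint => t _; rewrite -mulrBr derive1E.
    by have := is_derive_cutoff x t n0 => hd; congr (_ * _); exact: derive_val.
  have I0 : `|\int[mu]_(t in `]0, l[) (g t * s n%:R^-1 t) - g 0| <= e / 2.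
    apply: (@step_slope_average l n%:R^-1 0 d0) => //; try lra.
      rewrite subr0 gtr0_norm//; suff : n%:R^-1 < d0 / 2 by lra.
      rewrite -[ltRHS]invrK ltf_pV2 ?posrE ?invr_gt0 ?divr_gt0//.
      by near: n; exact: nbhs_infty_gtr.
    by move=> t td; rewrite distrC; apply: g0; rewrite /ball/= distrC.
  have I1 : `|\int[mu]_(t in `]0, l[) (g t * s (x - 3 * n%:R^-1) t) - g x| <= e / 2.
    apply: (@step_slope_average l (x - 3 * n%:R^-1) x d1) => //; try lra.
      rewrite addrAC subrr sub0r normrN gtr0_norm ?mulr_gt0//.
      suff : n%:R^-1 < d1 / 4 by lra.
      rewrite -[ltRHS]invrK ltf_pV2 ?posrE ?invr_gt0 ?divr_gt0//.
      by near: n; exact: nbhs_infty_gtr.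
    by move=> t td; rewrite distrC; apply: g1; rewrite /ball/= distrC.
  exact: normr_sub_sub_le I0 I1.
have c3 : (- \int[mu]_(t in `]0, l[) (h t * cutoff n x t)) @[n --> \oo] --> g 0 - g x.
  apply: cvg_trans c2; apply: near_eq_cvg; near=> n.
  by apply: gh; apply: test_function_cutoff => //; near: n; exact: nbig.
have E : g 0 - g x = - \int[mu]_(t in `]0, x[) h t.
  exact: (cvg_unique (@Rhausdorff R) c3 (cvgN c1)).
by rewrite -[RHS]opprK -E opprB.
Unshelve. all: by end_near. Qed.

End weak_derivatives.

(** * The Laplace transform of a Caputo derivative *)

Section fractional_kernel.
Context {R : realType}.
Local Notation mu := (@lebesgue_measure R).
Let mP : measurable (`]0, +oo[ : set R). Proof. exact: measurable_itv. Qed.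
Let mI (a b : R) : measurable (`]a, b[ : set R). Proof. exact: measurable_itv. Qed.

Definition scaler (s : R) : measurableTypeR R -> measurableTypeR R :=
  fun x => s * x.

Lemma measurable_scaler s : measurable_fun setT (scaler s).
Proof. by apply: measurable_funM => //; exact: measurable_id. Qed.

(** Named so that its structure of measure is found when it is scaled. *)
Let image (s : R) : {measure set (measurableTypeR R) -> \bar R} :=
  measure_function_pushforward__canonical__measure_function_Measure mu
    (measurable_scaler s).

Let lebesgue_measure_scale (s : {nonneg R}) (A : set R) : 0 < s%:num -> measurable A ->
  mscale s (image s%:num) A = mu A.
Proof.
move=> s0 mA; apply/esym/lebesgue_measure_unique => //= _ [[a b]] _ <-.
rewrite /mscale /= /pushforward.
rewrite (_ : _ @^-1` _ = `]s%:num^-1 * a, s%:num^-1 * b]%classic); last first.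
  apply/seteqP; split=> x /=; rewrite !in_itv/= ![s%:num^-1 * _]mulrC ltr_pdivrMr// ler_pdivlMr//;
  by rewrite ![_ * s%:num]mulrC.
rewrite !lebesgue_measure_itv/= !lte_fin ltr_pM2l ?invr_gt0//; case: ifP => _; last by rewrite mule0.
rewrite -!EFinB -EFinM; congr EFin.
by rewrite -mulrBr mulrA mulfV ?mul1r// gt_eqF.
Qed.

Let ge0_integral_scale (s : R) (f : R -> R) : 0 < s -> measurable_fun [set: R] f ->
  (forall x, 0 <= f x) ->
  ((\int[mu]_x (f x)%:E) = s%:E * \int[mu]_x (f (s * x))%:E)%E.
Proof.
move=> s0 mf f0; pose s' := NngNum (ltW s0).
have mE : measurable_fun [set: R] (EFin \o f) by exact/measurable_EFinP.
transitivity (\int[mscale s' (image s)]_x (f x)%:E)%E.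
  by apply: eq_measure_integral => //= A mA _; apply/esym; exact/(@lebesgue_measure_scale s').
rewrite ge0_integral_mscale//=; last by move=> x _; rewrite lee_fin.
congr (_ * _)%E.
have := @ge0_integral_pushforward _ _ (measurableTypeR R) (measurableTypeR R) R
  (scaler s) (measurable_scaler s) mu setT (EFin \o f) measurableT mE.
by rewrite preimage_setT; apply => x _; rewrite lee_fin.
Qed.

Lemma Rint_scale (s : R) (f : R -> R) : 0 < s -> measurable_fun [set: R] f ->
  (forall x, 0 <= f x) -> s * \int[mu]_x f (s * x) = \int[mu]_x f x.
Proof.
move=> s0 mf f0; rewrite /Rintegral (ge0_integral_scale s0 mf f0).
case: (\int[mu]_x _)%E => [r| |] //=.
- by rewrite mulr0 gt0_muley ?lte_fin.
- by rewrite mulr0 gt0_muleNy ?lte_fin.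
Qed.

Context (alpha : R) (alpha0 : 0 < alpha) (alpha1 : alpha < 1).

Lemma powR_le1 (x : R) : 0 < x -> x <= 1 -> x `^ alpha <= 1.
Proof.
move=> x0 x1; rewrite (_ : 1 = 1 `^ alpha); last by rewrite powR1.
by apply: ge0_ler_powR => //; rewrite ?nnegrE ltW.
Qed.

Lemma powR_ge1 (x : R) : 1 <= x -> 1 <= x `^ alpha.
Proof.
move=> x1; rewrite (_ : 1 = 1 `^ alpha); last by rewrite powR1.
by apply: ge0_ler_powR => //; rewrite ?nnegrE ?(ltW alpha0)// (le_trans ler01 x1).
Qed.

Lemma powRN_ge1 (x : R) : 0 < x -> x <= 1 -> 1 <= x `^ (- alpha).
Proof.
move=> x0 x1; rewrite powRN -[leLHS]invr1 lef_pV2 ?posrE ?powR_gt0//.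
exact: powR_le1.
Qed.

Lemma powRN_le (x y : R) : 0 < x -> x <= y -> y `^ (- alpha) <= x `^ (- alpha).
Proof.
move=> x0 xy; have y0 := lt_le_trans x0 xy.
rewrite !powRN lef_pV2 ?posrE ?powR_gt0//.
by apply: ge0_ler_powR => //; rewrite ?nnegrE ltW.
Qed.

(** By monotone convergence from [1/n, 1], where x^(1 - alpha) / (1 - alpha) is
    a primitive. *)
Lemma integrable_powRN : mu.-integrable `]0, 1] (EFin \o (fun x => x `^ (- alpha))).
Proof.
have b0 : 0 < 1 - alpha by rewrite subr_gt0.
apply/integrableP; split.
  by apply/measurable_EFinP; apply: measurable_fun_onT; exact: measurable_powR.
under eq_integral do rewrite /= ger0_norm ?powR_ge0//.
pose F (n : nat) : set R := `[n.+2%:R^-1, 1]%classic.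
have -> : (`]0, 1]%classic : set R) = \bigcup_i F i.
  apply/seteqP; split=> x /=; last first.
    move=> [n _]; rewrite /F /= !in_itv/= => /andP[nx ->]; rewrite andbT.
    by apply: lt_le_trans nx; rewrite invr_gt0.
  rewrite in_itv/= => /andP[x0 x1].
  have [n xn] : exists n : nat, x^-1 < n%:R.
    by exists (Num.bound x^-1); apply: archi_boundP; rewrite invr_ge0 ltW.
  exists n => //; rewrite /F /= in_itv/= x1 andbT.
  rewrite -[leRHS]invrK lef_pV2 ?posrE ?invr_gt0//; apply: (le_trans (ltW xn)).
  by rewrite ler_nat (leq_trans (leqnSn _)).
have cv := @ge0_nondecreasing_set_cvg_integral _ (measurableTypeR R) R F (fun x => (x `^ (- alpha))%:E) mu.
have nd : nondecreasing_seq F.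
  move=> m n mn; rewrite subsetEset => x; rewrite /F /= !in_itv/= => /andP[mx ->].
  by rewrite andbT (le_trans _ mx)// lef_pV2 ?posrE// ler_nat.
have {}cv := cv nd (fun=> measurable_itv _).
have mF n : measurable_fun (F n) (fun x => (x `^ (- alpha))%:E).
  by apply/measurable_EFinP; apply: measurable_fun_onT; exact: measurable_powR.
have {}cv := cv mF (fun n x _ => _).
apply: (@le_lt_trans _ _ ((1 - alpha)^-1)%:E); last by rewrite ltry.
rewrite -(cvg_lim _ (cv _))//; last by move=> *; rewrite lee_fin powR_ge0.
apply: lime_le; first by apply: cvgP (cv _) => *; rewrite lee_fin powR_ge0.
apply: nearW => n.
have n1 : (n.+2%:R^-1 : R) < 1 by rewrite invf_lt1// ltr1n.
have dG (x : R) : 0 < x -> is_derive x 1 (fun y => (1 - alpha)^-1 * y `^ (1 - alpha)) (x `^ (- alpha)).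
  move=> x0; have := is_derive1_powR (1 - alpha) x0 => h.
  apply: (is_derive_eq (is_deriveZ (1 - alpha)^-1 h)).
  by rewrite /GRing.scale/= mulrA mulVf ?mul1r ?gt_eqF//; congr (_ `^ _); ring.
rewrite (@continuous_FTC2 R _ (fun y => (1 - alpha)^-1 * y `^ (1 - alpha)))//.
- rewrite -EFinB lee_fin powR1 mulr1 gerBl mulr_ge0 ?powR_ge0// invr_ge0 ltW//.
- apply: continuous_in_subspaceT => x; rewrite inE/= in_itv/= => /andP[nx _].
  have x0 : 0 < x by apply: lt_le_trans nx; rewrite invr_gt0.
  by have := is_derive1_powR (- alpha) x0; exact: is_derive_continuous.
- split.
  + move=> x; rewrite in_itv/= => /andP[nx _].
    by have [] := dG x (lt_trans _ nx); rewrite ?invr_gt0.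
  + apply: cvg_at_right_filter; apply: is_derive_continuous (dG _ _).
    by rewrite invr_gt0.
  + by apply: cvg_at_left_filter; exact: is_derive_continuous (dG _ _).
- move=> x; rewrite in_itv/= => /andP[nx _].
  by rewrite derive1E; have [] := dG x (lt_trans _ nx); rewrite ?invr_gt0.
Qed.

(** The kernel of the Caputo derivative, damped by e^(-s x) and extended by 0:
    convolutions with it are integrals over a fixed interval. *)
Definition frac_kernel (s x : R) : R :=
  ((fun y => y `^ (- alpha) * expR (- s * y)) \_ `]0, +oo[) x.

Lemma frac_kernelE s x : 0 < x -> frac_kernel s x = x `^ (- alpha) * expR (- s * x).
Proof. by move=> x0; rewrite /frac_kernel patchE mem_set//= in_itv/= x0. Qed.

Lemma frac_kernel0 s x : x <= 0 -> frac_kernel s x = 0.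
Proof. by move=> x0; rewrite /frac_kernel patchE memNset//= in_itv/= andbT ltNge x0. Qed.

Lemma frac_kernel_ge0 s x : 0 <= frac_kernel s x.
Proof.
have [x0|x0] := leP x 0; first by rewrite frac_kernel0.
by rewrite frac_kernelE// mulr_ge0 ?powR_ge0 ?expR_ge0.
Qed.

Lemma measurable_frac_kernel s : measurable_fun setT (frac_kernel s).
Proof.
apply: (measurable_restrictT _ mP).1; apply: measurable_fun_onT.
by have mp := @measurable_powR R (- alpha); mfun.
Qed.

Lemma integrable_frac_kernel s : 1 <= s -> mu.-integrable setT (EFin \o frac_kernel s).
Proof.
move=> s1.
have m01 : measurable (`]0, 1] : set R) by exact: measurable_itv.
have i1 := (leb_integrable_patch (fun x => x `^ (- alpha)) m01).1 integrable_powRN.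
have i2 := (leb_integrable_patch (fun x => expR (- 1 * x)) mP).1 (integrable_expR ltr01).
apply: (leb_integrable_le measurableT (@measurable_frac_kernel s) (leb_integrableD measurableT i1 i2)) => x _.
rewrite ger0_norm ?frac_kernel_ge0//.
have [x0|x0] := leP x 0.
  by rewrite frac_kernel0// !patchE !memNset ?addr0//= in_itv/= ?andbT ltNge x0.
rewrite frac_kernelE//.
have -> : ((fun x => expR (- 1 * x)) \_ `]0, +oo[) x = expR (- 1 * x).
  by rewrite patchE mem_set//= in_itv/= x0.
have es : expR (- s * x) <= expR (- 1 * x).
  by rewrite ler_expR ler_wpM2r ?lerN2// ltW.
have e1 : expR (- s * x) <= 1.
  by rewrite -expR0 ler_expR mulNr oppr_le0 mulr_ge0 ?(ltW x0)// (le_trans _ s1).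
have [x1|x1] := leP x 1.
  rewrite patchE mem_set/=; last by rewrite in_itv/= x0.
  apply: ler_wpDr; first exact: expR_ge0.
  by rewrite ler_piMr ?powR_ge0.
rewrite patchE memNset/= ?add0r; last by rewrite in_itv/= x0/= leNgt x1.
apply: (@le_trans _ _ (1 * expR (- s * x))); last by rewrite mul1r.
rewrite ler_wpM2r ?expR_ge0//.
by rewrite powRN invf_le1 ?powR_gt0// powR_ge1// ltW.
Qed.

Lemma Gamma_frac : Gamma (1 - alpha) = \int[mu]_x frac_kernel 1 x.
Proof.
rewrite /Gamma /frac_kernel Rintegral_mkcond; apply: leb_eq_Rint => x _.
rewrite !patchE; case: ifP => // _.
by rewrite mulN1r (_ : 1 - alpha - 1 = - alpha)//; ring.
Qed.

Lemma Gamma_gt0 : 0 < Gamma (1 - alpha).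
Proof.
rewrite Gamma_frac.
have m01 : measurable (`]0, 1] : set R) by exact: measurable_itv.
apply: (@lt_le_trans _ _ (\int[mu]_(x in `]0, 1]) expR (-1))).
  rewrite (@Rintegral_cst _ _ _ mu)//.
  have H : mu `]0, 1] = 1%:E by rewrite lebesgue_measure_itv/= lte_fin ltr01 -EFinB subr0.
  by rewrite [X in fine X]H mulr1 expR_gt0.
have i1 := integrable_frac_kernel (lexx 1).
apply: (@le_trans _ _ (\int[mu]_(x in `]0, 1]) frac_kernel 1 x)).
  apply: leb_le_Rint => //.
  - by apply: leb_integrable_cst => //; exact: leb_itv_lty.
  - exact: (leb_integrableS measurableT m01 _ i1).
  - move=> x /=; rewrite in_itv/= => /andP[x0 x1]; rewrite frac_kernelE//.
    rewrite -[leLHS]mul1r; apply: ler_pM => //; first exact: powRN_ge1.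
    by rewrite ler_expR; lra.
by apply: leb_subset_Rint_le => // x _; exact: frac_kernel_ge0.
Qed.

(** The substitution x |-> s x in the Gamma integral. *)
Lemma Rint_frac_kernel s : 1 <= s ->
  \int[mu]_x frac_kernel s x = s `^ (alpha - 1) * Gamma (1 - alpha).
Proof.
move=> s1; have s0 : 0 < s by exact: lt_le_trans s1.
rewrite Gamma_frac -(Rint_scale s0 (@measurable_frac_kernel 1) (@frac_kernel_ge0 1)).
rewrite mulrA.
have -> : s `^ (alpha - 1) * s = s `^ alpha.
  by rewrite mulrC mulr_powRB1 ?ltW.
have p0 : s `^ alpha != 0 by rewrite gt_eqF ?powR_gt0.
have e x : frac_kernel 1 (s * x) = s `^ (- alpha) * frac_kernel s x.
  have [x0|x0] := leP x 0.
    by rewrite !frac_kernel0 ?mulr0// mulr_ge0_le0// ltW.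
  rewrite !frac_kernelE ?mulr_gt0// powRM ?ltW// mulrA; congr (_ * expR _); ring.
have si := integrable_frac_kernel s1.
rewrite [X in _ * X](@leb_eq_Rint _ _ _ (fun x => s `^ (- alpha) * frac_kernel s x))//.
by rewrite leb_RintZl// mulrA powRN mulfV// mul1r.
Qed.

(** The part of the integral beyond T is compared with the whole integral after
    a shift by T - z: the exponential gains e^(-s (T - z)) and the power
    decreases. *)
Lemma frac_kernel_truncated s T z : 1 <= s -> 0 <= z -> z <= T ->
  let G := \int[mu]_x frac_kernel s x in
  let I := \int[mu]_(t in `]0, T[) frac_kernel s (t - z) in
  0 <= G - I <= expR (- s * (T - z)) * G.
Proof.
move=> s1 z0 zT /=; set G := Rintegral _ _ _; set I := Rintegral _ _ _; have s0 : 0 <= s by exact: le_trans s1.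
have mf := @measurable_frac_kernel s.
have fi := integrable_frac_kernel s1.
have sh (c : R) : \int[mu]_t frac_kernel s (t - c) = G by exact: (Rint_shift (- c)).
have si (c : R) : mu.-integrable setT (EFin \o (fun t => frac_kernel s (t - c))).
  have mc : measurable_fun [set: R] (fun t => frac_kernel s (t - c)) by mfun.
  apply/integrableP; split; first exact/measurable_EFinP.
  have /integrableP[_] := fi; apply: le_lt_trans; rewrite le_eqVlt; apply/orP; left; apply/eqP.
  apply: (@ge0_integral_shift R (- c) (fun t => `|(frac_kernel s t)%:E|)%E) => //.
  by apply: measurableT_comp => //; exact/measurable_EFinP.
have m1 : measurable (`]0, T] : set R) by exact: measurable_itv.
have IE : I = \int[mu]_t ((fun t => frac_kernel s (t - z)) \_ `]0, T]) t.
  rewrite -Rintegral_mkcond; congr fine; apply: integral_itv_bndo_bndc.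
  by apply/measurable_EFinP; apply: measurable_fun_onT; mfun.
have pi := (leb_integrable_patch (fun t => frac_kernel s (t - z)) m1).1 (leb_integrableS measurableT m1 (@subsetT _ _) (si z)).
rewrite IE -{1 2}(sh z) -(leb_RintB measurableT (si z) pi) -(sh T) -leb_RintZl//; apply/andP; split.
  apply: Rintegral_ge0 => t _; rewrite patchE; case: ifP => _; rewrite ?subrr ?subr0//.
  exact: frac_kernel_ge0.
apply: leb_le_Rint => //; first exact: leb_integrableB; first exact: leb_integrableZl.
move=> t _; rewrite patchE mem_setE in_itv/=.
have e0 : 0 <= expR (- s * (T - z)) * frac_kernel s (t - T).
  by rewrite mulr_ge0 ?expR_ge0 ?frac_kernel_ge0.
have [t0|t0] := leP t 0; first by rewrite /= subr0 frac_kernel0//; lra.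
have [tT|tT] := leP t T; first by rewrite /= subrr.
rewrite /= subr0 !frac_kernelE ?subr_gt0 ?(le_lt_trans zT)//.
rewrite mulrCA -expRD.
rewrite (_ : - s * (T - z) + - s * (t - T) = - s * (t - z)); last by ring.
by rewrite ler_wpM2r ?expR_ge0// powRN_le ?subr_gt0// lerD2l lerN2.
Qed.

Context (T : R) (T0 : 0 < T) (w : R -> R) (wi : mu.-integrable `]0, T[ (EFin \o w)).
Let w0 : R -> R := w \_ `]0, T[.

Let mw0 : measurable_fun setT w0.
Proof. by have /(measurable_restrictT _ (mI 0 T)).1 := leb_measurable wi. Qed.

Let w0E t : 0 < t -> t < T -> w0 t = w t.
Proof. by move=> t1 t2; rewrite /w0 patchE mem_set//= in_itv/= t1. Qed.

Let subint (f : R -> R -> R) t : t < T ->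
  \int[mu]_(z in `]0, t[) f t z =
  \int[mu]_(z in `]0, T[) ((fun z => f t z) \_ `]-oo, t[) z.
Proof.
move=> tT; rewrite -Rintegral_mkcondr; congr (Rintegral _ _ _).
apply/seteqP; split=> z /=; rewrite !in_itv/=.
  by move=> /andP[-> zt]; rewrite zt (lt_trans zt tT).
by move=> [/andP[-> _] ->].
Qed.

(** The integral over a fixed interval, for Fubini: the kernel vanishes on the
    negative axis. *)
Lemma caputoE t : 0 < t -> t < T ->
  caputo alpha w t = (Gamma (1 - alpha))^-1 *
    \int[mu]_(z in `]0, T[) (frac_kernel 0 (t - z) * w0 z).
Proof.
move=> t0 tT; rewrite /caputo (@subint (fun t z => (t - z) `^ (- alpha) * w z))//.
congr (_ * _); apply: leb_eq_Rint => z /=; rewrite in_itv/= => /andP[z0 zT].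
rewrite patchE mem_setE in_itv/=; have [zt|tz] := ltP z t.
  by rewrite frac_kernelE ?subr_gt0// w0E// oppr0 mul0r expR0 mulr1.
by rewrite frac_kernel0 ?subr_le0// mul0r.
Qed.

Lemma measurable_caputo : measurable_fun (`]0, T[ : set R) (caputo alpha w).
Proof.
have mk := @measurable_frac_kernel 0.
have h : measurable_fun setT (fun t : R => (Gamma (1 - alpha))^-1 *
    \int[mu]_(z in `]0, T[) (frac_kernel 0 (t - z) * w0 z)).
  apply: measurable_funM => //.
  by apply: (leb_measurable_Rint (f := fun t z : R => frac_kernel 0 (t - z) * w0 z)) => //; mfun.
apply: (eq_measurable_fun _ _ (measurable_fun_onT h)) => t /set_mem /=.
by rewrite in_itv/= => /andP[t0 tT]; rewrite caputoE.
Qed.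

(** By Fubini the transform is the integral of e^(-sz) w(z) against the mass of
    the damped kernel on ]0, T - z[, which frac_kernel_truncated compares with
    the complete Gamma integral. *)
Lemma laplace_caputo s : 1 <= s ->
  `|\int[mu]_(t in `]0, T[) (expR (- s * t) * caputo alpha w t) -
    s `^ (alpha - 1) * \int[mu]_(t in `]0, T[) (expR (- s * t) * w t)| <=
  s `^ (alpha - 1) * expR (- s * T) * \int[mu]_(t in `]0, T[) `|w t|.
Proof.
move=> s1; have s0 : 0 <= s by exact: le_trans s1.
pose G := \int[mu]_x frac_kernel s x.
have GE : G = s `^ (alpha - 1) * Gamma (1 - alpha) by exact: Rint_frac_kernel.
have Gp := Gamma_gt0.
have G0 : 0 <= G by apply: Rintegral_ge0 => x _; exact: frac_kernel_ge0.
have mf := @measurable_frac_kernel s.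
(* e^(-s t) times the Caputo integrand, with e^(-s t) = e^(-s z) e^(-s (t - z)) *)
pose F (z t : R) := w0 z * (expR (- s * z) * frac_kernel s (t - z)).
have fsi (z : R) : mu.-integrable `]0, T[ (EFin \o (fun t => frac_kernel s (t - z))).
  apply: (@leb_integrableS R setT) => //.
  have mc : measurable_fun [set: R] (fun t => frac_kernel s (t - z)) by mfun.
  apply/integrableP; split; first exact/measurable_EFinP.
  have /integrableP[_] := integrable_frac_kernel s1; apply: le_lt_trans; rewrite le_eqVlt; apply/orP; left; apply/eqP.
  apply: (@ge0_integral_shift R (- z) (fun t => `|(frac_kernel s t)%:E|)%E) => //.
  by apply: measurableT_comp => //; exact/measurable_EFinP.
have wn : mu.-integrable `]0, T[ (EFin \o (fun z => `|w z| * G)).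
  apply: (leb_eq_integrable (mI 0 T) (leb_integrableZl G (mI 0 T) (leb_integrable_norm wi))) => z _; exact: mulrC.
have Fi : (mu \x mu)%E.-integrable (`]0, T[ `*` `]0, T[) (EFin \o (fun x => F x.1 x.2)).
  apply: (leb_integrable_rect (f := F) (mI 0 T) (mI 0 T) _ wn); first by apply: measurable_fun_onT; rewrite /F; mfun.
  apply: aeW => z /=; rewrite in_itv/= => /andP[z0 zT]; split.
    by do 2 apply: leb_integrableZl => //.
  rewrite (@leb_eq_Rint _ _ _ (fun t => (`|w z| * expR (- s * z)) * frac_kernel s (t - z))); last first.
    move=> t _; rewrite /F w0E// !normrM [`|expR _|]ger0_norm ?expR_ge0//.
    by rewrite [`|frac_kernel _ _|]ger0_norm ?frac_kernel_ge0// mulrA.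
  rewrite leb_RintZl// -mulrA ler_wpM2l//.
  have /andP[h1 h2] := frac_kernel_truncated s1 (ltW z0) (ltW zT).
  have e1 : expR (- s * z) <= 1.
    by rewrite -expR0 ler_expR mulNr oppr_le0 mulr_ge0// ltW.
  apply: (@le_trans _ _ (1 * G)); last by rewrite mul1r.
  have I0 : 0 <= \int[mu]_(t in `]0, T[) frac_kernel s (t - z).
    by apply: Rintegral_ge0 => t _; exact: frac_kernel_ge0.
  by apply: (ler_pM (expR_ge0 _) I0 e1); rewrite -subr_ge0.
have E : \int[mu]_(t in `]0, T[) (expR (- s * t) * caputo alpha w t) =
   (Gamma (1 - alpha))^-1 * \int[mu]_(z in `]0, T[)
      (w0 z * expR (- s * z) * \int[mu]_(t in `]0, T[) frac_kernel s (t - z)).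
  transitivity ((Gamma (1 - alpha))^-1 * \int[mu]_(t in `]0, T[) \int[mu]_(z in `]0, T[) F z t).
    rewrite -leb_RintZl//; last exact: (leb_integrable_Rint2 (f := F)).
    have mF : measurable_fun setT (fun t : R => \int[mu]_(z in `]0, T[) F z t).
      apply: (leb_measurable_Rint (f := fun t z : R => F z t)) => //; rewrite /F; mfun.
    apply: leb_ae_eq_Rint => //.
    - apply: measurable_funM; last exact: measurable_caputo.
      by apply: measurable_fun_onT; mfun.
    - by apply: measurable_fun_onT; mfun.
    - apply: (leb_ae_imp (leb_integrable_section2 (f := F) (mI 0 T) (mI 0 T) Fi)) => t ti /[dup] tD /=.
      rewrite in_itv/= => /andP[t0 tT]; rewrite caputoE// mulrCA; congr (_ * _).
      have e (z : R) : F z t = expR (- s * t) * (frac_kernel 0 (t - z) * w0 z).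
        rewrite /F; have [zt|tz] := ltP z t; last first.
          by rewrite !frac_kernel0 ?subr_le0// !(mulr0, mul0r).
        rewrite !frac_kernelE ?subr_gt0// oppr0 mul0r expR0 mulr1.
        rewrite (_ : - s * t = - s * z + - s * (t - z)) ?expRD; last by ring.
        by ring.
      rewrite -leb_RintZl//; first by apply: leb_eq_Rint => z _; rewrite e.
      apply: (leb_eq_integrable (mI 0 T) (leb_integrableZl (expR (s * t)) (mI 0 T) (ti tD))) => z _ /=.
      rewrite e mulrA -expRD mulNr subrr expR0 mul1r//.
  congr (_ * _); rewrite -(leb_fubini (f := F))//.
  by apply: leb_eq_Rint => z _; rewrite -leb_RintZl//; apply: leb_eq_Rint => t _; rewrite /F mulrA.
have i1 : mu.-integrable `]0, T[ (EFin \o (fun z => w0 z * expR (- s * z) *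
     \int[mu]_(t in `]0, T[) frac_kernel s (t - z))).
  apply: (leb_eq_integrable (mI 0 T) (leb_integrable_Rint1 (f := F) (mI 0 T) (mI 0 T) Fi)) => z _.
  by rewrite -leb_RintZl//; apply: leb_eq_Rint => t _; rewrite /F mulrA.
have i2 : mu.-integrable `]0, T[ (EFin \o (fun z => expR (- s * z) * w z)).
  apply: (@leb_integrableMb _ _ _ _ 1) => //; first by apply: measurable_fun_onT; mfun.
  move=> z /=; rewrite in_itv/= => /andP[z0 _].
  by rewrite ger0_norm ?expR_ge0// -expR0 ler_expR mulNr oppr_le0 mulr_ge0// ltW.
have -> : s `^ (alpha - 1) = (Gamma (1 - alpha))^-1 * G.
  by rewrite GE mulrCA mulVf ?mulr1// gt_eqF.
rewrite E -!mulrA -mulrBr normrM ger0_norm ?invr_ge0 ?(ltW Gp)//.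
apply: ler_wpM2l; first by rewrite invr_ge0 ltW.
rewrite mulrA -!leb_RintZl//; last exact: leb_integrable_norm.
rewrite -leb_RintB//; last exact: leb_integrableZl.
apply: leb_normr_le => //.
- exact: leb_measurable (leb_integrableB _ i1 (leb_integrableZl _ _ i2)).
- by apply: leb_integrableZl => //; exact: leb_integrable_norm.
- move=> z /=; rewrite in_itv/= => /andP[z0 zT]; rewrite w0E//.
  rewrite (_ : _ - _ = w z * (expR (- s * z) *
     (\int[mu]_(t in `]0, T[) frac_kernel s (t - z) - G))); last by ring.
  have /andP[h1 h2] := frac_kernel_truncated s1 (ltW z0) (ltW zT).
  rewrite normrM mulrC ler_wpM2r// normrM ger0_norm ?expR_ge0// distrC ger0_norm//.
  rewrite (_ : - s * T = - s * z + - s * (T - z)) ?expRD; last by ring.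
  by rewrite [leRHS]mulrC -mulrA ler_wpM2l ?expR_ge0.
Qed.

(** Integration by parts; w being only integrable, it is carried out by
    exchanging the integrals. *)
Lemma laplace_primitive s a : 0 < s ->
  s * \int[mu]_(t in `]0, T[) (expR (- s * t) * (a + \int[mu]_(z in `]0, t[) w z)) =
  a + \int[mu]_(t in `]0, T[) (expR (- s * t) * w t)
  - expR (- s * T) * (a + \int[mu]_(t in `]0, T[) w t).
Proof.
move=> s0.
have mh := @measurable_heaviside R.
have eint (c : R) : 0 <= c -> c <= T ->
   s * \int[mu]_(t in `]0, T[) (expR (- s * t) * heaviside (t - c)) = expR (- s * c) - expR (- s * T).
  move=> c0 cT.
  have dF (x : R) : is_derive x 1 (fun t => - s^-1 * expR (- s * t)) (expR (- s * x)).
    have h := is_derive_expR_scale (- s^-1) (- s) x.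
    by apply: (is_derive_eq h); rewrite mulrA mulrNN mulVf ?mul1r// gt_eqF.
  have mE : measurable_fun [set: R] (fun t => expR (- s * t) * heaviside (t - c)) by mfun.
  have bE : mu.-integrable `[0, T] (EFin \o (fun t => expR (- s * t) * heaviside (t - c))).
    apply: (@leb_integrable_bnd _ _ _ 1); [exact: measurable_itv|exact: leb_itv_lty|exact: measurable_fun_onT|].
    move=> t /=; rewrite in_itv/= => /andP[t0 _].
    rewrite normrM !ger0_norm ?expR_ge0 ?heaviside_ge0// mulr_ile1 ?expR_ge0 ?heaviside_ge0 ?heaviside_le1//.
    by rewrite -expR0 ler_expR mulNr oppr_le0 mulr_ge0// ltW.
  rewrite Rint_oo_cc// (Rint_itv_split mE bE c0 cT).
  rewrite [X in _ * (X + _)](_ : _ = 0) ?add0r; last first.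
    rewrite -(Rint_oo_cc 0 c mE) (@leb_eq_Rint _ _ _ (fun=> 0)).
      by rewrite (@Rintegral_cst _ _ _ mu)// mul0r.
    move=> t /=; rewrite in_itv/= => /andP[_ tc].
    by rewrite /heaviside leNgt subr_lt0 tc mulr0.
  rewrite (@leb_eq_Rint _ _ _ (fun t => expR (- s * t))); last first.
    by move=> t /=; rewrite in_itv/= => /andP[ct _]; rewrite /heaviside subr_ge0 ct mulr1.
  rewrite (Rint_FTC cT dF (@continuous_expR_lin _ (- s))).
  by rewrite !mulNr -mulNr; field; rewrite gt_eqF.
pose F (t z : R) := expR (- s * t) * heaviside (t - z) * w0 z.
have Fi : (mu \x mu)%E.-integrable (`]0, T[ `*` `]0, T[) (EFin \o (fun x => F x.1 x.2)).
  apply: (@leb_integrable_prod R _ _ (fun=> 1) (fun z => `|w z|) F) => //.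
  - by apply: measurable_fun_onT; rewrite /F; mfun.
  - by apply: leb_integrable_cst => //; exact: leb_itv_lty.
  - exact: leb_integrable_norm.
  - move=> t z /=; rewrite !in_itv/= => /andP[t0 tT] /andP[z0 zT].
    rewrite /F w0E// normrM; apply: ler_wpM2r => //.
    rewrite normrM !ger0_norm ?expR_ge0 ?heaviside_ge0// mulr_ile1 ?expR_ge0 ?heaviside_ge0 ?heaviside_le1//.
    by rewrite -expR0 ler_expR mulNr oppr_le0 mulr_ge0// ltW.
have ei : mu.-integrable `]0, T[ (EFin \o (fun t => expR (- s * t))).
  apply: (@leb_integrable_bnd _ _ _ 1) => //; [exact: leb_itv_lty|by apply: measurable_fun_onT; mfun|].
  move=> t /=; rewrite in_itv/= => /andP[t0 _].
  by rewrite ger0_norm ?expR_ge0// -expR0 ler_expR mulNr oppr_le0 mulr_ge0// ltW.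
have ewi : mu.-integrable `]0, T[ (EFin \o (fun t => expR (- s * t) * w t)).
  apply: (@leb_integrableMb _ _ _ _ 1) => //; first by apply: measurable_fun_onT; mfun.
  move=> t /=; rewrite in_itv/= => /andP[t0 _].
  by rewrite ger0_norm ?expR_ge0// -expR0 ler_expR mulNr oppr_le0 mulr_ge0// ltW.
have ae_eq : \int[mu]_(t in `]0, T[) (expR (- s * t) * (a + \int[mu]_(z in `]0, t[) w z)) =
   \int[mu]_(t in `]0, T[) (a * expR (- s * t) + \int[mu]_(z in `]0, T[) F t z).
  apply: leb_eq_Rint => t /=; rewrite in_itv/= => /andP[t0 tT].
  rewrite mulrDr [expR _ * a]mulrC; congr (_ + _).
  rewrite (Rint_lt_heaviside t0 tT wi) (@leb_eq_Rint _ _ _ (fun z => heaviside (t - z) * w0 z)); last first.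
    by move=> z /=; rewrite in_itv/= => /andP[z0 zT]; rewrite w0E.
  rewrite -leb_RintZl//; first by apply: leb_eq_Rint => z _; rewrite /F mulrA.
  apply: (@leb_integrableMb _ _ _ _ 1) => //; first by apply: measurable_fun_onT; mfun.
    by apply: (leb_eq_integrable (mI 0 T) wi) => z /=; rewrite in_itv/= => /andP[z0 zT]; rewrite w0E.
  by move=> z _; rewrite ger0_norm ?heaviside_ge0 ?heaviside_le1.
rewrite ae_eq leb_RintD//; [|exact: leb_integrableZl|exact: (leb_integrable_Rint1 (f := F))].
rewrite leb_RintZl// (leb_fubini (f := F))// mulrDr.
have -> : s * (a * \int[mu]_(t in `]0, T[) expR (- s * t)) = a * (1 - expR (- s * T)).
  rewrite mulrCA; congr (_ * _); have := eint 0 (lexx _) (ltW T0).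
  rewrite mulr0 expR0 => <-; congr (_ * _); apply: leb_eq_Rint => t /=; rewrite in_itv/= => /andP[t0 _].
  by rewrite subr0 /heaviside ltW// mulr1.
have -> : s * \int[mu]_(z in `]0, T[) \int[mu]_(t in `]0, T[) F t z =
    \int[mu]_(z in `]0, T[) (expR (- s * z) * w z - expR (- s * T) * w z).
  rewrite -leb_RintZl//; last exact: (leb_integrable_Rint2 (f := F)).
  apply: leb_eq_Rint => z /=; rewrite in_itv/= => /andP[z0 zT].
  rewrite -mulrBl -(eint z (ltW z0) (ltW zT)) -mulrA; congr (_ * _).
  rewrite [RHS]mulrC -leb_RintZl//; last first.
    apply: (@leb_integrable_bnd _ _ _ 1) => //; [exact: leb_itv_lty|by apply: measurable_fun_onT; mfun|].
    move=> t /=; rewrite in_itv/= => /andP[t0 _].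
    rewrite normrM !ger0_norm ?expR_ge0 ?heaviside_ge0// mulr_ile1 ?expR_ge0 ?heaviside_ge0 ?heaviside_le1//.
    by rewrite -expR0 ler_expR mulNr oppr_le0 mulr_ge0// ltW.
  by apply: leb_eq_Rint => t _; rewrite /F w0E// mulrC.
rewrite leb_RintB//; last exact: leb_integrableZl.
by rewrite leb_RintZl//; ring.
Qed.

End fractional_kernel.

(** * Mixed norms and product integrability *)

Section mixed_integrability.
Context {R : realType}.
Local Notation mu := (@lebesgue_measure R).
Let mI (a b : R) : measurable (`]a, b[ : set R). Proof. exact: measurable_itv. Qed.

Lemma ae_section1 (P : R -> R -> Prop) :
  {ae (mu \x mu)%E, forall z : R * R, P z.1 z.2} ->
  {ae mu, forall x, {ae mu, forall y, P x y}}.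
Proof.
move=> [N [mN N0 PN]].
have mS : measurable_fun [set: R] (fun x => mu (xsection N x)).
  exact: measurable_fun_xsection.
have h : {ae mu, forall x, [set: R] x -> mu (xsection N x) = 0}.
  apply/(ae_eq_integral_abs mu measurableT mS).
  by rewrite -[RHS]N0; apply: eq_integral => x _; rewrite gee0_abs.
apply: (leb_ae_imp h) => x /(_ Logic.I) Nx0.
exists (xsection N x); split => //; first exact: measurable_xsection.
by move=> y nP; apply/xsectionP; apply: PN => /=.
Qed.

(** The integral of |f - g| over the rectangle vanishes, hence so do the
    integrals over almost all of its sections in either direction. *)
Lemma ae_swap (A B : set R) (f g : R -> R -> R) : measurable A -> measurable B ->
  (mu \x mu)%E.-integrable (A `*` B) (EFin \o (fun z => f z.1 z.2)) ->
  (mu \x mu)%E.-integrable (A `*` B) (EFin \o (fun z => g z.1 z.2)) ->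
  {ae mu, forall y, B y -> {ae mu, forall x, A x -> f x y = g x y}} ->
  {ae mu, forall x, A x -> {ae mu, forall y, B y -> f x y = g x y}}.
Proof.
move=> mA mB fi gi fg; pose h x y := `|f x y - g x y|.
have mAB : measurable (A `*` B) by exact: measurableX.
have hi : (mu \x mu)%E.-integrable (A `*` B) (EFin \o (fun z => h z.1 z.2)).
  apply: (@integrable_norm _ _ _ (mu \x mu)%E (A `*` B) (fun z => f z.1 z.2 - g z.1 z.2)).
  exact: (@integrable_subr _ _ _ (mu \x mu)%E _ (fun z => f z.1 z.2) (fun z => g z.1 z.2)).
have hx := leb_integrable_Rint1 (f := h) mA mB hi.
have I0 : \int[mu]_(x in A) \int[mu]_(y in B) h x y = 0.
  rewrite (leb_fubini (f := h))// (@leb_ae_eq_Rint _ _ _ (fun=> 0)) //.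
  - by rewrite (@Rintegral_cst _ _ _ mu)// mul0r.
  - exact: leb_measurable (leb_integrable_Rint2 (f := h) mA mB hi).
  - apply: (leb_ae_imp2 fg (leb_integrable_section2 (f := h) mA mB hi)) => y fgy hy By.
    rewrite (@leb_ae_eq_Rint _ _ _ (fun=> 0)) //.
    + by rewrite (@Rintegral_cst _ _ _ mu)// mul0r.
    + exact: leb_measurable (hy By).
    + by apply: (leb_ae_imp (fgy By)) => x fgx Ax; rewrite /h fgx// subrr normr0.
have h0 : {ae mu, forall x, A x -> \int[mu]_(y in B) h x y = 0}.
  by apply: (leb_Rint_eq0_ae mA hx); [move=> x _; apply: Rintegral_ge0 => y _; exact: normr_ge0|rewrite I0].
apply: (leb_ae_imp2 h0 (leb_integrable_section1 (f := h) mA mB hi)) => x hx0 hxi Ax.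
have h1 : {ae mu, forall y, B y -> h x y = 0}.
  by apply: (leb_Rint_eq0_ae mB (hxi Ax)) => [y _|]; [exact: normr_ge0|rewrite hx0].
by apply: (leb_ae_imp h1) => y hy By; apply/eqP; rewrite -subr_eq0 -normr_eq0; apply/eqP; exact: hy.
Qed.

(** The norm of the constant 1, which bounds the L^1 norm by the L^2 norm. *)
Definition L2const (l : R) : \bar R := 'N[mu]_2%:E[(EFin \o \1_(`]0, l[ : set R))].

Lemma L2const_lty l : (L2const l < +oo)%E.
Proof.
rewrite /L2const unlock; apply: poweR_lty.
have : mu.-integrable setT (EFin \o \1_(`]0, l[ : set R)).
  apply/(integrable_indic_itv); exact: leb_itv_lty.
move/integrableP => [_]; apply: le_lt_trans; rewrite le_eqVlt; apply/orP; left; apply/eqP.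
apply: eq_integral => x _ /=; congr EFin; rewrite indicE.
by case: (x \in _) => /=; rewrite ?normr1 ?powR1 // normr0 powR0// gt_eqF.
Qed.

Lemma integral_le_L2norm l (f : R -> R) : measurable_fun (`]0, l[ : set R) f ->
  (\int[mu]_(x in `]0%R, l[) `|f x|%:E <= L2norm l f * L2const l)%E.
Proof.
move=> mf.
have mf' := (measurable_restrictT f (mI 0 l)).1 mf.
have mg : measurable_fun [set: R] (\1_(`]0, l[ : set R) : R -> R) by exact: measurable_indic.
have := @hoelder _ _ R mu _ _ 2 2 mf' mg.
rewrite /L2norm /L2const restrict_EFin => H; apply: le_trans (H _ _ _) => //; last lra.
rewrite Lnorm1 [leLHS]integral_mkcond le_eqVlt; apply/orP; left; apply/eqP.
apply: eq_integral => x _ /=; rewrite !patchE indicE.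
by case: ifP => _ /=; rewrite ?mulr1// mul0r normr0.
Qed.

Lemma L2norm_integrable l (f : R -> R) : measurable_fun (`]0, l[ : set R) f ->
  (L2norm l f < +oo)%E -> mu.-integrable `]0, l[ (EFin \o f).
Proof.
move=> mf fl; apply/integrableP; split; first exact/measurable_EFinP.
apply: le_lt_trans (integral_le_L2norm mf) _.
by apply: lte_mul_pinfty; rewrite ?Lnorm_ge0// ?L2const_lty// ge0_fin_numE ?Lnorm_ge0.
Qed.

(** The L^1 norm in x is bounded by the L^2 norm. In t, the case r = 2 reduces
    to r = 1 through y <= 1 + y^2 on the bounded interval ]0, T[. *)
Lemma LpL2_integrable (r : R) l T (w : R -> R -> R) : r = 1 \/ r = 2 -> LpL2 r%:E l T w ->
  (mu \x mu)%E.-integrable (`]0, l[ `*` `]0, T[) (EFin \o (fun z => w z.1 z.2)).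
Proof.
move=> r12 [mw wl]; apply/(@integrable_rectP _ _ _ _ R mu mu _ _ w) => //.
set W := (fun z => w z.1 z.2) \_ (`]0, l[ `*` `]0, T[).
have mAB : measurable (`]0, l[ `*` `]0, T[ : set (R * R)) by exact: measurableX.
have mW : measurable_fun setT W := (measurable_restrictT _ mAB).1 mw.
have W0 x t : (x \notin `]0, l[) \/ (t \notin `]0, T[) -> W (x, t) = 0.
  move=> h; rewrite /W patchE memNset// => -[/= xl tT]; move: xl tT h.
  by rewrite !in_itv/= => -> -> [].
have WE x t : x \in `]0, l[ -> t \in `]0, T[ -> W (x, t) = w x t.
  by move=> xl tT; rewrite /W patchE mem_set.
pose N t := L2norm l (fun x => W (x, t)).
have NE : (fun t => L2norm l (w ^~ t)) \_ `]0, T[ = N.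
  apply/funext => t; rewrite patchE mem_setE; case: ifPn => tT; rewrite /N /L2norm.
    apply: eq_Lnorm => x; rewrite !patchE; case: ifPn => // /set_mem xl /=.
    by rewrite WE.
  rewrite -[LHS](@Lnorm0 _ _ R mu 2%:E) ?gt_eqF//; apply: eq_Lnorm => x.
  by rewrite !patchE; case: ifPn => // /set_mem xl /=; rewrite W0//; right.
have NW t : N t = ('N[mu]_2%:E[(fun x => (W (x, t))%:E)])%E.
  apply: eq_Lnorm => x; rewrite patchE; case: ifPn => // /negP xl.
  by rewrite W0//; left; apply/negP => xl'; apply: xl; apply/mem_set.
have N0 t : (0 <= N t)%E by exact: Lnorm_ge0.
have mP : measurable_fun [set: R] (fun t => \int[mu]_x (`|(W (x, t))%:E| `^ 2)%E)%E.
  apply: (@measurable_fun_fubini_tonelli_G _ _ _ _ R mu (fun z => (`|(W z)%:E| `^ 2)%E)).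
    apply: (measurableT_comp (@measurable_poweR R 2)).
    by apply: measurableT_comp => //; exact/measurable_EFinP.
  by move=> z; exact: poweR_ge0.
have mN : measurable_fun [set: R] N.
  rewrite (_ : N = fun t => ((\int[mu]_x (`|(W (x, t))%:E| `^ 2)) `^ 2^-1)%E).
    exact: (measurableT_comp (@measurable_poweR R 2^-1) mP).
  by apply/funext => t; rewrite NW unlock.
have Nl : (\int[mu]_t N t < +oo)%E.
  move: wl; rewrite NE; case: r12 => ->.
    by rewrite Lnorm1; apply: le_lt_trans; apply: ge0_le_integral => //;
      [exact: measurableT_comp|move=> t _; rewrite gee0_abs].
  move/(@poweR_lty R _ 2); rewrite poweR_Lnorm// => Nl.
  have m2 : measurable_fun [set: R] (fun t => (`|N t| `^ 2)%E).
    apply: (measurableT_comp (@measurable_poweR R 2)).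
    exact: measurableT_comp.
  pose iT : R -> R := \1_(`]0, T[ : set R).
  have mi : measurable_fun [set: R] (EFin \o iT).
    by apply/measurable_EFinP; exact: measurable_indic.
  apply: (@le_lt_trans _ _ (\int[mu]_t ((iT t)%:E + `|N t| `^ 2))%E).
    apply: ge0_le_integral => //.
    - exact: emeasurable_funD.
    - move=> t _; rewrite gee0_abs// /iT indicE.
      have [tT|tT] := boolP (t \in (`]0, T[%classic : set R)); last first.
        rewrite -{1}NE patchE (negbTE tT); apply: adde_ge0; rewrite ?lee_fin//.
        exact: poweR_ge0.
      case: (N t) (N0 t) => [y| |//] y0; last by rewrite poweRyr// addey.
      rewrite poweR_EFin -EFinD lee_fin powR_mulrn//=.
      by have := sqr_ge0 (y - 1); have := sqr_ge0 y; rewrite !expr2; nra.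
  rewrite ge0_integralD//.
  - apply: lte_add_pinfty => //.
    have : mu.-integrable setT (EFin \o iT).
      apply/(integrable_indic_itv); exact: leb_itv_lty.
    move/integrableP => [_]; apply: le_lt_trans; rewrite le_eqVlt; apply/orP; left; apply/eqP.
    by apply: eq_integral => t _; rewrite gee0_abs// lee_fin /iT indicE.
  - by move=> t _; rewrite lee_fin /iT indicE.
  - by move=> t _; exact: poweR_ge0.
apply/integrable21ltyP; first exact/measurable_EFinP.
have Nint : (\int[mu]_t (L2const l * N t) < +oo)%E.
  rewrite ge0_integralZl//; last exact: Lnorm_ge0.
  by apply: lte_mul_pinfty; rewrite ?Lnorm_ge0// ge0_fin_numE ?Lnorm_ge0// L2const_lty.
apply: le_lt_trans Nint; apply: ge0_le_integral => //.
- by move=> t _; exact: integral_ge0.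
- apply: (@measurable_fun_fubini_tonelli_G _ _ _ _ R mu (fun z => `|(W z)%:E|%E)) => //.
  by apply: measurableT_comp => //; exact/measurable_EFinP.
- exact: measurable_funeM.
- move=> t _; rewrite muleC.
  have mWt : measurable_fun (`]0, l[ : set R) (fun x => W (x, t)).
    by apply: measurable_fun_onT; exact: (measurableT_comp mW (measurable_fun_pair _ _)).
  apply: le_trans (integral_le_L2norm mWt); rewrite integral_mkcond.
  rewrite le_eqVlt; apply/orP; left; apply/eqP; rewrite [RHS]integral_mkcond.
  apply: eq_integral => x _; rewrite !patchE in_setT; case: ifPn => // /negP xl.
  rewrite /= W0 ?normr0//; left; apply/negP => xl'; apply: xl; exact/mem_set.
Qed.

End mixed_integrability.

(** * Traces and Taylor expansions *)

Section traces.
Context {R : realType}.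
Local Notation mu := (@lebesgue_measure R).
Let mI (a b : R) : measurable (`]a, b[ : set R). Proof. exact: measurable_itv. Qed.
Let mh := @measurable_heaviside R.
Implicit Types (l T c : R).

Lemma test_function_continuous l T (phi : R -> R) : test_function l T phi ->
  continuous phi /\ continuous (derive1 phi).
Proof.
move=> [dphi _]; split=> x; apply/differentiable_continuous/derivable1_diffP.
  exact: (dphi 0%N x).
exact: (dphi 1%N x).
Qed.

Lemma continuous_bounded_itvo (l : R) (g : R -> R) : continuous g ->
  exists M, forall x, `]0, l[%classic x -> `|g x| <= M.
Proof.
move=> cg; have [M gM] := continuous_bounded_itv 0 l cg; exists M => x /=.
by rewrite in_itv/= => /andP[/ltW x0 /ltW xl]; exact: gM.
Qed.

Lemma Rint_heaviside_ramp (w x : R) : 0 <= w -> 0 < x ->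
  \int[mu]_(y in `]0, x[) heaviside (y - w) = ramp (x - w).
Proof.
move=> w0 x0; have [xw|wx] := leP x w.
  rewrite ler0_ramp ?subr_le0// (@leb_eq_Rint _ _ _ (fun=> 0)).
    by rewrite (@Rintegral_cst _ _ _ mu)// mul0r.
  move=> y /=; rewrite in_itv/= => /andP[_ yx].
  by rewrite /heaviside leNgt subr_lt0 (lt_le_trans yx xw).
have mE : measurable_fun [set: R] (fun y => heaviside (y - w)) by mfun.
have bE : mu.-integrable `[0, x] (EFin \o (fun y => heaviside (y - w))).
  apply: (@leb_integrable_bnd _ _ _ 1); [exact: measurable_itv|exact: leb_itv_lty|exact: measurable_fun_onT|].
  by move=> t _; rewrite ger0_norm ?heaviside_ge0 ?heaviside_le1.
rewrite Rint_oo_cc// (Rint_itv_split mE bE w0 (ltW wx)).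
rewrite -(Rint_oo_cc 0 w mE) (@leb_eq_Rint _ _ _ (fun=> 0)); last first.
  move=> t /=; rewrite in_itv/= => /andP[_ tc].
  by rewrite /heaviside leNgt subr_lt0 tc.
rewrite (@Rintegral_cst _ _ _ mu)// mul0r add0r.
rewrite (@leb_eq_Rint _ _ _ (fun=> 1)); last first.
  by move=> t /=; rewrite in_itv/= => /andP[ct _]; rewrite /heaviside subr_ge0 ct.
rewrite (@Rintegral_cst _ _ _ mu)// mul1r ger0_ramp ?subr_ge0 ?(ltW wx)//.
have H : mu `[w, x] = (x - w)%:E by rewrite lebesgue_measure_itv/= lte_fin wx -EFinB.
by rewrite [X in fine X]H.
Qed.

(** Cauchy's formula for the repeated integral. *)
Lemma Rint_primitive_ramp (l x : R) (h : R -> R) : 0 < x -> x <= l ->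
  mu.-integrable `]0, l[ (EFin \o h) ->
  mu.-integrable `]0, x[ (EFin \o (fun y => \int[mu]_(w in `]0, y[) h w)) /\
  \int[mu]_(y in `]0, x[) \int[mu]_(w in `]0, y[) h w =
  \int[mu]_(w in `]0, l[) (ramp (x - w) * h w).
Proof.
move=> x0 xl hi; pose h0 := h \_ `]0, l[.
have mh0 : measurable_fun setT h0.
  by have /(measurable_restrictT _ (mI 0 l)).1 := leb_measurable hi.
have h0E z : 0 < z -> z < l -> h0 z = h z.
  by move=> z0 zT; rewrite /h0 patchE mem_set//= in_itv/= z0.
pose F (y w : R) := heaviside (y - w) * h0 w.
have e y : `]0, x[%classic y -> \int[mu]_(w in `]0, y[) h w = \int[mu]_(w in `]0, l[) F y w.
  rewrite /= in_itv/= => /andP[y0 yx]; rewrite (Rint_lt_heaviside y0 (lt_le_trans yx xl) hi).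
  by apply: leb_eq_Rint => w /=; rewrite in_itv/= => /andP[w0 wl]; rewrite /F h0E.
have Fi : (mu \x mu)%E.-integrable (`]0, x[ `*` `]0, l[) (EFin \o (fun z => F z.1 z.2)).
  apply: (@leb_integrable_prod R _ _ (fun=> 1) (fun z => `|h z|) F) => //.
  - by apply: measurable_fun_onT; rewrite /F; mfun.
  - by apply: leb_integrable_cst => //; exact: leb_itv_lty.
  - exact: leb_integrable_norm.
  - move=> t z /=; rewrite !in_itv/= => /andP[t0 tT] /andP[z0 zT].
    rewrite /F h0E// normrM; apply: ler_wpM2r => //.
    by rewrite ger0_norm ?heaviside_ge0 ?heaviside_le1.
split.
  by apply: (leb_eq_integrable (mI 0 x) (leb_integrable_Rint1 (f := F) (mI 0 x) (mI 0 l) Fi)) => y xy; rewrite e.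
rewrite (leb_eq_Rint e) (leb_fubini (f := F))//.
apply: leb_eq_Rint => w /=; rewrite in_itv/= => /andP[w0 wl].
rewrite -(Rint_heaviside_ramp (ltW w0) x0) mulrC -leb_RintZl//; last first.
  apply: (@leb_integrable_bnd _ _ _ 1) => //; [exact: leb_itv_lty|by apply: measurable_fun_onT; mfun|].
  by move=> t _; rewrite ger0_norm ?heaviside_ge0 ?heaviside_le1.
by apply: leb_eq_Rint => y _; rewrite /F h0E// mulrC.
Qed.

Lemma taylor2_integral (l v0 v1 x : R) (f' f'' : R -> R) : 0 < x -> x <= l ->
  mu.-integrable `]0, l[ (EFin \o f'') ->
  measurable_fun (`]0, x[ : set R) f' ->
  {ae mu, forall y, `]0, l[%classic y -> f' y = v1 + \int[mu]_(w in `]0, y[) f'' w} ->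
  v0 + \int[mu]_(y in `]0, x[) f' y = taylor2 l v0 v1 f'' x.
Proof.
move=> x0 xl hi mf fE.
have [i1 e1] := Rint_primitive_ramp x0 xl hi.
rewrite /taylor2 -e1 -addrA; congr (_ + _).
have xx : fine (mu `]0, x[) = x := fine_lebesgue_itvoo x0.
have ci : mu.-integrable `]0, x[ (EFin \o (fun=> v1)).
  by apply: leb_integrable_cst => //; exact: leb_itv_lty.
rewrite (@leb_ae_eq_Rint _ _ _ (fun y => v1 + \int[mu]_(w in `]0, y[) f'' w))//.
- rewrite leb_RintD//; congr (_ + _).
  by rewrite (@Rintegral_cst _ _ _ mu)//; congr (_ * _).
- exact: leb_measurable (leb_integrableD (mI 0 x) ci i1).
- apply: (leb_ae_imp fE) => y fy /=; rewrite in_itv/= => /andP[y0 yx]; apply: fy.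
  by rewrite /= in_itv/= y0 (lt_le_trans yx xl).
Qed.

(** The continuous representative has the same weak derivative, and
    weak_derivative_FTC applies to its extension by constants. *)
Lemma has_trace0_FTC l c (f h : R -> R) : 0 < l ->
  measurable_fun (`]0, l[ : set R) f -> mu.-integrable `]0, l[ (EFin \o h) ->
  has_trace0 l f c -> weak_derivative l f h ->
  {ae mu, forall x, `]0, l[%classic x -> f x = c + \int[mu]_(y in `]0, x[) h y}.
Proof.
move=> l0 mf hi [g [cg gf g0]] fh.
pose gc x := g (clamp l x).
have cgc : continuous gc by apply: continuous_comp_clamp => //; exact: ltW.
have gcf : {ae mu, forall x, `]0, l[%classic x -> gc x = f x}.
  apply: (leb_ae_imp gf) => x gx /[dup] xl /=; rewrite in_itv/= => /andP[x0 xl'].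
  by rewrite /gc clamp_id ?ltW// gx.
have wg : weak_derivative l gc h.
  move=> phi tphi; rewrite -fh//; have [_ cphi] := test_function_continuous tphi.
  have m1 : measurable_fun (`]0, l[ : set R) (derive1 phi).
    by apply: measurable_fun_onT; exact: continuous_measurable_fun.
  apply: leb_ae_eq_Rint => //.
  - by apply: measurable_funM => //; apply: measurable_fun_onT; exact: continuous_measurable_fun.
  - exact: measurable_funM.
  - by apply: (leb_ae_imp gcf) => x gx xl; rewrite gx.
apply: (leb_ae_imp gcf) => x gx /[dup] xl /=; rewrite in_itv/= => /andP[x0 xl'].
rewrite -gx// -(weak_derivative_FTC x0 (ltW xl') cgc hi wg).
have gc0 : gc 0 = c by rewrite /gc clamp_id// ltW.
by rewrite gc0 addrC subrK.
Qed.

Lemma has_trace0_taylor2 l c (f f' f'' : R -> R) : 0 < l ->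
  mu.-integrable `]0, l[ (EFin \o f) -> mu.-integrable `]0, l[ (EFin \o f') ->
  mu.-integrable `]0, l[ (EFin \o f'') ->
  weak_derivative l f f' -> weak_derivative l f' f'' ->
  has_trace0 l f c -> has_trace0 l f' 0 ->
  {ae mu, forall x, `]0, l[%classic x -> f x = taylor2 l c 0 f'' x}.
Proof.
move=> l0 fi f'i f''i ff' f'f'' tf tf'.
have h1 := has_trace0_FTC l0 (leb_measurable fi) f'i tf ff'.
have h2 := has_trace0_FTC l0 (leb_measurable f'i) f''i tf' f'f''.
apply: (leb_ae_imp h1) => x fx /[dup] xl /=; rewrite in_itv/= => /andP[x0 xl'].
rewrite fx//; apply: taylor2_integral => //; first exact: ltW.
apply: leb_measurable (leb_integrableS (mI 0 l) (mI 0 x) _ f'i).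
by apply: subset_itvl; rewrite bnd_simp ltW.
Qed.

(** The derivative exists in the open interval only, and f is extended by
    constants to apply the fundamental theorem up to the boundary. *)
Lemma Ck_FTC l (f g : R -> R) x : {within `[0, l], continuous f} ->
  {within `[0, l], continuous g} ->
  (forall x, x \in `]0, l[ -> is_derive x 1 f (g x)) -> 0 < x -> x <= l ->
  f x = f 0 + \int[mu]_(y in `]0, x[) g y.
Proof.
move=> cf cg dfg x0 xl; have l0 : 0 <= l by exact: le_trans (ltW x0) xl.
pose gc y := g (clamp l y); pose fc y := f (clamp l y).
have cgc : continuous gc by exact: continuous_comp_clamp.
have cfc : continuous fc by exact: continuous_comp_clamp.
rewrite (@leb_eq_Rint _ _ g gc); last first.
  move=> y /=; rewrite in_itv/= => /andP[y0 yx].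
  by rewrite /gc clamp_id ?ltW// (lt_le_trans yx).
rewrite Rint_oo_cc; last exact: continuous_measurable_fun.
have fcE y : 0 <= y -> y <= l -> fc y = f y by move=> y0 yl; rewrite /fc clamp_id.
have dfc y : y \in `]0, x[ -> is_derive y 1 fc (gc y).
  rewrite in_itv/= => /andP[y0 yx]; have yl := lt_le_trans yx xl.
  apply: (@near_eq_is_derive _ _ _ f).
    near=> z; rewrite fcE//; last by near: z; apply: lt_le_nbhsl.
    by near: z; apply: lt_le_nbhsr.
  by rewrite /gc clamp_id ?ltW//; apply: dfg; rewrite in_itv/= y0.
rewrite /Rintegral (@continuous_FTC2 R gc fc 0 x)//.
- by rewrite -EFinB /= !fcE ?(ltW x0)// addrC subrK.
- exact: continuous_subspaceT.
- split; first by move=> y /dfc[].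
  + exact: cvg_at_right_filter (cfc 0).
  + exact: cvg_at_left_filter (cfc x).
- by move=> y /dfc dy; rewrite derive1E; exact: derive_val.
Unshelve. all: by end_near. Qed.

End traces.

(** * The initial value *)

Section initial_value.
Context {R : realType}.
Local Notation mu := (@lebesgue_measure R).
Let mI (a b : R) : measurable (`]a, b[ : set R). Proof. exact: measurable_itv. Qed.
Context (l T : R) (l0 : 0 < l) (T0 : 0 < T).

(** The set A has finite measure, so that the L^2 norm controls the integral
    over A. *)
Lemma L2norm_cvg_Rint (A : set R) (U : R -> R -> R) (t0 : R) :
  measurable A -> A `<=` `]0, l[ ->
  (forall t, t \in `[0, T] ->
     measurable_fun (`]0, l[ : set R) (U ^~ t) /\ (L2norm l (U ^~ t) < +oo)%E) ->
  t0 \in `[0, T] ->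
  L2norm l (fun x => U x t - U x t0) @[t --> within `[0, T] (nbhs t0)] --> 0%E ->
  \int[mu]_(x in A) U x t @[t --> within `[0, T] (nbhs t0)] --> \int[mu]_(x in A) U x t0.
Proof.
move=> mA AI Ui t0T cU; apply/cvgrPdist_le => e e0.
pose C := fine (L2const l).
have CE : L2const l = C%:E.
  by rewrite /C fineK// ge0_fin_numE ?L2const_lty// Lnorm_ge0.
have C0 : 0 <= C by apply: fine_ge0; exact: Lnorm_ge0.
have d0 : 0 < e / (C + 1) by rewrite divr_gt0// ltr_wpDl.
have nb : nbhs (0%E : \bar R) [set y | (y < (e / (C + 1))%:E)%E].
  by apply: open_nbhs_nbhs; split; [exact: open_ereal_lt_ereal|rewrite /= lte_fin].
have h : \forall t \near t0, `[0, T]%classic t ->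
    (L2norm l (fun x => U x t - U x t0)%R < (e / (C + 1))%:E)%E := cU _ nb.
rewrite near_withinE; apply: filterS h => t hN' tT; have hN := hN' tT.
have [mt lt] := Ui t tT; have [m0 lt0] := Ui t0 t0T.
have it := L2norm_integrable mt lt; have i0 := L2norm_integrable m0 lt0.
have itA := leb_integrableS (mI 0 l) mA AI it; have i0A := leb_integrableS (mI 0 l) mA AI i0.
rewrite -leb_RintB//.
have di : mu.-integrable `]0, l[ (EFin \o (fun x => U x t - U x t0)) by exact: leb_integrableB.
have md := leb_measurable di.
apply: (@le_trans _ _ (\int[mu]_(x in `]0, l[) `|U x t - U x t0|)).
  apply: (@le_trans _ _ (\int[mu]_(x in A) `|U x t - U x t0|)).
    apply: leb_normr_le => //; first exact: leb_measurable (leb_integrableB mA i0A itA).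
      exact: (leb_integrableS (mI 0 l) mA AI (leb_integrable_norm di)).
    by move=> x _; rewrite distrC.
  by apply: leb_subset_Rint_le => //; exact: leb_integrable_norm.
have H := integral_le_L2norm md.
rewrite -lee_fin EFin_Rint//; last exact: leb_integrable_norm.
apply: (le_trans H); rewrite CE.
apply: (@le_trans _ _ ((e / (C + 1))%:E * C%:E)%E).
  by apply: lee_pmul => //; [exact: Lnorm_ge0|exact: ltW].
rewrite -EFinM lee_fin mulrAC ler_pdivrMr ?ltr_wpDl// ler_wpM2l ?(ltW e0)//.
by rewrite lerDl.
Qed.

(** The identity u(t) = a + int_0^t u_t in L^2(0,l), tested on every measurable
    set A of values of x: the function t |-> int_A u is continuous with an
    integrable weak derivative, so weak_derivative_FTC applies to it. Two
    functions with the same integral over every A agree almost everywhere. *)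
Lemma initial_value_FTC (u ut : R -> R -> R) (a : R -> R) :
  W11L2_with l T u ut -> mu.-integrable `]0, l[ (EFin \o a) ->
  has_initial_value l T u a ->
  {ae mu, forall t, `]0, T[%classic t -> {ae mu, forall x, `]0, l[%classic x ->
     u x t = a x + \int[mu]_(s in `]0, t[) ut x s}}.
Proof.
move=> [ul utl dut] ai [U [Ui Uc Uu Ua]].
have ui := LpL2_integrable (or_introl erefl) ul.
have uti := LpL2_integrable (or_introl erefl) utl.
have mIl := mI 0 l; have mIT := mI 0 T.
have rect (A : set R) (w : R -> R -> R) (B : set R) : measurable A -> A `<=` `]0, l[ ->
    measurable B -> B `<=` `]0, T[ ->
    (mu \x mu)%E.-integrable (`]0, l[ `*` `]0, T[) (EFin \o (fun z => w z.1 z.2)) ->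
    (mu \x mu)%E.-integrable (A `*` B) (EFin \o (fun z => w z.1 z.2)).
  move=> mA AI mB BI; apply: integrableS; [exact: measurableX|exact: measurableX|].
  by move=> z [/AI ? /BI].
have tT01 t : `]0, T[%classic t -> t \in `[0, T].
  by rewrite /= !in_itv/= => /andP[/ltW-> /ltW->].
pose gam (A : set R) t := \int[mu]_(x in A) U x (clamp T t).
have clin t : clamp T t \in `[0, T] by rewrite in_itv/= clamp_in ?(ltW T0).
have gamE A t : `]0, T[%classic t -> gam A t = \int[mu]_(x in A) U x t.
  by rewrite /= in_itv/= => /andP[t0 tT]; rewrite /gam clamp_id ?ltW.
have cgam (A : set R) : measurable A -> A `<=` `]0, l[ -> continuous (gam A).
  move=> mA AI; apply: (continuous_comp_clamp (g := fun t => \int[mu]_(x in A) U x t)); first exact: ltW.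
  apply/subspace_continuousP => t /= tT.
  by apply: L2norm_cvg_Rint => //; exact: Uc.
have gu (A : set R) : measurable A -> A `<=` `]0, l[ ->
   {ae mu, forall t, `]0, T[%classic t -> gam A t = \int[mu]_(x in A) u x t}.
  move=> mA AI; apply: (leb_ae_imp2 Uu (leb_integrable_section2 (f := u) mIl mIT ui)) => t Uut uti' tT.
  rewrite gamE//; have [mt lt] := Ui t (tT01 t tT).
  have it := L2norm_integrable mt lt.
  apply: leb_ae_eq_Rint => //; first exact: leb_measurable (leb_integrableS mIl mA AI it).
    exact: leb_measurable (leb_integrableS mIl mA AI (uti' tT)).
  by apply: (leb_ae_imp (Uut _)) => [|x Ux /AI xl]; [exact: tT|exact: Ux].
have wd (A : set R) : measurable A -> A `<=` `]0, l[ ->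
    weak_derivative T (gam A) (fun t => \int[mu]_(x in A) ut x t).
  move=> mA AI phi tphi; have [cphi cphi'] := test_function_continuous tphi.
  have uA := rect A u _ mA AI mIT (fun _ h => h) ui.
  have utA := rect A ut _ mA AI mIT (fun _ h => h) uti.
  have [M phiM] := continuous_bounded_itvo T cphi.
  have [M' phiM'] := continuous_bounded_itvo T cphi'.
  have mphi : measurable_fun [set: R] phi by exact: continuous_measurable_fun.
  have mphi' : measurable_fun [set: R] (derive1 phi) by exact: continuous_measurable_fun.
  have mAT : measurable (A `*` `]0, T[ : set (R * R)) by exact: measurableX.
  have prod (w : R -> R -> R) (psi : R -> R) (B : R) : measurable_fun [set: R] psi ->
      (forall t, `]0, T[%classic t -> `|psi t| <= B) ->
      (mu \x mu)%E.-integrable (A `*` `]0, T[) (EFin \o (fun z => w z.1 z.2)) ->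
      (mu \x mu)%E.-integrable (A `*` `]0, T[) (EFin \o (fun z => psi z.2 * w z.1 z.2)).
    move=> mpsi psiB wi.
    apply: (@integrableMb _ _ _ (mu \x mu)%E _ (fun z => psi z.2) (fun z => w z.1 z.2) B) => //.
      by apply: measurable_fun_onT; exact: (measurableT_comp mpsi measurable_snd).
    by move=> z [_ /psiB].
  have p1 := prod u _ _ mphi' phiM' uA.
  have p2 := prod ut _ _ mphi phiM utA.
  transitivity (\int[mu]_(t in `]0, T[) \int[mu]_(x in A) (derive1 phi t * u x t)).
    apply: leb_ae_eq_Rint => //.
    - apply: measurable_funM; last exact: measurable_fun_onT.
      by apply: measurable_fun_onT; apply: continuous_measurable_fun; exact: cgam.
    - exact: leb_measurable (leb_integrable_Rint2 (f := fun x t => derive1 phi t * u x t) mA mIT p1).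
    - apply: (leb_ae_imp2 (gu A mA AI) (leb_integrable_section2 (f := u) mA mIT uA)) => t gt ut' tT.
      by rewrite gt// mulrC -leb_RintZl//; exact: ut'.
  rewrite -(leb_fubini (f := fun x t => derive1 phi t * u x t))//.
  transitivity (\int[mu]_(x in A) - \int[mu]_(t in `]0, T[) (phi t * ut x t)).
    apply: leb_ae_eq_Rint => //.
    - exact: leb_measurable (leb_integrable_Rint1 (f := fun x t => derive1 phi t * u x t) mA mIT p1).
    - apply: measurable_funN.
      exact: leb_measurable (leb_integrable_Rint1 (f := fun x t => phi t * ut x t) mA mIT p2).
    - apply: (leb_ae_imp (dut phi tphi)) => x dx /AI xl.
      rewrite (@leb_eq_Rint _ _ _ (fun t => u x t * derive1 phi t)); last by move=> t _; rewrite mulrC.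
      by rewrite dx//; congr (- _); apply: leb_eq_Rint => t _; rewrite mulrC.
  rewrite leb_RintN//; last exact: (leb_integrable_Rint1 (f := fun x t => phi t * ut x t)).
  congr (- _); rewrite (leb_fubini (f := fun x t => phi t * ut x t))//.
  apply: leb_ae_eq_Rint => //.
  - exact: leb_measurable (leb_integrable_Rint2 (f := fun x t => phi t * ut x t) mA mIT p2).
  - apply: measurable_funM; last exact: measurable_fun_onT.
    exact: leb_measurable (leb_integrable_Rint2 (f := ut) mA mIT utA).
  - apply: (leb_ae_imp (leb_integrable_section2 (f := ut) mA mIT utA)) => t ut' tT.
    by rewrite leb_RintZl// 1?mulrC//; exact: ut'.
have mass (A : set R) t : measurable A -> A `<=` `]0, l[ -> `]0, T[%classic t ->
    \int[mu]_(x in A) U x t = \int[mu]_(x in A) (a x + \int[mu]_(s in `]0, t[) ut x s).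
  move=> mA AI tT; have := tT; rewrite /= in_itv/= => /andP[t0 tT'].
  have utA := rect A ut _ mA AI mIT (fun _ h => h) uti.
  have := weak_derivative_FTC t0 (ltW tT') (cgam A mA AI) (leb_integrable_Rint2 (f := ut) mA mIT utA) (wd A mA AI).
  rewrite gamE// => E.
  have tI : `]0, t[ `<=` `]0, T[%classic.
    by move=> s /=; rewrite !in_itv/= => /andP[-> /lt_trans]; exact.
  have utAt := rect A ut `]0, t[%classic mA AI (mI 0 t) tI uti.
  have g0 : gam A 0 = \int[mu]_(x in A) a x.
    rewrite /gam clamp_id ?(ltW T0)//.
    have T00 : (0 : R) \in `[0, T] by rewrite in_itv/= lexx ltW.
    have [m0 lt0] := Ui 0 T00; have i0 := L2norm_integrable m0 lt0.
    apply: leb_ae_eq_Rint => //; first exact: leb_measurable (leb_integrableS mIl mA AI i0).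
      exact: leb_measurable (leb_integrableS mIl mA AI ai).
    by apply: (leb_ae_imp Ua) => x Ux /AI xl; exact: Ux.
  rewrite leb_RintD//; [|exact: (leb_integrableS mIl mA AI ai)|exact: (leb_integrable_Rint1 (f := ut))].
  by rewrite (leb_fubini (f := ut))// -E g0 addrC subrK.
apply: (leb_ae_imp2 Uu (leb_integrable_section2 (f := u) mIl mIT ui)) => t Uut uti' tT.
have [mt lt] := Ui t (tT01 t tT); have it := L2norm_integrable mt lt.
have := tT; rewrite /= in_itv/= => /andP[t0 tT'].
have tI : `]0, t[ `<=` `]0, T[%classic.
  by move=> s /=; rewrite !in_itv/= => /andP[-> /lt_trans]; exact.
have uti2 := rect `]0, l[%classic ut `]0, t[%classic mIl (fun _ h => h) (mI 0 t) tI uti.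
have ri : mu.-integrable `]0, l[ (EFin \o (fun x => a x + \int[mu]_(s in `]0, t[) ut x s)).
  by apply: leb_integrableD => //; exact: (leb_integrable_Rint1 (f := ut)).
have H : {ae mu, forall x, `]0, l[%classic x ->
    (U x t)%:E = (a x + \int[mu]_(s in `]0, t[) ut x s)%:E}.
  apply: (@integral_ae_eq _ _ R mu _ mIl (EFin \o (fun x => a x + \int[mu]_(s in `]0, t[) ut x s)) (EFin \o (U ^~ t))) => //.
    by apply/measurable_EFinP; exact: leb_measurable ri.
  move=> A AI mA.
  rewrite /comp -!EFin_Rint//; [|exact: (leb_integrableS mIl mA AI ri)|exact: (leb_integrableS mIl mA AI it)].
  by congr EFin; exact: mass.
have Uut' : {ae mu, forall x, x \in `]0, l[ -> U x t = u x t} by exact: Uut.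
apply: (leb_ae_imp2 H Uut') => x + Ux xl => /(_ xl) [<-].
by rewrite Ux.
Qed.

End initial_value.

(** * The transformed equation *)

Section transpose.
Context {R : realType}.
Local Notation mu := (@lebesgue_measure R).

Lemma integrable_transpose (A B : set R) (f : R -> R -> R) :
  measurable A -> measurable B ->
  measurable_fun (A `*` B) (fun z : R * R => f z.1 z.2) ->
  (mu \x mu)%E.-integrable (B `*` A) (EFin \o (fun z => f z.2 z.1)) ->
  (mu \x mu)%E.-integrable (A `*` B) (EFin \o (fun z => f z.1 z.2)).
Proof.
move=> mA mB mf.
move=> /(@integrable_rectP _ _ _ _ R mu mu B A (fun y x => f x y) mB mA) fi.
apply/(@integrable_rectP _ _ _ _ R mu mu A B f mA mB).
have mF := (measurable_restrictT _ (measurableX mA mB)).1 mf.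
apply/integrable21ltyP; first exact/measurable_EFinP.
have mF' := measurable_int _ fi.
have := (@integrable12ltyP _ _ _ _ R mu mu _ mF').1 fi.
have swap x y : ((fun z : R * R => f z.2 z.1) \_ (B `*` A)) (y, x) =
    ((fun z : R * R => f z.1 z.2) \_ (A `*` B)) (x, y).
  by rewrite !patchE !in_setX /= andbC.
by under eq_integral do under eq_integral do rewrite /= swap.
Qed.

End transpose.

Section solution_transform.
Context {R : realType}.
Local Notation mu := (@lebesgue_measure R).
Let mI (a b : R) : measurable (`]a, b[ : set R). Proof. exact: measurable_itv. Qed.
Context (l T : R) (l0 : 0 < l) (T0 : 0 < T).
Let mIl := mI 0 l.
Let mIT := mI 0 T.
Let mlT : measurable (`]0, l[ `*` `]0, T[ : set (R * R)).
Proof. exact: measurableX. Qed.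

Let integrable2 (w : R -> R -> R) :=
  (mu \x mu)%E.-integrable (`]0, l[ `*` `]0, T[) (EFin \o (fun z => w z.1 z.2)).

Let ae_rect (P : R -> R -> Prop) :=
  {ae mu, forall x, `]0, l[%classic x -> {ae mu, forall t, `]0, T[%classic t -> P x t}}.

(** The part of u which is determined by its second derivative, as u_x(0, t) =
    0. *)
Definition curvature_part (uxx : R -> R -> R) (x t : R) : R :=
  \int[mu]_(w in `]0, l[) (ramp (x - w) * uxx w t).

(** The value of u at x = 0 recovered by averaging over x: in contrast with the
    trace, which is only known to exist for almost every t, it is defined for
    all t and measurable. *)
Definition boundary_mean (u uxx : R -> R -> R) (t : R) : R :=
  l^-1 * \int[mu]_(x in `]0, l[) (u x t - curvature_part uxx x t).

Let mramp := @measurable_ramp R.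

Let patch2 (w : R -> R -> R) : R -> R -> R :=
  fun x t => ((fun z => w z.1 z.2) \_ (`]0, l[ `*` `]0, T[)) (x, t).

Let patch2E w x t : `]0, l[%classic x -> `]0, T[%classic t -> patch2 w x t = w x t.
Proof. by move=> xl tT; rewrite /patch2 patchE mem_set. Qed.

Let measurable_patch2 w : integrable2 w ->
  measurable_fun setT (fun z : R * R => patch2 w z.1 z.2).
Proof.
move=> wi; have mw : measurable_fun (`]0, l[ `*` `]0, T[ : set (R * R)) (fun z => w z.1 z.2).
  exact: (@integrable_measurable _ _ _ (mu \x mu)%E _ (fun z => w z.1 z.2) wi).
have H := (measurable_restrictT _ mlT).1 mw.
by rewrite (_ : (fun z => _) = (fun z => w z.1 z.2) \_ (`]0, l[ `*` `]0, T[))//; apply/funext => -[x t].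
Qed.

(** The ramp is bounded by l, hence this part by l times the L^1 norm in x of
    uxx. *)
Lemma integrable_curvature_part uxx : integrable2 uxx -> integrable2 (curvature_part uxx).
Proof.
move=> wi; have mw := measurable_patch2 wi.
pose K (x t : R) := \int[mu]_(w in `]0, l[) (ramp (x - w) * patch2 uxx w t).
have mK : measurable_fun setT (fun z : R * R => K z.1 z.2).
  apply: (leb_measurable_Rint (f := fun (z : R * R) (w : R) => ramp (z.1 - w) * patch2 uxx w z.2)) => //.
  mfun.
have KE x t : `]0, l[%classic x -> `]0, T[%classic t -> K x t = curvature_part uxx x t.
  by move=> xl tT; apply: leb_eq_Rint => w wl; rewrite patch2E.
have ni : integrable2 (fun x t => `|uxx x t|).
  exact: (@integrable_norm _ _ _ (mu \x mu)%E _ (fun z => uxx z.1 z.2) wi).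
pose h t := \int[mu]_(w in `]0, l[) `|uxx w t|.
have hi : mu.-integrable `]0, T[ (EFin \o h) := leb_integrable_Rint2 (f := fun x t => `|uxx x t|) mIl mIT ni.
have swapped : (mu \x mu)%E.-integrable (`]0, T[ `*` `]0, l[)
    (EFin \o (fun z => K z.2 z.1)).
  apply: (@leb_integrable_rect R _ _ (fun t => l * l * h t) (fun t x => K x t)) => //.
  - by apply: measurable_fun_onT; exact: (measurableT_comp mK (measurable_fun_pair measurable_snd measurable_fst)).
  - exact: leb_integrableZl.
  - apply: (leb_ae_imp (leb_integrable_section2 (f := uxx) mIl mIT wi)) => t gt tT.
    have {}gt := gt tT.
    have Kb x : `]0, l[%classic x -> `|K x t| <= l * h t.
      move=> xl; rewrite KE// /curvature_part -leb_RintZl//; last exact: leb_integrable_norm.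
      move: xl; rewrite /= in_itv/= => /andP[x0 xl].
      have rb w : `]0, l[%classic w -> `|ramp (x - w)| <= l.
        rewrite /= in_itv/= => /andP[w0 wl].
        by rewrite ger0_norm ?ramp_ge0//; apply: (ramp_le (ltW l0)); lra.
      apply: leb_normr_le => //.
      + apply: measurable_funM; last exact: leb_measurable gt.
        by apply: measurable_fun_onT; mfun.
      + by apply: leb_integrableZl => //; exact: leb_integrable_norm.
      + by move=> w wl; rewrite normrM ler_wpM2r// rb.
    have mKt : measurable_fun (`]0, l[ : set R) (fun x => K x t).
      by apply: measurable_fun_onT; exact: (measurable_fun2 mK).
    split; first by apply: (@leb_integrable_bnd _ _ _ (l * h t)) => //; exact: leb_itv_lty.
    have h0 : 0 <= h t by exact: Rintegral_ge0.
    apply: (@le_trans _ _ (\int[mu]_(x in `]0, l[) (l * h t))).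
      apply: leb_le_Rint => //.
        by apply: leb_integrable_norm; apply: (@leb_integrable_bnd _ _ _ (l * h t)) => //; exact: leb_itv_lty.
      by apply: leb_integrable_cst => //; exact: leb_itv_lty.
    have muD : fine (mu `]0, l[) = l := fine_lebesgue_itvoo l0.
    by rewrite (@Rintegral_cst _ _ _ mu)// [X in _ * X]muD mulrAC.
have Ki : integrable2 K by apply: integrable_transpose => //; exact: measurable_fun_onT.
apply: (@integrable_ext _ _ _ (mu \x mu)%E _ (fun z => K z.1 z.2)) => //.
by move=> [x t] /= [xl tT]; exact: KE.
Qed.

Let expb s t : 0 <= s -> `]0, T[%classic t -> `|expR (- s * t)| <= 1.
Proof.
move=> s0; rewrite /= in_itv/= => /andP[t0 _].
by rewrite ger0_norm ?expR_ge0// -expR0 ler_expR mulNr oppr_le0 mulr_ge0// ltW.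
Qed.

Lemma integrable_damped s w : 0 <= s -> integrable2 w ->
  integrable2 (fun x t => expR (- s * t) * w x t).
Proof.
move=> s0 wi.
apply: (@integrableMb _ _ _ (mu \x mu)%E _ (fun z => expR (- s * z.2)) (fun z => w z.1 z.2) 1) => //.
  by apply: measurable_fun_onT; mfun.
by move=> [x t] [_ tT]; exact: expb.
Qed.

Let damped1 s (f : R -> R) : 0 <= s -> mu.-integrable `]0, T[ (EFin \o f) ->
  mu.-integrable `]0, T[ (EFin \o (fun t => expR (- s * t) * f t)).
Proof.
move=> s0 fi; apply: (@leb_integrableMb _ _ _ _ 1) => //; first by apply: measurable_fun_onT; mfun.
by move=> t tT; exact: expb.
Qed.

Let damped_le s (f : R -> R) : 0 <= s -> mu.-integrable `]0, T[ (EFin \o f) ->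
  `|\int[mu]_(t in `]0, T[) (expR (- s * t) * f t)| <= \int[mu]_(t in `]0, T[) `|f t|.
Proof.
move=> s0 fi; apply: leb_normr_le => //.
- exact: leb_measurable (damped1 s0 fi).
- exact: leb_integrable_norm.
- by move=> t tT; rewrite normrM ler_piMl// expb.
Qed.

Lemma transform_curvature_part s uxx x : 0 <= s -> integrable2 uxx -> `]0, l[%classic x ->
  \int[mu]_(t in `]0, T[) (expR (- s * t) * curvature_part uxx x t) =
  \int[mu]_(w in `]0, l[) (ramp (x - w) * \int[mu]_(t in `]0, T[) (expR (- s * t) * uxx w t)).
Proof.
move=> s0 ui xl; have dui := integrable_damped s0 ui.
have rb w : `]0, l[%classic w -> `|ramp (x - w)| <= l.
  move: xl; rewrite /= !in_itv/= => /andP[x0 xl] /andP[w0 wl].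
  by rewrite ger0_norm ?ramp_ge0//; apply: (ramp_le (ltW l0)); lra.
have rprod (w : R -> R -> R) : integrable2 w -> integrable2 (fun y t => ramp (x - y) * w y t).
  move=> wi.
  apply: (@integrableMb _ _ _ (mu \x mu)%E _ (fun z => ramp (x - z.1)) (fun z => w z.1 z.2) l) => //.
    by apply: measurable_fun_onT; mfun.
  by move=> [y t] [yl _]; exact: rb.
have r1 := rprod _ ui; have r2 := rprod _ dui.
transitivity (\int[mu]_(t in `]0, T[) \int[mu]_(w in `]0, l[) (ramp (x - w) * (expR (- s * t) * uxx w t))).
  apply: leb_ae_eq_Rint => //.
  - apply: measurable_funM; first by apply: measurable_fun_onT; mfun.
    exact: leb_measurable (leb_integrable_Rint2 (f := fun w t => ramp (x - w) * uxx w t) mIl mIT r1).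
  - exact: leb_measurable (leb_integrable_Rint2 (f := fun w t => ramp (x - w) * (expR (- s * t) * uxx w t)) mIl mIT r2).
  - apply: (leb_ae_imp (leb_integrable_section2 (f := fun w t => ramp (x - w) * uxx w t) mIl mIT r1)) => t ti tT.
    by rewrite /curvature_part -leb_RintZl//; [apply: leb_eq_Rint => w _; ring|exact: ti].
rewrite -(leb_fubini (f := fun w t => ramp (x - w) * (expR (- s * t) * uxx w t)))//.
apply: leb_ae_eq_Rint => //.
- exact: leb_measurable (leb_integrable_Rint1 (f := fun w t => ramp (x - w) * (expR (- s * t) * uxx w t)) mIl mIT r2).
- apply: measurable_funM; first by apply: measurable_fun_onT; mfun.
  exact: leb_measurable (leb_integrable_Rint1 (f := fun w t => expR (- s * t) * uxx w t) mIl mIT dui).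
- apply: (leb_ae_imp (leb_integrable_section1 (f := fun w t => expR (- s * t) * uxx w t) mIl mIT dui)) => w wi wl.
  by rewrite leb_RintZl//; exact: wi.
Qed.

Context (alpha : R) (alpha0 : 0 < alpha) (alpha1 : alpha < 1).
Context (p a b : R -> R) (a0 a1 M : R).
Context (mp : measurable_fun setT p) (pM : forall x, `|p x| <= M).
Context (ai : mu.-integrable `]0, l[ (EFin \o a)) (bi : mu.-integrable `]0, l[ (EFin \o b)).
Context (aE : forall x, `]0, l[%classic x -> a x = taylor2 l a0 a1 b x).
Context (u ut ux uxx : R -> R -> R).
Context (hW : W11L2_with l T u ut) (hL : L2H2_with l T u ux uxx).
Context (hpde : {ae (mu \x mu)%E, forall z : R * R, z.1 \in `]0, l[ -> z.2 \in `]0, T[ ->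
        caputo alpha (ut z.1) z.2 = uxx z.1 z.2 - p z.1 * u z.1 z.2}).
Context (hini : has_initial_value l T u a).
Context (hneu : {ae mu, forall t, t \in `]0, T[ -> has_trace0 l (ux ^~ t) 0}).
Context (htr : {ae mu, forall t, t \in `]0, T[ -> exists c, has_trace0 l (u ^~ t) c}).

Let ui : integrable2 u.
Proof. by case: hW => h _ _; exact: LpL2_integrable (or_introl erefl) h. Qed.
Let uti : integrable2 ut.
Proof. by case: hW => _ h _; exact: LpL2_integrable (or_introl erefl) h. Qed.
Let uxi : integrable2 ux.
Proof. by case: hL => _ h _ _ _; exact: LpL2_integrable (or_intror erefl) h. Qed.
Let uxxi : integrable2 uxx.
Proof. by case: hL => _ _ h _ _; exact: LpL2_integrable (or_intror erefl) h. Qed.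

Let Cu := boundary_mean u uxx.

Lemma integrable_boundary_mean : mu.-integrable `]0, T[ (EFin \o boundary_mean u uxx).
Proof.
apply: leb_integrableZl => //; apply: (leb_integrable_Rint2 (f := fun x t => u x t - curvature_part uxx x t)) => //.
apply: (@integrable_subr _ _ _ (mu \x mu)%E _ (fun z => u z.1 z.2) (fun z => curvature_part uxx z.1 z.2)) => //.
exact: integrable_curvature_part.
Qed.

(** The function u(x, t) minus its curvature part does not depend on x. *)
Lemma boundary_meanE : {ae mu, forall t, `]0, T[%classic t -> forall c,
  has_trace0 l (u ^~ t) c -> boundary_mean u uxx t = c /\
  {ae mu, forall x, `]0, l[%classic x -> u x t = c + curvature_part uxx x t}}.
Proof.
case: (hL) => _ _ _ d1 d2.
have s1 := leb_integrable_section2 (f := u) mIl mIT ui.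
have s2 := leb_integrable_section2 (f := ux) mIl mIT uxi.
have s3 := leb_integrable_section2 (f := uxx) mIl mIT uxxi.
have s4 := leb_integrable_section2 (f := curvature_part uxx) mIl mIT (integrable_curvature_part uxxi).
have S := leb_ae_and (leb_ae_and (leb_ae_and s1 s2) s3) s4.
have D := leb_ae_and (leb_ae_and d1 d2) hneu.
apply: (leb_ae_imp2 S D) => t [[[i1 i2] i3] i4] [[w1 w2] tr] tT c tc.
have E := has_trace0_taylor2 l0 (i1 tT) (i2 tT) (i3 tT) (w1 tT) (w2 tT) tc (tr tT).
have E' : {ae mu, forall x, `]0, l[%classic x -> u x t = c + curvature_part uxx x t}.
  by apply: (leb_ae_imp E) => x ux' xl; rewrite ux'// /taylor2 mul0r addr0.
split => //; rewrite /boundary_mean (@leb_ae_eq_Rint _ _ _ (fun=> c)) //.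
- have muD : fine (mu `]0, l[) = l := fine_lebesgue_itvoo l0.
  by rewrite (@Rintegral_cst _ _ _ mu)// [X in _ * (_ * X)]muD mulrCA mulVf ?mulr1// gt_eqF.
- exact: leb_measurable (leb_integrableB mIl (i1 tT) (i4 tT)).
- by apply: (leb_ae_imp E') => x ux' xl; rewrite ux'// addrK.
Qed.

Let u_split : ae_rect (fun x t => u x t = Cu t + curvature_part uxx x t).
Proof.
apply: (@ae_swap R _ _ u (fun x t => Cu t + curvature_part uxx x t)) => //.
  apply: (@integrable_addr _ _ _ (mu \x mu)%E _ (fun z => Cu z.2) (fun z => curvature_part uxx z.1 z.2)) => //.
    apply: (@leb_integrable_prod R _ _ (fun=> 1) (fun t => `|Cu t|) (fun x t => Cu t)) => //.
    + have mC := leb_measurable integrable_boundary_mean.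
      have mC' := (measurable_restrictT Cu mIT).1 mC.
      apply: (eq_measurable_fun (fun z : R * R => (Cu \_ `]0, T[) z.2)).
        by move=> [x t] /set_mem[_ tT] /=; rewrite patchE mem_set.
      by apply: measurable_fun_onT; exact: (measurableT_comp mC' measurable_snd).
    + by apply: leb_integrable_cst => //; exact: leb_itv_lty.
    + exact: leb_integrable_norm integrable_boundary_mean.
    + by move=> x t _ _; rewrite mul1r.
  exact: integrable_curvature_part.
apply: (leb_ae_imp2 htr boundary_meanE) => t ht bm tT.
have [c tc] := ht tT; have [h1 h2] := bm tT c tc.
by apply: (leb_ae_imp h2) => x hx xl; rewrite hx// /Cu h1.
Qed.

Let primitive_int : integrable2 (fun x t => \int[mu]_(s in `]0, t[) ut x s).
Proof.
have mh := @measurable_heaviside R; have mw := measurable_patch2 uti.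
pose K (x t : R) := \int[mu]_(s in `]0, T[) ((1 - heaviside (s - t)) * patch2 ut x s).
have mK : measurable_fun setT (fun z : R * R => K z.1 z.2).
  apply: (leb_measurable_Rint (f := fun (z : R * R) (s : R) => (1 - heaviside (s - z.2)) * patch2 ut z.1 s)) => //.
  mfun.
have KE x t : `]0, l[%classic x -> `]0, T[%classic t -> K x t = \int[mu]_(s in `]0, t[) ut x s.
  move=> xl; rewrite /= in_itv/= => /andP[t0 tT].
  rewrite (_ : `]0, t[%classic = `]0, T[ `&` `]-oo, t[%classic) ?Rintegral_mkcondr; last first.
    apply/seteqP; split=> z /=; rewrite !in_itv/=.
      by move=> /andP[-> zt]; rewrite zt (lt_trans zt tT).
    by move=> [/andP[-> _] ->].
  apply: leb_eq_Rint => z zT; rewrite patchE mem_setE in_itv/= /heaviside subr_ge0 ltNge patch2E//.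
  by case: (t <= z); rewrite /= ?subrr ?subr0 ?mul0r ?mul1r.
have ni : integrable2 (fun x t => `|ut x t|).
  exact: (@integrable_norm _ _ _ (mu \x mu)%E _ (fun z => ut z.1 z.2) uti).
have Ki : integrable2 K.
  apply: (@leb_integrable_rect R _ _ (fun x => T * \int[mu]_(s in `]0, T[) `|ut x s|) K) => //.
  - exact: measurable_fun_onT.
  - by apply: leb_integrableZl => //; exact: (leb_integrable_Rint1 (f := fun x t => `|ut x t|)).
  - apply: (leb_ae_imp (leb_integrable_section1 (f := ut) mIl mIT uti)) => x gx xl; have {}gx := gx xl.
    have Kb t : `|K x t| <= \int[mu]_(s in `]0, T[) `|ut x s|.
      apply: leb_normr_le => //; last 2 first.
      + exact: leb_integrable_norm.
      + move=> s sT; rewrite patch2E// normrM ler_piMl//.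
        rewrite ger0_norm ?subr_ge0 ?heaviside_le1//.
        by rewrite lerBlDr lerDl heaviside_ge0.
      + by apply: measurable_fun_onT; mfun.
    have mKt : measurable_fun (`]0, T[ : set R) (fun t => K x t).
      by apply: measurable_fun_onT; exact: (measurable_fun2 mK).
    have Kxi : mu.-integrable `]0, T[ (EFin \o K x).
      by apply: (@leb_integrable_bnd _ _ _ (\int[mu]_(s in `]0, T[) `|ut x s|)) => //; exact: leb_itv_lty.
    split => //.
    apply: (@le_trans _ _ (\int[mu]_(t in `]0, T[) (\int[mu]_(s in `]0, T[) `|ut x s|))).
      apply: leb_le_Rint => //; first exact: leb_integrable_norm.
      by apply: leb_integrable_cst => //; exact: leb_itv_lty.
    have muD : fine (mu `]0, T[) = T := fine_lebesgue_itvoo T0.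
    by rewrite (@Rintegral_cst _ _ _ mu)// [X in _ * X]muD mulrC.
apply: (@integrable_ext _ _ _ (mu \x mu)%E _ (fun z => K z.1 z.2)) => //.
by move=> [x t] /= [xl tT]; exact: KE.
Qed.

Let u_time : ae_rect (fun x t => u x t = a x + \int[mu]_(s in `]0, t[) ut x s).
Proof.
apply: (@ae_swap R _ _ u (fun x t => a x + \int[mu]_(s in `]0, t[) ut x s)) => //.
  apply: (@integrable_addr _ _ _ (mu \x mu)%E _ (fun z => a z.1) (fun z => \int[mu]_(s in `]0, z.2[) ut z.1 s)) => //.
  apply: (@leb_integrable_prod R _ _ (fun x => `|a x|) (fun=> 1) (fun x t => a x)) => //.
  - have ma' := (measurable_restrictT a mIl).1 (leb_measurable ai).
    apply: (eq_measurable_fun (fun z : R * R => (a \_ `]0, l[) z.1)).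
      by move=> [x t] /set_mem[xl _] /=; rewrite patchE mem_set.
    by apply: measurable_fun_onT; exact: (measurableT_comp ma' measurable_fst).
  - exact: leb_integrable_norm.
  - by apply: leb_integrable_cst => //; exact: leb_itv_lty.
  - by move=> x t _ _; rewrite mulr1.
exact: initial_value_FTC.
Qed.

Let pde : ae_rect (fun x t => caputo alpha (ut x) t = uxx x t - p x * u x t).
Proof.
have h := @ae_section1 R (fun x t => x \in `]0, l[ -> t \in `]0, T[ ->
        caputo alpha (ut x) t = uxx x t - p x * u x t) hpde.
apply: (leb_ae_imp h) => x hx xl.
by apply: (leb_ae_imp hx) => t ht tT; exact: ht.
Qed.

(** For almost every x three facts hold at once: the expansion of u from x = 0,
    the expansion from t = 0, and the equation. Their transforms combine into a
    second order differential equation for s u^ - a, where u^ is the transform;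
    g is its second derivative, s uxx^ - a''. The error e is made of the values
    at time T and of the tail of the Caputo kernel, both multiplied by e^(-sT). *)
Lemma solution_resolvent : exists2 A0 : R, 0 <= A0 & forall s k : R, 1 <= s -> k ^+ 2 = s `^ alpha ->
  let v0 := s * \int[mu]_(t in `]0, T[) (expR (- s * t) * boundary_mean u uxx t) - a0 in
  exists g e : R -> R,
  [/\ mu.-integrable `]0, l[ (EFin \o g), mu.-integrable `]0, l[ (EFin \o e),
    {ae mu, forall x, `]0, l[%classic x ->
      g x = (p x + k ^+ 2) * taylor2 l v0 (- a1) g x + p x * a x - b x + e x},
    \int[mu]_(x in `]0, l[) `|g x| <= A0 * s /\ `|v0| <= A0 * s &
    \int[mu]_(x in `]0, l[) `|e x| <= A0 * (s `^ alpha * expR (- s * T))].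
Proof.
have nut : integrable2 (fun x t => `|ut x t|).
  exact: (@integrable_norm _ _ _ (mu \x mu)%E _ (fun z => ut z.1 z.2) uti).
have nuxx : integrable2 (fun x t => `|uxx x t|).
  exact: (@integrable_norm _ _ _ (mu \x mu)%E _ (fun z => uxx z.1 z.2) uxxi).
pose h x := \int[mu]_(t in `]0, T[) `|ut x t|.
have hi : mu.-integrable `]0, l[ (EFin \o h) := leb_integrable_Rint1 (f := fun x t => `|ut x t|) mIl mIT nut.
pose h2 x := \int[mu]_(t in `]0, T[) `|uxx x t|.
have h2i : mu.-integrable `]0, l[ (EFin \o h2) := leb_integrable_Rint1 (f := fun x t => `|uxx x t|) mIl mIT nuxx.
pose IC := \int[mu]_(t in `]0, T[) `|boundary_mean u uxx t|.
pose I2 := \int[mu]_(x in `]0, l[) h2 x.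
pose Ib := \int[mu]_(x in `]0, l[) `|b x|.
pose Ie := \int[mu]_(x in `]0, l[) (`|a x| + 2 * h x).
have h0 x : 0 <= h x by exact: Rintegral_ge0.
have IC0 : 0 <= IC by exact: Rintegral_ge0.
have I20 : 0 <= I2 by apply: Rintegral_ge0 => x _; exact: Rintegral_ge0.
have Ib0 : 0 <= Ib by exact: Rintegral_ge0.
have Ie0 : 0 <= Ie by apply: Rintegral_ge0 => x _; rewrite addr_ge0// mulr_ge0.
have a00 := normr_ge0 a0.
exists (IC + `|a0| + I2 + Ib + Ie) => [|s k s1 ks v0].
  by rewrite !addr_ge0.
have s0 : 0 <= s by exact: le_trans s1.
have sp : 0 < s by exact: lt_le_trans s1.
have sa0 : 0 <= s `^ alpha by exact: powR_ge0.
pose g0 x := \int[mu]_(t in `]0, T[) (expR (- s * t) * uxx x t).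
have g0i : mu.-integrable `]0, l[ (EFin \o g0).
  by apply: (leb_integrable_Rint1 (f := fun x t => expR (- s * t) * uxx x t)) => //; exact: integrable_damped.
pose g x := s * g0 x - b x.
have gi : mu.-integrable `]0, l[ (EFin \o g) by apply: leb_integrableB => //; exact: leb_integrableZl.
pose tl := taylor2 l v0 (- a1) g.
have mtl : measurable_fun setT tl by exact: measurable_taylor2.
pose rhs x := (p x + k ^+ 2) * tl x + p x * a x - b x.
have tli : mu.-integrable `]0, l[ (EFin \o tl).
  apply: (@leb_integrable_bnd _ _ _ (`|v0| + `|- a1| * l + l * \int[mu]_(w in `]0, l[) `|g w|)) => //.
  - exact: leb_itv_lty.
  - exact: measurable_fun_onT.
  - by move=> x /=; rewrite in_itv/= => /andP[x0 xl]; apply: taylor2_bound => //; exact: ltW.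
have rhsi : mu.-integrable `]0, l[ (EFin \o rhs).
  apply: leb_integrableB => //; apply: leb_integrableD => //.
    apply: (@leb_integrableMb _ _ _ _ (M + k ^+ 2)) => //; first by apply: measurable_fun_onT; mfun.
    by move=> x _; rewrite (le_trans (ler_normD _ _))// lerD// ger0_norm ?sqr_ge0.
  by apply: (@leb_integrableMb _ _ _ _ M) => //; exact: measurable_fun_onT.
exists g, (fun x => g x - rhs x); split => //.
- exact: leb_integrableB.
- by apply: aeW => x _; rewrite /rhs -/tl addrC subrK.
- split.
    apply: (@le_trans _ _ (s * I2 + Ib)).
      rewrite /I2 /Ib -leb_RintZl// -leb_RintD//; [|exact: leb_integrableZl|exact: leb_integrable_norm].
      apply: leb_ae_le_Rint => //.
      + exact: leb_integrable_norm.
      + by apply: leb_integrableD => //; [exact: leb_integrableZl|exact: leb_integrable_norm].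
      + apply: (leb_ae_imp (leb_integrable_section1 (f := uxx) mIl mIT uxxi)) => x ix xl.
        rewrite (le_trans (ler_normB _ _))// lerD2r normrM ger0_norm// ler_wpM2l//.
        by apply: damped_le => //; exact: ix.
    rewrite mulrC mulrDl -!addrA; nra.
  rewrite (le_trans (ler_normB _ _))// normrM ger0_norm//.
  have := damped_le s0 integrable_boundary_mean; rewrite -/IC => hC.
  have : s * `|\int[mu]_(t in `]0, T[) (expR (- s * t) * boundary_mean u uxx t)| <= s * IC.
    by rewrite ler_wpM2l.
  nra.
- apply: (@le_trans _ _ (Ie * (s `^ alpha * expR (- s * T)))); last first.
    apply: ler_wpM2r; first by rewrite mulr_ge0 ?expR_ge0.
    by rewrite lerDr !addr_ge0.
  have hai : mu.-integrable `]0, l[ (EFin \o (fun x => `|a x| + 2 * h x)).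
    by apply: leb_integrableD => //; [exact: leb_integrable_norm|exact: leb_integrableZl].
  rewrite mulrC /Ie -leb_RintZl//; apply: leb_ae_le_Rint => //.
  + by apply: leb_integrable_norm; exact: leb_integrableB.
  + exact: leb_integrableZl.
  have e1 := leb_integrable_section1 (f := ut) mIl mIT uti.
  have e2 := leb_integrable_section1 (f := uxx) mIl mIT uxxi.
  have e3 := leb_integrable_section1 (f := u) mIl mIT ui.
  have e4 := leb_integrable_section1 (f := curvature_part uxx) mIl mIT (integrable_curvature_part uxxi).
  have e5 := leb_integrable_section1 (f := fun x t => \int[mu]_(s in `]0, t[) ut x s) mIl mIT primitive_int.
  have E := leb_ae_and (leb_ae_and (leb_ae_and e1 e2) (leb_ae_and e3 e4)) e5.
  have F := leb_ae_and (leb_ae_and u_split u_time) pde.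
  apply: (leb_ae_imp2 E F) => x [[[i1 i2] [i3 i4]] i5] [[f1 f2] f3] xl.
  have {}i1 := i1 xl; have {}i2 := i2 xl; have {}i3 := i3 xl; have {}i4 := i4 xl; have {}i5 := i5 xl.
  have {}f1 := f1 xl; have {}f2 := f2 xl; have {}f3 := f3 xl.
  pose Us := \int[mu]_(t in `]0, T[) (expR (- s * t) * u x t).
  pose W := \int[mu]_(t in `]0, T[) (expR (- s * t) * ut x t).
  have me : measurable_fun (`]0, T[ : set R) (fun t => expR (- s * t)).
    by apply: measurable_fun_onT; mfun.
  (* the Taylor formulas of u and of a at x = 0, subtracted *)
  have E1 : s * Us - a x = tl x.
    have -> : Us = \int[mu]_(t in `]0, T[) (expR (- s * t) * boundary_mean u uxx t)
         + \int[mu]_(w in `]0, l[) (ramp (x - w) * g0 w).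
      rewrite -(transform_curvature_part s0 uxxi xl).
      have d1 := damped1 s0 integrable_boundary_mean.
      have d2 := damped1 s0 i4.
      rewrite -leb_RintD//; apply: leb_ae_eq_Rint => //.
      * exact: leb_measurable (damped1 s0 i3).
      * exact: leb_measurable (leb_integrableD mIT d1 d2).
      * by apply: (leb_ae_imp f1) => t ft tT; rewrite ft// mulrDr.
    rewrite /tl /taylor2 aE// /taylor2 /g /v0.
    have xl' := xl; move: xl'; rewrite /= in_itv/= => /andP[x0 xl'].
    have rmul (f : R -> R) : mu.-integrable `]0, l[ (EFin \o f) ->
        mu.-integrable `]0, l[ (EFin \o (fun w => ramp (x - w) * f w)).
      move=> fi; apply: (@leb_integrableMb _ _ _ _ l) => //; first by apply: measurable_fun_onT; mfun.
      move=> w /=; rewrite in_itv/= => /andP[w0 wl].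
      by rewrite ger0_norm ?ramp_ge0//; apply: (ramp_le (ltW l0)); rewrite lerBlDr (le_trans (ltW xl'))// lerDl ltW.
    rewrite [X in _ = _ + X](_ : _ = s * \int[mu]_(w in `]0, l[) (ramp (x - w) * g0 w) -
        \int[mu]_(w in `]0, l[) (ramp (x - w) * b w)); first by ring.
    have r1 := rmul _ g0i; have r2 := rmul _ bi.
    rewrite -leb_RintZl// -leb_RintB//; last exact: leb_integrableZl.
    by apply: leb_eq_Rint => w _; ring.
  have E2 : s * Us = a x + W - expR (- s * T) * (a x + \int[mu]_(t in `]0, T[) ut x t).
    rewrite -(laplace_primitive T0 i1 (a x) sp); congr (_ * _).
    have Fi : mu.-integrable `]0, T[ (EFin \o (fun t => a x + \int[mu]_(s in `]0, t[) ut x s)).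
      by apply: leb_integrableD => //; apply: leb_integrable_cst => //; exact: leb_itv_lty.
    apply: leb_ae_eq_Rint => //.
    * exact: leb_measurable (damped1 s0 i3).
    * exact: leb_measurable (damped1 s0 Fi).
    * by apply: (leb_ae_imp f2) => t ft tT; rewrite ft.
  have E3 : \int[mu]_(t in `]0, T[) (expR (- s * t) * caputo alpha (ut x) t) = g0 x - p x * Us.
    have d2 := damped1 s0 i2; have d3 := damped1 s0 i3.
    rewrite /g0 /Us -leb_RintZl// -leb_RintB//; last exact: leb_integrableZl.
    apply: leb_ae_eq_Rint => //.
    * by apply: measurable_funM => //; exact: measurable_caputo.
    * exact: leb_measurable (leb_integrableB mIT d2 (leb_integrableZl (p x) mIT d3)).
    * by apply: (leb_ae_imp f3) => t ft tT; rewrite ft//; ring.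
  have E4 := laplace_caputo alpha0 alpha1 i1 s1.
  rewrite E3 -/W in E4.
  have ssa : s * s `^ (alpha - 1) = s `^ alpha by rewrite mulr_powRB1.
  pose It := \int[mu]_(t in `]0, T[) ut x t.
  have It_le : `|It| <= h x by exact: le_normr_Rintegral.
  have -> : g x - rhs x = s * (g0 x - p x * Us - s `^ (alpha - 1) * W) +
      s `^ alpha * (expR (- s * T) * (a x + It)).
    rewrite /rhs -E1 /g ks -ssa.
    have -> : W = s * Us - a x + expR (- s * T) * (a x + It) by rewrite E2 -/It; ring.
    by ring.
  rewrite (le_trans (ler_normD _ _))//.
  apply: (@le_trans _ _ (s `^ alpha * expR (- s * T) * h x +
      s `^ alpha * expR (- s * T) * (`|a x| + h x))).
    apply: lerD.
      rewrite normrM ger0_norm// -ssa -!mulrA ler_wpM2l//.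
      by move: E4; rewrite -!mulrA.
    rewrite !normrM (ger0_norm sa0) ger0_norm ?expR_ge0// mulrA ler_wpM2l ?mulr_ge0 ?expR_ge0//.
    by rewrite (le_trans (ler_normD _ _))// lerD2l.
  by rewrite -mulrDr le_eqVlt; apply/orP; left; apply/eqP; ring.
Qed.

End solution_transform.

(** * Laplace variables and coefficients *)

Section assembly.
Context {R : realType}.
Local Notation mu := (@lebesgue_measure R).
Let mI (a b : R) : measurable (`]a, b[ : set R). Proof. exact: measurable_itv. Qed.

(** For the integers k = n and s = k^(2 / alpha) one has s^alpha = k^2. As s >=
    k^2 the truncation error e^(-sT) is eventually below e^(-kl), and a power of
    k is absorbed by lowering the rate from l to lam. *)
Lemma powR_rate (alpha l T lam c : R) : 0 < alpha -> alpha < 1 -> 0 < l -> 0 < T -> lam < l ->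
  exists C n0, 0 <= C /\ forall n, (n0 <= n)%N -> let k : R := n%:R in let s := k `^ (2 / alpha) in
    [/\ 1 <= k /\ c <= k, s `^ alpha = k ^+ 2, k <= s /\ k ^+ 2 <= s,
      expR (- s * T) <= expR (- k * l) & s * expR (- k * l) <= C * expR (- k * lam)].
Proof.
move=> al0 al1 l0 T0 laml.
have r2 : 2 <= 2 / alpha by rewrite ler_pdivlMr// ler_piMr// ltW.
have [N rN] : exists N : nat, 2 / alpha <= N.+1%:R.
  exists (Num.bound (2 / alpha)).
  rewrite (le_trans (ltW (archi_boundP _)))//; last by rewrite ler_nat.
  by rewrite divr_ge0// ltW.
have d0 : 0 < l - lam by rewrite subr_gt0.
exists (N.+1`!%:R / (l - lam) ^+ N.+1), (Num.bound `|1 + `|c| + l / T|).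
split; first by rewrite divr_ge0// exprn_ge0// ltW.
move=> n nn k s.
have kb : 1 + `|c| + l / T <= k.
  rewrite (le_trans (ler_norm _))// (le_trans (ltW (archi_boundP (normr_ge0 _))))//.
  by rewrite ler_nat.
have lT0 : 0 <= l / T by rewrite divr_ge0// ltW.
have k1 : 1 <= k by have := normr_ge0 c; lra.
have k0 : 0 < k by exact: lt_le_trans k1.
have k2s : k ^+ 2 <= s by rewrite -powR_mulrn ?(ltW k0)//; exact: ler_powR.
have ks : k <= s.
  by apply: le_trans k2s; rewrite expr2 ler_peMr// ltW.
split => //.
- by split => //; have := ler_norm c; have := normr_ge0 c; lra.
- by rewrite /s -powRrM divfK ?gt_eqF// powR_mulrn// ltW.
- rewrite ler_expR !mulNr lerN2; apply: (@le_trans _ _ (k ^+ 2 * T)); last by rewrite ler_wpM2r// ltW.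
  rewrite expr2 -mulrA ler_wpM2l ?(ltW k0)//.
  by rewrite -ler_pdivrMr//; have := normr_ge0 c; lra.
- have sN : s <= k ^+ N.+1 by rewrite -powR_mulrn ?(ltW k0)//; exact: ler_powR.
  have kd : 0 <= k * (l - lam) by rewrite mulr_ge0// ltW.
  have F0 : (0 : R) < N.+1`!%:R by rewrite ltr0n fact_gt0.
  have e1 : (k * (l - lam)) ^+ N.+1 / N.+1`!%:R <= expR (k * (l - lam)).
    by apply: le_trans (expR_ge1Dxn N kd); rewrite lerDr.
  have dN : 0 < (l - lam) ^+ N.+1 by rewrite exprn_gt0.
  have e2 : k ^+ N.+1 <= N.+1`!%:R / (l - lam) ^+ N.+1 * expR (k * (l - lam)).
    by rewrite mulrAC ler_pdivlMr// -exprMn [leRHS]mulrC -ler_pdivrMr.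
  have -> : expR (- k * lam) = expR (k * (l - lam)) * expR (- k * l).
    by rewrite -expRD; congr expR; ring.
  rewrite mulrA ler_wpM2r ?expR_ge0//; exact: le_trans e2.
Qed.

Lemma Ck_bounded (l : R) (f : R -> R) : 0 < l -> {within `[0, l], continuous f} ->
  let fc := fun x => f (clamp l x) in
  continuous fc /\ exists2 B, 0 <= B & forall x, `|fc x| <= B.
Proof.
move=> l0 cf fc; have cfc : continuous fc by apply: continuous_comp_clamp => //; exact: ltW.
split => //; have [B fB] := continuous_bounded_itv 0 l cfc.
have h x : `|fc x| <= B.
  have /andP[h1 h2] := clamp_in x (ltW l0).
  by have := fB _ h1 h2; rewrite /fc [clamp l (clamp l x)]clamp_id.
by exists B => //; exact: le_trans (h 0).
Qed.

(** The derivative a'(0) is the value at 0 of the continuous extension of a'. *)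
Lemma Ck2_taylor2 (l : R) (a : R -> R) : 0 < l -> Ck l 2 a ->
  exists2 b, {within `[0, l], continuous b} &
  exists a1, forall x, `]0, l[%classic x -> a x = taylor2 l (a 0) a1 b x.
Proof.
move=> l0 [ca [a' [ca' [b [cb _] da']] da]]; exists b => //; exists (a' 0) => x.
rewrite /= in_itv/= => /andP[x0 xl].
rewrite (Ck_FTC ca ca' da x0 (ltW xl)).
have cintegrable (f : R -> R) : {within `[0, l], continuous f} -> mu.-integrable `]0, l[ (EFin \o f).
  move=> cf; apply: (@leb_integrableS R `[0, l]); [exact: measurable_itv|exact: mI| |].
    by apply: subset_itvW; rewrite bnd_simp.
  by apply: continuous_compact_integrable; first exact: segment_compact.
apply: taylor2_integral => //; [exact: ltW|exact: cintegrable| |].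
  apply: leb_measurable (leb_integrableS (mI 0 l) (mI 0 x) _ (cintegrable _ ca')).
  by apply: subset_itvl; rewrite bnd_simp ltW.
apply: aeW => y /=; rewrite in_itv/= => /andP[y0 yl].
exact: (Ck_FTC ca' cb da' y0 (ltW yl)).
Qed.

(** The equation involves the coefficients on ]0, l[ only, so they may be
    replaced by bounded continuous extensions to the line. *)
Lemma is_solution_clamp (l T alpha : R) (p a : R -> R) (u : R -> R -> R) : 0 < l ->
  is_solution l T alpha p a u ->
  is_solution l T alpha (fun x => p (clamp l x)) (fun x => a (clamp l x)) u.
Proof.
move=> l0 [ut [ux [uxx [h1 h2 [N [mN N0 hN]] [U [U1 U2 U3 U4]] h5]]]].
exists ut, ux, uxx; split => //.
  exists N; split => // z nz; apply: hN => hz; apply: nz => z1 z2.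
  rewrite hz// clamp_id//; move: z1; rewrite in_itv/= => /andP[*]; exact: ltW.
exists U; split => //; apply: (leb_ae_imp U4) => x hx xl; rewrite hx//.
by rewrite clamp_id//; move: xl; rewrite in_itv/= => /andP[*]; exact: ltW.
Qed.

End assembly.

(** * Equality of the potentials *)

Section uniqueness.
Context {R : realType}.
Local Notation mu := (@lebesgue_measure R).
Let mI (a b : R) : measurable (`]a, b[ : set R). Proof. exact: measurable_itv. Qed.
Context (l T alpha : R) (l0 : 0 < l) (T0 : 0 < T) (al0 : 0 < alpha) (al1 : alpha < 1).
Context (p q a b : R -> R) (a0 a1 M : R) (M0 : 0 <= M).
Context (cp : continuous p) (cq : continuous q) (ca : continuous a) (cb : continuous b).
Context (pM : forall z, `|p z| <= M) (qM : forall z, `|q z| <= M)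
  (aM : forall z, `|a z| <= M) (bM : forall z, `|b z| <= M).
Context (aE : forall x, `]0, l[%classic x -> a x = taylor2 l a0 a1 b x).
Context (u v : R -> R -> R).
Context (hu : is_solution l T alpha p a u) (hv : is_solution l T alpha q a v).
Context (huv : same_trace0 l T u v).

Let mp := continuous_measurable cp.
Let mq := continuous_measurable cq.
Let ma := continuous_measurable ca.
Let mb := continuous_measurable cb.

Let bint (f : R -> R) : continuous f -> (forall z, `|f z| <= M) ->
  mu.-integrable `]0, l[ (EFin \o f).
Proof.
move=> cf fM; apply: (@leb_integrable_bnd _ _ _ M) => //; first exact: leb_itv_lty.
by apply: measurable_fun_onT; exact: continuous_measurable.
Qed.

(** The value at 0 of the transform of the solution is, up to an error of the
    order of s e^(-kl), the value at 0 of the solution rh of the integral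
    equation with the same potential: the quantities in boundary_value_estimate
    are at most of the order of k s, and they are divided by k. *)
Let boundary_gap (r : R -> R) (w wt wx wxx : R -> R -> R) : continuous r ->
  (forall z, `|r z| <= M) ->
  W11L2_with l T w wt -> L2H2_with l T w wx wxx ->
  {ae (mu \x mu)%E, forall z : R * R, z.1 \in `]0, l[ -> z.2 \in `]0, T[ ->
        caputo alpha (wt z.1) z.2 = wxx z.1 z.2 - r z.1 * w z.1 z.2} ->
  has_initial_value l T w a ->
  {ae mu, forall t, t \in `]0, T[ -> has_trace0 l (wx ^~ t) 0} ->
  {ae mu, forall t, t \in `]0, T[ -> exists c, has_trace0 l (w ^~ t) c} ->
  exists2 B : R, 0 <= B & forall (k s Dh : R) (rh : R -> R),
    1 <= k -> 2 * M * l <= k -> s `^ alpha = k ^+ 2 -> k <= s -> k ^+ 2 <= s ->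
    expR (- s * T) <= expR (- k * l) ->
    measurable_fun setT rh -> (forall y, 0 <= y -> y <= l -> `|rh y| <= Dh) ->
    (forall y, 0 <= y -> y <= l -> rh y =
      \int[mu]_(z in `]0, l[) (neumann k y z * (b z - r z * a z)) + a1 * neumann k y 0
      - \int[mu]_(z in `]0, l[) (neumann k y z * (r z * rh z))) ->
    `|s * \int[mu]_(t in `]0, T[) (expR (- s * t) * boundary_mean l w wxx t) - a0 - rh 0| <=
    B * (s * expR (- k * l)).
Proof.
move=> cr rM h1 h2 h3 h4 h5 h6; have mr := continuous_measurable cr.
have [A A0 hA] := solution_resolvent l0 T0 al0 al1 mr rM (bint ca aM) (bint cb bM) aE h1 h2 h3 h4 h5 h6.
have a10 := normr_ge0 a1.
exists (2 * (`|a1| + 3 * A + `|a1| * l + l * A)).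
  by rewrite mulr_ge0 ?addr_ge0 ?mulr_ge0// ltW.
move=> k s Dh rh k1 Mk sk ks k2s esk mrh rhD rhE.
have k0 : 0 < k by exact: lt_le_trans k1.
have s1 : 1 <= s by exact: le_trans ks.
have [g [e [gi ei gE [gA vA] eA]]] := hA s k s1 (esym sk).
have := boundary_value_estimate l0 k0 mr ma mb rM aM bM Mk mrh rhD rhE gi ei gE.
set v0 := _ - a0 in vA *.
set Ig := \int[mu]_(z in _) `|g z| in gA *; set Ie := \int[mu]_(z in _) `|e z| in eA *.
move/le_trans; apply.
set E := expR (- k * l).
have E0 : 0 <= E by exact: expR_ge0.
have eA' : Ie <= E * (k * s * A).
  rewrite sk in eA; apply: (le_trans eA); rewrite mulrC [leRHS]mulrC -!mulrA.
  have : k ^+ 2 * expR (- s * T) <= k * s * E.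
    apply: ler_pM => //; rewrite ?sqr_ge0 ?expR_ge0//.
    by apply: (le_trans k2s); rewrite ler_peMl// (le_trans _ s1).
  move=> h; have := ler_wpM2r A0 h; rewrite -!mulrA => h'; apply: (le_trans h').
  by rewrite le_eqVlt; apply/orP; left; apply/eqP; ring.
have s0 : 0 <= s by exact: le_trans s1.
have b1 : `|a1| <= k * s * `|a1| by rewrite ler_peMl// mulr_ege1.
have b2 : Ig <= k * s * A.
  by apply: (le_trans gA); rewrite mulrC -mulrA ler_peMl// mulr_ge0.
have b3 : k * (`|v0| + `|a1| * l + l * Ig) <= k * s * (A + `|a1| * l + l * A).
  rewrite -mulrA ler_wpM2l ?(ltW k0)// !mulrDr; apply: lerD; first apply: lerD.
  - by rewrite mulrC.
  - by rewrite ler_peMl// mulr_ge0// ltW.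
  - by rewrite mulrCA ler_wpM2l ?(ltW l0)// mulrC.
apply: (@le_trans _ _ (2 * k^-1 * (E * (k * s * `|a1| + k * s * A + k * s * (A + `|a1| * l + l * A)) + E * (k * s * A)))).
  apply: ler_wpM2l; first by rewrite mulr_ge0// invr_ge0 ltW.
  apply: lerD => //; apply: ler_wpM2l => //; apply: lerD => //; exact: lerD.
rewrite le_eqVlt; apply/orP; left; apply/eqP; field.
by rewrite gt_eqF.
Qed.

(** The functions laplace k m and laplace k m + laplace k d are the resolvents
    of q and p. Both boundary values are close to the same number computed from
    the common trace, so laplace k (d 0) is small. *)
Lemma equal_potentials : (forall x, x \in `[0, l] -> a x != 0) ->
  forall x, x \in `[0, l] -> p x = q x.
Proof.
move=> an0.
(* c >= 2 l M, and every k > c is large enough for resolvent_bound *)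
pose c := 2 * l * M + 1.
have c0 : 0 < c by rewrite ltr_wpDl// !mulr_ge0// ltW.
have lMc : l * M / c <= 2^-1.
  rewrite ler_pdivrMr// /c; lra.
have [K [m [d [K0 [mm md] [mK dK] mE dE]]]] :=
  wave_families l0 c0 M0 lMc a1 mp mq ma mb pM qM aM bM.
apply: (potential_unique l0 c0 M0 K0 cp cq ca pM qM aM mm md mK dK dE) => // lam laml.
have [ut [ux [uxx [u1 u2 u3 u4 u5]]]] := hu.
have [vt [vx [vxx [v1 v2 v3 v4 v5]]]] := hv.
have tu : {ae mu, forall t, t \in `]0, T[ -> exists c, has_trace0 l (u ^~ t) c}.
  by apply: (leb_ae_imp huv) => t h /h[e eu _]; exists e.
have tv : {ae mu, forall t, t \in `]0, T[ -> exists c, has_trace0 l (v ^~ t) c}.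
  by apply: (leb_ae_imp huv) => t h /h[e _ ev]; exists e.
have [Bu Bu0 hBu] := boundary_gap cp pM u1 u2 u3 u4 u5 tu.
have [Bv Bv0 hBv] := boundary_gap cq qM v1 v2 v3 v4 v5 tv.
have [C [n0 [C0 rate]]] := powR_rate (c + 1) al0 al1 l0 T0 laml.
exists ((Bu + Bv) * C), n0 => n nn.
have [] := rate n nn; set k : R := n%:R; set s := k `^ (2 / alpha).
move=> [k1 ck1] sk [ks k2s] esT sC.
have ck : c < k by rewrite (lt_le_trans _ ck1)// ltrDl.
have Mk : 2 * M * l <= k by apply: ltW; apply: lt_trans ck; rewrite /c; lra.
have k0 : 0 < k by exact: lt_le_trans k1.
have lb y := laplace_profile_bound l0 M0 mp mq pM qM K0 mm md mK dK y ck1.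
have ml : measurable_fun setT (fun y => laplace k (m y)) by exact: measurable_laplace.
have ld : measurable_fun setT (fun y => laplace k (d y)) by exact: measurable_laplace.
pose ru y := laplace k (m y) + laplace k (d y).
pose rv y := laplace k (m y).
have prof y : 0 <= y -> rv y = _ := fun y0 =>
  laplace_profile l0 c0 M0 mq ma mb qM aM bM K0 mm mK mE ck y0.
have diff y : 0 <= y -> laplace k (d y) = _ := fun y0 =>
  laplace_difference l0 c0 M0 mp mq ma pM qM aM K0 mm md mK dK dE ck y0.
have ni (y B : R) (h : R -> R) : 0 <= y -> measurable_fun setT h ->
   (forall z, `|h z| <= B) ->
   mu.-integrable `]0, l[ (EFin \o (fun z => neumann k y z * h z)).
  move=> y0 mh' hB; apply: (@leb_integrable_bnd _ _ _ (k^-1 * B)) => //; first exact: leb_itv_lty.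
    by apply: measurable_fun_onT; apply: measurable_funM => //; apply: measurable_neumann; mfun.
  move=> z /=; rewrite in_itv/= => /andP[/ltW z0 /ltW zl]; rewrite normrM ler_pM ?hB//.
  by rewrite ger0_norm ?neumann_ge0// neumann_le_inv.
have ruE y : 0 <= y -> y <= l -> ru y =
      \int[mu]_(z in `]0, l[) (neumann k y z * (b z - p z * a z)) + a1 * neumann k y 0
      - \int[mu]_(z in `]0, l[) (neumann k y z * (p z * ru z)).
  move=> y0 yl; rewrite /ru -/(rv y) prof// diff// -/(rv).
  have bnd (f1 g1 : R -> R) (B1 B2 z : R) : `|f1 z| <= B1 -> `|g1 z| <= B2 -> `|f1 z * g1 z| <= B1 * B2.
    by move=> h1 h2; rewrite normrM ler_pM.
  have i1 : mu.-integrable `]0, l[ (EFin \o (fun z => neumann k y z * (b z - q z * a z))).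
    apply: (ni y (M + M * M)) => //; first by mfun.
    by move=> z; rewrite (le_trans (ler_normB _ _))// lerD// normrM ler_pM.
  have i2 : mu.-integrable `]0, l[ (EFin \o (fun z => neumann k y z * (q z * laplace k (m z)))).
    apply: (ni y (M * K)) => //; first by mfun.
    by move=> z; rewrite normrM ler_pM// (lb z).1.
  have i3 : mu.-integrable `]0, l[ (EFin \o (fun z => neumann k y z *
      ((p z - q z) * (a z + laplace k (m z)) + p z * laplace k (d z)))).
    apply: (ni y ((M + M) * (M + K) + M * (K * (2 * M * l)))) => //; first by mfun.
    move=> z; have [l1 l2] := lb z.
    rewrite (le_trans (ler_normD _ _))// lerD// normrM ler_pM//.
      by rewrite (le_trans (ler_normB _ _))// lerD.
    by rewrite (le_trans (ler_normD _ _))// lerD.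
  have i4 : mu.-integrable `]0, l[ (EFin \o (fun z => neumann k y z * (b z - p z * a z))).
    apply: (ni y (M + M * M)) => //; first by mfun.
    by move=> z; rewrite (le_trans (ler_normB _ _))// lerD// normrM ler_pM.
  have i5 : mu.-integrable `]0, l[ (EFin \o (fun z => neumann k y z *
      (p z * (laplace k (m z) + laplace k (d z))))).
    apply: (ni y (M * (K + K * (2 * M * l)))) => //; first by mfun.
    move=> z; have [l1 l2] := lb z.
    by rewrite normrM ler_pM// (le_trans (ler_normD _ _))// lerD.
  have E : \int[mu]_(z in `]0, l[) (neumann k y z * (b z - p z * a z)) -
     \int[mu]_(z in `]0, l[) (neumann k y z * (p z * (laplace k (m z) + laplace k (d z)))) =
     \int[mu]_(z in `]0, l[) (neumann k y z * (b z - q z * a z)) -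
     \int[mu]_(z in `]0, l[) (neumann k y z * (q z * laplace k (m z))) -
     \int[mu]_(z in `]0, l[) (neumann k y z *
      ((p z - q z) * (a z + laplace k (m z)) + p z * laplace k (d z))).
    rewrite -leb_RintB// -leb_RintB// -leb_RintB//; last exact: leb_integrableB.
    by apply: leb_eq_Rint => z _; ring.
  by rewrite [RHS]addrAC E; ring.
have same : \int[mu]_(t in `]0, T[) (expR (- s * t) * boundary_mean l u uxx t) =
            \int[mu]_(t in `]0, T[) (expR (- s * t) * boundary_mean l v vxx t).
  have bu := integrable_boundary_mean l0 u1 u2.
  have bv := integrable_boundary_mean l0 v1 v2.
  have me : measurable_fun (`]0, T[ : set R) (fun t => expR (- s * t)) by apply: measurable_fun_onT; mfun.
  apply: leb_ae_eq_Rint => //.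
  - by apply: measurable_funM => //; exact: leb_measurable bu.
  - by apply: measurable_funM => //; exact: leb_measurable bv.
  - apply: (leb_ae_imp2 huv (leb_ae_and (boundary_meanE l0 u1 u2 u5) (boundary_meanE l0 v1 v2 v5))).
    move=> t h [hu' hv'] tT; have [e eu ev] := h tT.
    by rewrite (hu' tT e eu).1 (hv' tT e ev).1.
have rub y : 0 <= y -> y <= l -> `|ru y| <= K + K * (2 * M * l).
  by move=> _ _; exact: le_trans (ler_normD _ _) (lerD (lb y).1 (lb y).2).
have gu := hBu k s _ ru k1 Mk sk ks k2s esT (measurable_funD ml ld) rub ruE.
have gv := hBv k s K rv k1 Mk sk ks k2s esT ml (fun y _ _ => (lb y).1) (fun y y0 _ => prof y y0).
rewrite -same in gv.
rewrite (_ : laplace k (d 0) = (s * \int[mu]_(t in `]0, T[) (expR (- s * t) * boundary_mean l u uxx t) - a0 - rv 0) - (s * \int[mu]_(t in `]0, T[) (expR (- s * t) * boundary_mean l u uxx t) - a0 - ru 0)); last first.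
  by rewrite /ru /rv; ring.
apply: (le_trans (ler_normB _ _)); apply: (le_trans (lerD gv gu)).
have Buv : 0 <= Bu + Bv by exact: addr_ge0.
rewrite -mulrDl [Bv + Bu]addrC -mulrA; exact: (ler_wpM2l Buv sC).
Qed.

End uniqueness.

Theorem theorem1 (R : realType) (l T alpha : R)
  (hl : 0 < l) (hT : 0 < T) (halpha0 : 0 < alpha) (halpha1 : alpha < 1)
  (p q a : R -> R) (hp : Ck l 1 p) (hq : Ck l 1 q) (ha : Ck l 2 a)
  (u v : R -> R -> R)
  (hu1 : W11L2 l T u) (hu2 : L2H2 l T u)
  (hv1 : W11L2 l T v) (hv2 : L2H2 l T v)
  (hu : is_solution l T alpha p a u)
  (hv : is_solution l T alpha q a v)
  (ha0 : forall x, x \in `[0, l] -> `|a x| != 0)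
  (huv : same_trace0 l T u v) :
  forall x, x \in `[0, l] -> p x = q x.
Proof.
have [b cb [a1 aE]] := Ck2_taylor2 hl ha.
have [cp [Bp Bp0 pB]] := Ck_bounded hl hp.1.
have [cq [Bq Bq0 qB]] := Ck_bounded hl hq.1.
have [ca [Ba Ba0 aB]] := Ck_bounded hl ha.1.
have [cb' [Bb Bb0 bB]] := Ck_bounded hl cb.
pose M := Bp + Bq + Ba + Bb.
have M0 : 0 <= M by rewrite !addr_ge0.
have aE' x : `]0, l[%classic x -> a (clamp l x) = taylor2 l (a 0) a1 (fun x => b (clamp l x)) x.
  move=> /[dup] xl /=; rewrite in_itv/= => /andP[x0 xl'].
  rewrite clamp_id ?ltW// aE// /taylor2; congr (_ + _); apply: leb_eq_Rint => w /=.
  by rewrite in_itv/= => /andP[w0 wl]; rewrite clamp_id ?ltW.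
have H := equal_potentials hl hT halpha0 halpha1 M0 cp cq ca cb' _ _ _ _ aE'
  (is_solution_clamp hl hu) (is_solution_clamp hl hv) huv _.
move=> x /[dup] xl; rewrite in_itv/= => /andP[x0 xl'].
rewrite -(clamp_id x0 xl'); apply: H => // [z|z|z|z|y].
- by rewrite (le_trans (pB z))// /M; lra.
- by rewrite (le_trans (qB z))// /M; lra.
- by rewrite (le_trans (aB z))// /M; lra.
- by rewrite (le_trans (bB z))// /M; lra.
- rewrite in_itv/= => /andP[y0 yl]; rewrite clamp_id// -normr_eq0.
  by apply: ha0; rewrite in_itv/= y0.
Qed.
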